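(* Let $n=2q\ge 2$ be even and let $L$ be the differential operator in $L^2(0,1)$ generated by the differential expression $$l(y)=D^ny+\sum_{k=0}^{n-2}p_k(x)D^ky,\qquad D=-i\,d/dx,\quad p_k\in L^1(0,1),$$ and by $n$ linearly independent normalized two-point boundary conditions with leading coefficient vectors $b_j^0,b_j^1$, $j=0,\dots,n-1$. If $L$ is dissipative, then $L$ is Birkhoff-regular, i.e. $\Theta(b^0,b^1)\neq 0$.
   Context: Normalized boundary conditions: for $j=0,\dots,n-1$, $$U_j(y)\equiv b_j^0D^jy(0)+b_j^1D^jy(1)+\ldots=0,$$ where the dots denote a linear combination (with vector coefficients) of the values $D^ky(0),D^ky(1)$ with $k<j$. Here $b_j^0,b_j^1$ are column vectors of length $r_j$, with $0\le r_j\le 2$, $\sum_{j=0}^{n-1}r_j=n$ and $\operatorname{rank}(b_j^0\; b_j^1)=r_j$. If $r_j=0$ there is no condition of order $j$; if $r_j=2$ one takes $(b_j^0\; b_j^1)$ to be the $2\times2$ identity matrix. The operator $L$ acts by $Ly=l(y)$ on the domain of all $y\in L^2(0,1)$ such that $y,\dots,y^{(n-1)}$ are absolutely continuous on $[0,1]$, $l(y)\in L^2(0,1)$ and $U_j(y)=0$ for all $j$. Dissipative means $\operatorname{Im}(Ly,y)\ge 0$ for all $y$ in the domain of $L$ (so that $\|(L-\lambda)^{-1}\|\le|\operatorname{Im}\lambda|^{-1}$ for $\operatorname{Im}\lambda<0$). Regularity determinants: let $q=\lfloor n/2\rfloor$, $\varepsilon_k=\exp(2\pi i k/n)$. For $i=0,1$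 and $k=0,\dots,n-1$ let $B_k^i\in\mathbb{C}^n$ be the column obtained by stacking the blocks $b_j^i\varepsilon_k^j$, $j=0,\dots,n-1$. For $0\le p\le n$ let $\mathbf{\Theta}_p(b^0,b^1)$ be the $n\times n$ matrix with columns $B_0^0,\dots,B_{p-1}^0,B_p^1,\dots,B_{n-1}^1$, let $\Theta_p(b^0,b^1)$ be its determinant, and set $\Theta(b^0,b^1)=\Theta_q(b^0,b^1)$. For $n=2q$ even, $L$ is called Birkhoff-regular if $\Theta(b^0,b^1)\ne0$. *)

(* Defs.v *)
From HB Require Import structures.
From mathcomp Require Import all_boot all_order all_algebra.
From mathcomp Require Import all_classical all_reals all_analysis.
From mathcomp Require Import complex.

Set Implicit Arguments.
Unset Strict Implicit.
Unset Printing Implicit Defensive.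

Import Order.TTheory GRing.Theory Num.Theory.
Import numFieldNormedType.Exports.
Import ComplexField.

Local Open Scope classical_set_scope.
Local Open Scope ring_scope.
Local Open Scope complex_scope.

Section FunctionsOnUnitInterval.
Variable R : realType.

Local Notation mu := (@lebesgue_measure R).
Local Notation I01 := (`]0%R, 1%R[%classic : set R).

(* A function on [0, 1] is a total function on R whose values outside [0, 1]
   are never used. Measurability is Borel, which is no restriction for classes
   modulo a.e. equality. *)

Definition inL1 (f : R -> R[i]) : Prop :=
  mu.-integrable I01 (fun x => (complex.Re (f x))%:E) /\
  mu.-integrable I01 (fun x => (complex.Im (f x))%:E).

Definition inL2 (f : R -> R[i]) : Prop :=
  [/\ measurable_fun I01 (fun x => complex.Re (f x)),
      measurable_fun I01 (fun x => complex.Im (f x)) &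
      mu.-integrable I01 (fun x => (Normc.normc (f x) ^+ 2)%:E)].

Definition cintegral (f : R -> R[i]) : R[i] :=
  (\int[mu]_(x in I01) complex.Re (f x)) +i*
  (\int[mu]_(x in I01) complex.Im (f x)).

Definition inner (f g : R -> R[i]) : R[i] :=
  cintegral (fun x => f x * conjc (g x)).

(* The intervals ]a i, b i[ may share endpoints but do not overlap. *)
Definition abs_continuous01 (f : R -> R[i]) : Prop :=
  forall e : R, 0 < e -> exists2 d : R, 0 < d &
    forall (m : nat) (a b : 'I_m -> R),
      (forall i, [/\ 0 <= a i, a i <= b i & b i <= 1]) ->
      (forall i j, i != j -> b i <= a j \/ b j <= a i) ->
      \sum_(i < m) (b i - a i) < d ->
      \sum_(i < m) Normc.normc (f (b i) - f (a i)) < e.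

(* The limit runs over t in [0, 1] only, so derivatives at 0 and 1 are
   one-sided. *)
Definition diff_quotient (f : R -> R) (x t : R) : R := (f t - f x) / (t - x).

Definition nbhs01 (x : R) : set_system R := within `[0, 1]%classic x^'.

Definition rderivable01 (f : R -> R) (x : R) : Prop :=
  cvg (diff_quotient f x t @[t --> nbhs01 x]).

Definition rderiv01 (f : R -> R) (x : R) : R :=
  lim (diff_quotient f x t @[t --> nbhs01 x]).

Definition derivable01 (f : R -> R[i]) (x : R) : Prop :=
  rderivable01 (fun t => complex.Re (f t)) x /\
  rderivable01 (fun t => complex.Im (f t)) x.

Definition deriv01 (f : R -> R[i]) (x : R) : R[i] :=
  rderiv01 (fun t => complex.Re (f t)) x +i*
  rderiv01 (fun t => complex.Im (f t)) x.

Definition derivn01 (k : nat) (f : R -> R[i]) : R -> R[i] := iter k deriv01 f.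

(* D = -i d/dx *)
Definition Dn (k : nat) (f : R -> R[i]) (x : R) : R[i] :=
  (0 -i* 1) ^+ k * derivn01 k f x.

(* For y in the domain of L the derivative of order n exists only a.e.; at the
   remaining points [lim] takes a default value, irrelevant in L^2. *)
Definition diff_expr (n : nat) (p : 'I_n.-1 -> R -> R[i]) (y : R -> R[i])
    (x : R) : R[i] :=
  Dn n y x + \sum_(k < n.-1) p k x * Dn k y x.

End FunctionsOnUnitInterval.

Section BoundaryConditions.
Variables (R : realType) (n : nat).

(* [bc_a0 j k] and [bc_a1 j k] are the coefficients of D^k y(0) and D^k y(1)
   in U_j; they are used only for k < j. *)
Record normalized_bc := NormalizedBC {
  bc_r : 'I_n -> nat;
  bc_b0 : forall j, 'cV[R[i]]_(bc_r j);
  bc_b1 : forall j, 'cV[R[i]]_(bc_r j);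
  bc_a0 : forall j, 'I_n -> 'cV[R[i]]_(bc_r j);
  bc_a1 : forall j, 'I_n -> 'cV[R[i]]_(bc_r j);
  bc_r_le2 : forall j, (bc_r j <= 2)%N;
  bc_r_sum : (\sum_(j < n) bc_r j)%N = n;
  bc_rank : forall j, \rank (row_mx (bc_b0 j) (bc_b1 j)) = bc_r j;
  bc_id2 : forall j, bc_r j = 2%N ->
    forall s t, row_mx (bc_b0 j) (bc_b1 j) s t = ((s : nat) == t)%:R
}.

(* U_j as a linear form in z0 k = D^k y(0) and z1 k = D^k y(1) *)
Definition bc_form (U : normalized_bc) (j : 'I_n) (z0 z1 : 'I_n -> R[i]) :
    'cV[R[i]]_(bc_r U j) :=
  z0 j *: bc_b0 U j + z1 j *: bc_b1 U j
  + \sum_(k < n | (k < j)%N) (z0 k *: bc_a0 U j k + z1 k *: bc_a1 U j k).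

Definition bc_eval (U : normalized_bc) (j : 'I_n) (y : R -> R[i]) :
    'cV[R[i]]_(bc_r U j) :=
  bc_form U j (fun k => Dn k y 0) (fun k => Dn k y 1).

(* The n scalar conditions are automatically linearly independent. *)
Lemma bc_independent (U : normalized_bc)
    (c : forall j, 'rV[R[i]]_(bc_r U j)) :
  (forall z0 z1, \sum_(j < n) c j *m bc_form U j z0 z1 = 0) ->
  forall j, c j = 0.
Proof.
move=> c0 j; have [m] := ubnP (n - j); elim: m j => // m IHm j ltm.
pose dl (a : R[i]) (k : 'I_n) : R[i] := if k == j then a else 0.
have E a1 a2 : c j *m (a1 *: bc_b0 U j + a2 *: bc_b1 U j) = 0.
  rewrite -{}[RHS](c0 (dl a1) (dl a2)) (bigD1 j) //= [\sum_(i < n | _) _]big1 ?addr0.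
    rewrite /bc_form /dl eqxx [\sum_(k < n | _) _]big1 ?addr0 // => k ltkj.
    have /negPf-> : k != j by rewrite neq_ltn ltkj.
    by rewrite !scale0r addr0.
  move=> i neij; case: (ltngtP i j) => [ltij|ltji|/val_inj eij].
  - rewrite /bc_form /dl (negPf neij) !scale0r !add0r big1 ?mulmx0 // => k ltki.
    have /negPf-> : k != j by rewrite neq_ltn (ltn_trans ltki ltij).
    by rewrite !scale0r addr0.
  - rewrite IHm ?mul0mx //; apply: leq_trans (ltnSE ltm).
    by rewrite ltn_sub2l.
  - by rewrite eij eqxx in neij.
have /row_freeP[B fB] : row_free (row_mx (bc_b0 U j) (bc_b1 U j)).
  by apply/eqP; exact: bc_rank.
rewrite -[LHS]mulmx1 -fB mulmxA mul_mx_row.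
have := E 1 0; rewrite scale1r scale0r addr0 => ->.
have := E 0 1; rewrite scale1r scale0r add0r => ->.
by rewrite row_mx0 mul0mx.
Qed.

Definition root_unity (k : nat) : R[i] :=
  cos (2 * pi * k%:R / n%:R) +i* sin (2 * pi * k%:R / n%:R).

Definition Bcol (r : 'I_n -> nat) (hr : (\sum_(j < n) r j)%N = n)
    (b : forall j, 'cV[R[i]]_(r j)) (k : nat) : 'cV[R[i]]_n :=
  castmx (hr, erefl 1%N) (\mxcol_(j < n) (root_unity k ^+ j *: b j)).

Definition Theta_mx (r : 'I_n -> nat) (hr : (\sum_(j < n) r j)%N = n)
    (b0 b1 : forall j, 'cV[R[i]]_(r j)) (p : nat) : 'M[R[i]]_n :=
  \matrix_(s < n, k < n)
    (if (k < p)%N then Bcol hr b0 k s 0 else Bcol hr b1 k s 0).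

Definition Theta (r : 'I_n -> nat) (hr : (\sum_(j < n) r j)%N = n)
    (b0 b1 : forall j, 'cV[R[i]]_(r j)) : R[i] :=
  \det (Theta_mx hr b0 b1 n./2).

(* This notion of regularity is meant for even n only. *)
Definition birkhoff_regular (U : normalized_bc) : Prop :=
  Theta (bc_r_sum U) (bc_b0 U) (bc_b1 U) != 0.

Variable p : 'I_n.-1 -> R -> R[i].

(* derivn01 k y exists on [0, 1] for k < n, since derivn01 k y is derivable on
   [0, 1] for k.+1 < n. *)
Definition in_domain (U : normalized_bc) (y : R -> R[i]) : Prop :=
  [/\ inL2 y,
      forall k, (k.+1 < n)%N ->
        forall x, 0 <= x <= 1 -> derivable01 (derivn01 k y) x,
      forall k, (k < n)%N -> abs_continuous01 (derivn01 k y),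
      inL2 (diff_expr p y) &
      forall j, bc_eval U j y = 0].

Definition dissipative (U : normalized_bc) : Prop :=
  forall y, in_domain U y -> 0 <= complex.Im (inner (diff_expr p y) y).

End BoundaryConditions.

(* Main.v *)
(* Suppose Theta = 0. A kernel vector of the matrix gives exponential solutions
   of D^n y = lambda y with lambda in the lower half-plane, on [0, +oo[ and on
   ]-oo, 0], whose boundary data zeta0, zeta1 satisfy the leading parts of the
   boundary conditions. Let B(z) = sum_m z_(n-1-m) conj(z_m) be the form of
   Lagrange's identity, 2 Im (D^n y, y) = B(y at 0) - B(y at 1). On data of
   exponentials it is, up to the factor -2 at 0 and 2 at 1, the Gram form of a
   Cauchy matrix, hence B(zeta0) - B(zeta1) < 0.

   On the other hand, for small d > 0 there are y in the domain of L, supported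
   in [0, d] and [1 - d, 1], with data D^j y ~ d^-j zeta_j at the endpoints and
   D^j y = O(d^-j) everywhere. They are found near each endpoint by solving
   D^n y + sum_k p_k D^k y = h, with h a polynomial chosen to meet the boundary
   data, as the fixed point of a map which contracts because the terms
   p_k D^k y, k <= n - 2, are O(d) relative to D^n y in L^1. The same smallness
   gives 2 Im (L y, y) = d^(1-n) (B(zeta0) - B(zeta1) + O(d)), which contradicts
   dissipativity. *)

(* The coefficients are only in L^1, so a smooth cutoff of the exponentials is not admissible: p_k
   D^k y need not lie in L^2. This is why y is made to solve an equation with bounded right-hand
   side: the singular terms are absorbed in y, and l(y) equals a constant times h almost everywhere.
   The exponentials themselves are never formed; only their data sum_k c_k w_k^j at one point enter,
   with w_k^n = -i. As -i is not real and n = 2q, exactly q roots lie in the upper half-plane and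
   their opposites in the lower one, which matches the q columns from b^0 and the q columns from b^1
   in Theta. Lagrange's identity is applied to real polynomials only: y is a polynomial with
   boundary data E plus an n-fold primitive of the lower-order terms, smaller by a factor d. The
   identity is exact for the polynomial, and E differs from the prescribed data by a relative error
   O(d). As d tends to 0, dissipativity gives B(zeta1) <= B(zeta0), while B(zeta0) <= 0 <= B(zeta1);
   both vanish, and definiteness of the Gram forms kills the kernel vector. *)
Require Import Defs.
From HB Require Import structures.
From mathcomp Require Import all_boot all_order all_algebra.
From mathcomp Require Import all_classical all_reals all_analysis.
From mathcomp Require Import measurable_realfun complex zify ring lra.

Set Implicit Arguments.
Unset Strict Implicit.
Unset Printing Implicit Defensive.

Import Order.TTheory GRing.Theory Num.Theory.
Import numFieldNormedType.Exports.
Import ComplexField.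

Local Open Scope classical_set_scope.
Local Open Scope ring_scope.
Local Open Scope complex_scope.

(** * The norm |Re z| + |Im z|, Cauchy matrices and the boundary form *)

Section ComplexNorm1.
Variable R : realType.
Implicit Types z w : R[i].

(** This norm is additive in the real and imaginary parts, so real estimates on integrals and
    primitives add up to complex ones. It is submultiplicative and unchanged by conjugation and by
    powers of i. *)
Definition norm1 z : R := `|complex.Re z| + `|complex.Im z|.

Lemma norm1_ge0 z : 0 <= norm1 z.
Proof. by rewrite addr_ge0. Qed.

Lemma norm1_0 : norm1 0 = 0.
Proof. by rewrite /norm1 /= normr0 addr0. Qed.

Lemma norm1_eq0 z : norm1 z = 0 -> z = 0.
Proof.
case: z => a b; rewrite /norm1 /= => /eqP; rewrite paddr_eq0// !normr_eq0.
by move=> /andP[/eqP-> /eqP->].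
Qed.

Lemma norm1D z w : norm1 (z + w) <= norm1 z + norm1 w.
Proof.
by case: z w => [a b] [c d]; rewrite /norm1 /= addrACA lerD// ler_normD.
Qed.

Lemma norm1N z : norm1 (- z) = norm1 z.
Proof. by case: z => a b; rewrite /norm1 /= !normrN. Qed.

Lemma norm1B z w : norm1 (z - w) <= norm1 z + norm1 w.
Proof. by rewrite -[norm1 w]norm1N norm1D. Qed.

Lemma norm1_distC z w : norm1 (z - w) = norm1 (w - z).
Proof. by rewrite -norm1N opprB. Qed.

Lemma norm1M z w : norm1 (z * w) <= norm1 z * norm1 w.
Proof.
case: z w => [a b] [c d]; rewrite /norm1 /= mulrDl !mulrDr -!normrM.
have := ler_normB (a * c) (b * d); have := ler_normD (a * d) (b * c).
by lra.
Qed.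

Lemma norm1_conj z : norm1 (conjc z) = norm1 z.
Proof. by case: z => a b; rewrite /norm1 /= normrN. Qed.

Lemma norm1_real (a : R) : norm1 a%:C = `|a|.
Proof. by rewrite /norm1 /= normr0 addr0. Qed.

Lemma norm1_realM (a : R) z : norm1 (a%:C * z) = `|a| * norm1 z.
Proof.
case: z => c d; rewrite /norm1 /= !mul0r subr0 addr0.
by rewrite !normrM mulrDr.
Qed.

Lemma norm1_iX k z : norm1 ((0 +i* 1) ^+ k * z) = norm1 z.
Proof.
elim: k z => [|k IH] z; first by rewrite expr0 mul1r.
rewrite exprSr -mulrA IH; case: z => a b.
by rewrite /norm1 /= !mul0r !mul1r sub0r add0r normrN addrC.
Qed.

Lemma norm1_sum (I : Type) (r : seq I) (P : pred I) (F : I -> R[i]) :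
  norm1 (\sum_(i <- r | P i) F i) <= \sum_(i <- r | P i) norm1 (F i).
Proof.
elim/big_ind2 : _ => //; first by rewrite norm1_0.
by move=> x1 x2 y1 y2 h1 h2; exact: le_trans (norm1D _ _) (lerD h1 h2).
Qed.

Lemma Re_le_norm1 z : `|complex.Re z| <= norm1 z.
Proof. by rewrite lerDl. Qed.

Lemma Im_le_norm1 z : `|complex.Im z| <= norm1 z.
Proof. by rewrite lerDr. Qed.

Lemma normc_le_norm1 z : Normc.normc z <= norm1 z.
Proof.
have e : z = (complex.Re z)%:C + (0 +i* complex.Im z).
  by case: z => a b; simpc.
rewrite {1}e (le_trans (le_normcD _ _))// /norm1 lerD//.
  by rewrite /= expr0n addr0 sqrtr_sqr.
by rewrite /= expr0n add0r sqrtr_sqr.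
Qed.

Lemma cReD z w : complex.Re (z + w) = complex.Re z + complex.Re w.
Proof. by case: z w => [? ?] [? ?]. Qed.
Lemma cImD z w : complex.Im (z + w) = complex.Im z + complex.Im w.
Proof. by case: z w => [? ?] [? ?]. Qed.
Lemma cReB z w : complex.Re (z - w) = complex.Re z - complex.Re w.
Proof. by case: z w => [? ?] [? ?]. Qed.
Lemma cImB z w : complex.Im (z - w) = complex.Im z - complex.Im w.
Proof. by case: z w => [? ?] [? ?]. Qed.
Lemma cReM z w : complex.Re (z * w) =
  complex.Re z * complex.Re w - complex.Im z * complex.Im w.
Proof. by case: z w => [? ?] [? ?]. Qed.
Lemma cImM z w : complex.Im (z * w) =
  complex.Re z * complex.Im w + complex.Im z * complex.Re w.
Proof. by case: z w => [? ?] [? ?]. Qed.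

Lemma complex_eta z : z = complex.Re z +i* complex.Im z.
Proof. by case: z. Qed.

Lemma norm1_ReIm (a b : R) : norm1 (a +i* b) = `|a| + `|b|.
Proof. by []. Qed.

End ComplexNorm1.

(** * Positive definiteness of Cauchy matrices *)

Section CauchyGram.
Variable R : realType.
Implicit Types s c : nat -> R[i].

(** For [s k] in the right half-plane this is the squared norm in L^2(0, +oo) of sum_k c_k exp(-s_k
    x). *)
Definition gram s c q : R[i] :=
  \sum_(k < q) \sum_(l < q) c k * conjc (c l) / (s k + conjc (s l)).

Lemma Re_gt0_addJ_neq0 (a b : R[i]) : 0 < complex.Re a -> 0 < complex.Re b ->
  a + conjc b != 0.
Proof.
case: a b => [a a'] [b b'] /= a0 b0; apply/eqP => -[/eqP].
by rewrite gt_eqF// addr_gt0.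
Qed.

(* Schur complement of a Cauchy matrix: eliminating the first index leaves
   the Cauchy matrix on the remaining nodes, with rescaled coefficients. *)
Lemma gram_schur s c q : (forall k, (k < q.+1)%N -> 0 < complex.Re (s k)) ->
  let A := \sum_(k < q.+1) c k / (s k + conjc (s 0%N)) in
  gram s c q.+1 = (s 0%N + conjc (s 0%N)) * (A * conjc A) +
  gram (fun k => s k.+1)
    (fun k => c k.+1 * (s k.+1 - s 0%N) / (s k.+1 + conjc (s 0%N))) q.
Proof.
move=> s0 /=.
(* Index 0 is kept with coefficient [c' 0 = 0], so that both sides are double sums over the same
   range and the identity holds term by term. *)
set c' := fun k => c k * (s k - s 0%N) / (s k + conjc (s 0%N)).
have c'0 : c' 0%N = 0 by rewrite /c' subrr mulr0 mul0r.
have -> : gram (fun k => s k.+1)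
    (fun k => c k.+1 * (s k.+1 - s 0%N) / (s k.+1 + conjc (s 0%N))) q =
  gram s c' q.+1.
  rewrite /gram [RHS]big_ord_recl /= [X in X + _]big1 ?add0r; last first.
    by move=> i _; rewrite c'0 !mul0r.
  apply: eq_bigr => i _; rewrite [RHS]big_ord_recl /= c'0 conjc0 mulr0 mul0r.
  by rewrite add0r.
rewrite rmorph_sum big_distrlr /= mulr_sumr /gram -big_split /=.
apply: eq_bigr => k _; rewrite mulr_sumr -big_split /=.
apply: eq_bigr => l _; rewrite /c' !rmorphM /= !conjc_inv.
have e (x y : R[i]) : conjc (x + y) = conjc x + conjc y by rewrite rmorphD.
have eN (x : R[i]) : conjc (- x) = - conjc x by rewrite rmorphN.
rewrite !e eN !conjcK.
have h1 := Re_gt0_addJ_neq0 (s0 k (ltn_ord k)) (s0 l (ltn_ord l)).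
have h2 := Re_gt0_addJ_neq0 (s0 k (ltn_ord k)) (s0 0%N isT).
have h3 := Re_gt0_addJ_neq0 (s0 0%N isT) (s0 l (ltn_ord l)).
have h4 : conjc (s l) + s 0%N != 0 by rewrite addrC.
by field; rewrite h1 h2 h4.
Qed.

(** Induction by [gram_schur], whose two summands are nonnegative. If both vanish, the rescaled
    coefficients are 0; as the nodes are distinct this kills every [c k.+1], and then [A = 0] kills
    [c 0]. *)
Lemma gram_ge0_eq0 s c q : (forall k, (k < q)%N -> 0 < complex.Re (s k)) ->
  (forall k l, (k < q)%N -> (l < q)%N -> s k = s l -> k = l) ->
  0 <= gram s c q /\ (gram s c q = 0 -> forall k, (k < q)%N -> c k = 0).
Proof.
elim: q s c => [|q IH] s c s0 sinj.
  by split; [rewrite /gram big_ord0|].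
rewrite gram_schur//=; set A := \sum_(k < q.+1) _.
set c' := fun k => c k.+1 * _ / _.
have [g0 gE] : 0 <= gram (fun k => s k.+1) c' q /\
    (gram (fun k => s k.+1) c' q = 0 -> forall k, (k < q)%N -> c' k = 0).
  apply: IH => [k kq|k l kq lq e]; first exact: s0.
  by apply: succn_inj; exact: sinj.
have p0 : 0 < s 0%N + conjc (s 0%N).
  have := s0 0%N isT; case: (s 0%N) => a b /= a0.
  by rewrite ltcE /= subrr eqxx /= addr_gt0.
have A0 : 0 <= (s 0%N + conjc (s 0%N)) * (A * conjc A).
  by rewrite mulr_ge0 ?(ltW p0)// mulcJ_ge0.
split; first by rewrite addr_ge0.
move=> /eqP; rewrite paddr_eq0// => /andP[/eqP AE /eqP /gE c'0].
have {}AE : A = 0.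
  move/eqP : AE; rewrite mulf_eq0 gt_eqF//= mulf_eq0 => /orP[/eqP//|].
  by rewrite conjc_eq0 => /eqP.
have cS k : (k < q)%N -> c k.+1 = 0.
  move=> kq; have := c'0 _ kq; rewrite /c' => /eqP.
  rewrite mulf_eq0 invr_eq0 (negPf (Re_gt0_addJ_neq0 _ _)) ?orbF//; last 2 first.
    exact: s0.
    exact: s0.
  rewrite mulf_eq0 subr_eq0 => /orP[/eqP//|/eqP e].
  by have := sinj k.+1 0%N kq isT e.
case=> [_|k kq]; last exact: cS.
move/eqP : AE; rewrite /A big_ord_recl big1 ?addr0; last first.
  by move=> i _; rewrite (_ : c _ = 0) ?mul0r//; exact: cS.
rewrite mulf_eq0 invr_eq0 (negPf (Re_gt0_addJ_neq0 _ _)) ?orbF//; last 2 first.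
  exact: s0.
  exact: s0.
by move/eqP.
Qed.

End CauchyGram.

(** * The form of Lagrange's identity on data of exponentials *)

Section BoundaryForm.
Variable R : realType.
Implicit Types z : nat -> R[i].

(* If z j = D^j y (x0), this is the Hermitian form of Lagrange's identity:
   D^n y * conj y - y * conj (D^n y) = D (bform n (D^j y)_j). *)
Definition bform n z : R[i] := \sum_(m < n) z (n.-1 - m)%N * conjc (z m).

(** For each pair (k, l) the sum over m is geometric: multiplied by [w k - conjc (w l)] it
    telescopes to w_k^n - conj(w_l)^n = -2i. *)
Lemma bform_exp n (w : nat -> R[i]) (c : nat -> R[i]) q :
  (forall k, (k < q)%N -> w k ^+ n = - 'i) ->
  (forall k l, (k < q)%N -> (l < q)%N -> w k - conjc (w l) != 0) ->
  bform n (fun j => \sum_(k < q) c k * w k ^+ j) =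
  - 2 * 'i * \sum_(k < q) \sum_(l < q) c k * conjc (c l) / (w k - conjc (w l)).
Proof.
move=> wn w0; rewrite /bform.
transitivity (\sum_(m < n) \sum_(k < q) \sum_(l < q)
    c k * conjc (c l) * (w k ^+ (n.-1 - m) * conjc (w l) ^+ m)).
  apply: eq_bigr => m _; rewrite rmorph_sum big_distrlr /=.
  apply: eq_bigr => k _; apply: eq_bigr => l _.
  by rewrite rmorphM rmorphXn /=; ring.
rewrite exchange_big mulr_sumr /=; apply: eq_bigr => k _.
rewrite exchange_big mulr_sumr /=; apply: eq_bigr => l _.
rewrite -mulr_sumr.
have wd := w0 k l (ltn_ord k) (ltn_ord l).
have -> : \sum_(m < n) w k ^+ (n.-1 - m) * conjc (w l) ^+ m =
    - 2 * 'i / (w k - conjc (w l)).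
  apply: (mulfI wd); rewrite [RHS]mulrC divfK// -(subrXX _ _ n).
  rewrite wn// -rmorphXn wn//=.
  by apply/eqP; rewrite eq_complex /=; apply/andP; split; apply/eqP; ring.
by rewrite !mulrA; ring.
Qed.

End BoundaryForm.

(** * Primitives of integrable functions and one-sided derivatives *)

Section Primitive.
Variable R : realType.
Local Notation mu := (@lebesgue_measure R).
Implicit Types g : R -> R.

(** Densities are integrable on the whole line, so that one primitive serves every subinterval up to
    an additive constant. *)
Definition rprim g (x : R) : R := \int[mu]_(t in `]-oo, x]) g t.

Definition rintegrable g := mu.-integrable setT (EFin \o g).

Lemma rintegrableS g (A : set R) : measurable A -> rintegrable g ->
  mu.-integrable A (EFin \o g).
Proof. by move=> mA; apply: integrableS. Qed.

Lemma rprimB g x y : rintegrable g -> x <= y ->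
  rprim g y - rprim g x = \int[mu]_(t in `]x, y]) g t.
Proof.
move=> ig xy; rewrite /rprim (@Rintegral_itvB R g -oo%O (BRight y) x)//.
by apply: rintegrableS ig.
Qed.

Lemma rprim_dist_le g x y : rintegrable g -> x <= y ->
  `|rprim g y - rprim g x| <= \int[mu]_(t in `]x, y]) `|g t|.
Proof.
move=> ig xy; rewrite rprimB//; apply: le_normr_Rintegral => //.
exact: rintegrableS ig.
Qed.

(** Absolute continuity of the integral, applied to the union of the intervals. *)
Lemma rprim_abs_continuous g : rintegrable g -> forall e : R, 0 < e ->
  exists2 d : R, 0 < d & forall (m : nat) (a b : 'I_m -> R),
    (forall i, a i <= b i) ->
    (forall i j, i != j -> b i <= a j \/ b j <= a i) ->
    \sum_(i < m) (b i - a i) < d ->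
    \sum_(i < m) `|rprim g (b i) - rprim g (a i)| < e.
Proof.
move=> ig e e0.
have [d [d0 gd]] := integral_normr_continuous ig e0.
exists d => // m a b ab abI sd.
(* Half-open intervals stay disjoint when two of them share an endpoint. *)
pose F (i : 'I_m) : set (measurableTypeR R) := `]a i, b i]%classic.
have tF : trivIset setT F.
  move=> i j _ _ [t []]; rewrite /F /= !in_itv/= => /andP[t1 t2] /andP[t3 t4].
  apply/eqP/negPn/negP => /abI[h|h].
    by have := lt_le_trans t3 (le_trans t2 h); rewrite ltxx.
  by have := lt_le_trans t1 (le_trans t4 h); rewrite ltxx.
have mF i : measurable (F i) by exact: measurable_itv.
set D := \big[setU/set0]_(i < m) F i.
have mD : measurable D by apply: bigsetU_measurable => i _; exact: mF.
have muD : (mu D < d%:E)%E.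
  rewrite /D measure_bigsetU_ord//= (eq_bigr (fun i => (b i - a i)%:E)).
    by rewrite sumEFin lte_fin.
  move=> i _; rewrite /F lebesgue_measure_itv/= lte_fin; case: ltP => //.
  by rewrite le_eqVlt => /orP[/eqP->|]; rewrite ?subrr// ltNge ab.
apply: le_lt_trans (gd _ mD muD).
apply: (@le_trans _ _ (\sum_(i < m) \int[mu]_(t in F i) `|g t|)).
  by apply: ler_sum => i _; exact: rprim_dist_le.
have ing : mu.-integrable setT (EFin \o (fun t => `|g t|)) by exact: integrable_norm.
rewrite /Rintegral (@integral_bigsetU_EFin _ _ _ mu _ F (fun t => `|g t|))//=.
- rewrite sum_fine; last by move=> i _; apply: (@integrable_fin_num _ _ R mu (F i) (mF i) (fun t => (`|g t|)%:E)); apply: integrableS ing => //; exact: mF.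
  exact: lexx.
- exact: index_enum_uniq.
- exact: sub_trivIset tF.
- by apply: (measurable_int mu); exact: integrableS measurableT mD (@subsetT _ _) ing.
Qed.

Lemma rprim_continuous g : rintegrable g -> continuous (rprim g).
Proof.
move=> ig x; apply/cvgrPdist_lt => e e0.
have [d d0 gd] := rprim_abs_continuous ig e0.
have key (y z : R) : y <= z -> z - y < d -> `|rprim g z - rprim g y| < e.
  move=> yz zyd.
  have := gd 1%N (fun=> y) (fun=> z); rewrite !big_ord1; apply => //.
  by move=> i j; rewrite !ord1.
near=> t; have xt : `|x - t| < d by near: t; exact: cvgr_dist_lt.
case: (leP t x) => [tx|/ltW xt'].
  by apply: key => //; rewrite (le_lt_trans _ xt)// ler_norm.
by rewrite distrC key// (le_lt_trans _ xt)// distrC ler_norm.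
Unshelve. all: by end_near. Qed.

Lemma rprimD g1 g2 x : rintegrable g1 -> rintegrable g2 ->
  rprim (fun t => g1 t + g2 t) x = rprim g1 x + rprim g2 x.
Proof. by move=> i1 i2; rewrite /rprim RintegralD//; exact: rintegrableS. Qed.

Lemma rprimZ (k : R) g x : rintegrable g ->
  rprim (fun t => k * g t) x = k * rprim g x.
Proof. by move=> i1; rewrite /rprim RintegralZl//; exact: rintegrableS. Qed.

Lemma rprim_expand g x y (L e : R) : rintegrable g -> x <= y ->
  (forall s, x < s <= y -> `|g s - L| <= e) ->
  `|rprim g y - rprim g x - L * (y - x)| <= e * (y - x).
Proof.
move=> ig xy h; rewrite rprimB//.
have ixy k : mu.-integrable `]x, y] (EFin \o cst k).
  apply: measurable_bounded_integrable => //.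
    by rewrite /= lebesgue_measure_itv/=; case: ifP => _; rewrite -?EFinB ltry.
  by exists `|k|; split=> // M kM s _; exact: ltW.
have e1 k : \int[mu]_(t in `]x, y]) k = k * (y - x).
  rewrite Rintegral_cst//= lebesgue_measure_itv/= lte_fin.
  by case: ltP => //; rewrite le_eqVlt => /orP[/eqP->|]; rewrite ?subrr// ltNge xy.
have ig' : mu.-integrable `]x, y] (EFin \o g) by exact: rintegrableS ig.
rewrite -e1 -RintegralB//; last exact: (ixy L).
have igL : mu.-integrable `]x, y] (EFin \o (fun t => g t - L)).
  by apply: (integrableB _ ig' (ixy L)).
apply: le_trans; first exact: le_normr_Rintegral.
rewrite -e1; apply: le_Rintegral => //.
- exact: integrable_norm.
- exact: (ixy e).
Qed.

End Primitive.

(** * Derivatives along [0, 1] and the fundamental theorem of calculus *)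

Section OneSidedDerivative.
Variable R : realType.
Local Notation mu := (@lebesgue_measure R).
Implicit Types f g : R -> R.

Lemma nbhs01P (x : R) (P : set R) : nbhs01 x P <->
  exists2 d : R, 0 < d &
    forall t, 0 <= t <= 1 -> t != x -> `|x - t| < d -> P t.
Proof.
rewrite /nbhs01 /within /dnbhs /within /=; split.
  move=> /nbhs_ballP[d /= d0 h]; exists d => // t t01 tx xt.
  by apply: (h t); rewrite //= in_itv.
case=> d d0 h; apply/nbhs_ballP; exists d => //= t xt tx.
by rewrite in_itv /= => t01; exact: h.
Qed.

Lemma nbhs01_properfilter (x : R) : 0 <= x <= 1 -> ProperFilter (nbhs01 x).
Proof.
move=> /andP[x0 x1]; apply: Build_ProperFilter_ex => P /nbhs01P[d d0 h].
(* A move of length e <= 1/2 away from the nearer endpoint stays in [0, 1]. *)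
pose e := Num.min (d / 2) (1 / 2).
have e0 : 0 < e by rewrite lt_min !divr_gt0.
have ed : e < d by rewrite gt_min; apply/orP; left; lra.
have e12 : e <= 1 / 2 by rewrite ge_min lexx orbT.
case: (leP x (1 / 2)) => hx.
  exists (x + e); apply: h.
  - by apply/andP; split; lra.
  - by rewrite -subr_eq0 addrC addKr gt_eqF.
  - by rewrite opprD addNKr normrN gtr0_norm.
exists (x - e); apply: h.
- by apply/andP; split; lra.
- by rewrite -subr_eq0 addrC addKr oppr_eq0 gt_eqF.
- by rewrite opprB addrC subrK gtr0_norm.
Qed.

Lemma rderiv01_eps f (x l : R) : 0 <= x <= 1 ->
  (forall e, 0 < e -> exists2 d : R, 0 < d &
    forall t, 0 <= t <= 1 -> t != x -> `|x - t| < d ->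
      `|diff_quotient f x t - l| <= e) ->
  rderivable01 f x /\ rderiv01 f x = l.
Proof.
move=> x01 h; have pf := nbhs01_properfilter x01.
have cl : diff_quotient f x t @[t --> nbhs01 x] --> l.
  apply/cvgrPdist_le => e e0; have [d d0 hd] := h e e0.
  by apply/nbhs01P; exists d => // t t01 tx xt /=; rewrite distrC; exact: hd.
split; first by apply/cvg_ex; exists l.
by apply/cvg_lim => //; exact: Rhausdorff.
Qed.

Lemma rderivable01_eps f (x : R) : rderivable01 f x ->
  forall e, 0 < e -> exists2 d : R, 0 < d &
    forall t, 0 <= t <= 1 -> t != x -> `|x - t| < d ->
      `|diff_quotient f x t - rderiv01 f x| <= e.
Proof.
move=> /= fx e e0; have /cvgrPdist_le/(_ e e0) : diff_quotient f x t
  @[t --> nbhs01 x] --> rderiv01 f x by exact: fx.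
by move=> /nbhs01P[d d0 h]; exists d => // t t01 tx xt; rewrite distrC; exact: h.
Qed.

Lemma rderiv01_congr f g (x : R) : 0 <= x <= 1 ->
  (forall t, 0 <= t <= 1 -> f t = g t) ->
  rderivable01 f x = rderivable01 g x /\ rderiv01 f x = rderiv01 g x.
Proof.
move=> x01 fg.
suff e : diff_quotient f x t @[t --> nbhs01 x] =
    diff_quotient g x t @[t --> nbhs01 x].
  by rewrite /rderivable01 /rderiv01 e.
apply/seteqP; split=> P /= /nbhs01P[d d0 h]; apply/nbhs01P; exists d => // t t01 tx xt;
  by have := h t t01 tx xt; rewrite /= /diff_quotient !fg.
Qed.

Lemma rderiv01_prim g (c : R) F (x : R) : rintegrable g -> 0 <= x <= 1 ->
  (forall t, 0 <= t <= 1 -> F t = c + rprim g t) ->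
  (forall e, 0 < e -> exists2 d : R, 0 < d &
    forall t, 0 <= t <= 1 -> `|x - t| < d -> `|g t - g x| <= e) ->
  rderivable01 F x /\ rderiv01 F x = g x.
Proof.
move=> ig x01 FE gc; apply: rderiv01_eps => // e e0.
have [d d0 hd] := gc e e0; exists d => // t t01 tx xt.
have FB s : 0 <= s <= 1 -> F s - F x = rprim g s - rprim g x.
  by move=> s01; rewrite !FE//; ring.
have tx0 : t - x != 0 by rewrite subr_eq0.
have -> : diff_quotient F x t - g x =
    (rprim g t - rprim g x - g x * (t - x)) / (t - x).
  by rewrite /diff_quotient FB//; field.
rewrite normrM normfV ler_pdivrMr ?normr_gt0//.
move/andP : x01 => [x0 x1]; move/andP : (t01) => [t0 t1].
have [xt'|tx'|/eqP] := ltgtP x t; last by rewrite eq_sym (negPf tx).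
  rewrite [in leRHS]gtr0_norm ?subr_gt0//.
  apply: rprim_expand => //; first exact: ltW.
  move=> s /andP[xs st]; apply: hd; first by apply/andP; split; lra.
  by rewrite ltr0_norm ?subr_lt0//; rewrite ltr0_norm ?subr_lt0// in xt; lra.
rewrite [in leRHS]distrC [in leRHS]gtr0_norm ?subr_gt0//.
rewrite -normrN.
have -> : - (rprim g t - rprim g x - g x * (t - x)) =
  rprim g x - rprim g t - g x * (x - t) by ring.
apply: rprim_expand => //; first exact: ltW.
move=> s /andP[ts sx]; apply: hd; first by apply/andP; split; lra.
by rewrite ger0_norm ?subr_ge0//; rewrite gtr0_norm ?subr_gt0// in xt; lra.
Qed.

(** The top derivative in the construction has a merely integrable density, so it is differentiated
    at Lebesgue points only. *)
Lemma ae_rderiv01_prim g (c : R) F : rintegrable g ->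
  (forall t, 0 <= t <= 1 -> F t = c + rprim g t) ->
  {ae mu, forall x, `]0, 1[%classic x -> rderiv01 F x = g x}.
Proof.
move=> ig FE.
have locg : locally_integrable setT g.
  have := @integrable_locally R g setT measurableT ig.
  by rewrite patch_setT.
have := lebesgue_differentiation locg.
apply: filterS; first exact: (ae_filter_ringOfSetsType mu).
move=> x gx.
rewrite /= in_itv/= => /andP[x0 x1].
have x01 : 0 <= x <= 1 by rewrite !ltW.
have xu : x < x + 1 by rewrite ltrDl.
have iu : mu.-integrable [set` `]-oo, (x + 1)]] (EFin \o g).
  exact: rintegrableS ig.
have [|dF F'] := FTC1_lebesgue_pt xu iu _ gx; first by rewrite ltNyr.
rewrite derive1E in F'.
suff : rderivable01 F x /\ rderiv01 F x = g x by case.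
apply: rderiv01_eps => // e e0.
have : (h^-1 *: (rprim g (h *: 1 + x) - rprim g x)) @[h --> 0^'] --> g x.
  by rewrite -F'; exact: dF.
move=> /cvgrPdist_le/(_ e e0) /nbhs_ballP[d /= d0 h].
exists d => // t t01 tx xt.
have tx0 : t - x != 0 by rewrite subr_eq0.
have := h (t - x); rewrite /ball /= sub0r opprB => /(_ xt tx0).
rewrite distrC /diff_quotient !FE// [_%:A]mulr1 subrK [_ *: _]mulrC.
by rewrite opprD addrACA subrr add0r.
Qed.

End OneSidedDerivative.

(** * Borel measurability of the derivative *)

Section MeasurableDerivative.
Variable R : realType.
Implicit Types f F : R -> R.

Let dq F (h x : R) : R := (F (x + h) - F x) / h.

Let dq_continuous F h : continuous F -> continuous (dq F h).
Proof.
move=> cF x; apply: cvgM; last exact: cvg_cst.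
apply: cvgB; last exact: cF.
apply: (@continuous_comp _ _ _ (fun y => y + h) F); last exact: cF.
by apply: cvgD; [exact: cvg_id|exact: cvg_cst].
Qed.

(** A reference increment strictly below 1/(m+1), hence admissible at level m of [dset]. *)
Let hs (m : nat) : R := m.+2%:R^-1.

Let hs_gt0 m : 0 < hs m. Proof. by rewrite invr_gt0 ltr0n. Qed.

(* Cauchy criterion for the difference quotients: a countable combination of
   closed sets. *)
Let dset F : set R := \bigcap_(k : nat) \bigcup_(m : nat)
  \bigcap_(h in [set h : R | 0 < `|h| < m.+1%:R^-1])
    [set x | `|dq F h x - dq F (hs m) x| <= k.+1%:R^-1].

Let measurable_dset F : continuous F -> measurable (dset F).
Proof.
move=> cF; apply: bigcap_measurableType => k _; apply: bigcup_measurable => m _.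
apply: closed_measurable; apply: closed_bigI => h _.
apply: (@closed_comp _ _ (fun x => `|dq F h x - dq F (hs m) x|)
  [set y | y <= k.+1%:R^-1]); last exact: closed_le.
move=> x _; apply: (@continuous_comp _ _ _ (fun x => dq F h x - dq F (hs m) x)
  (fun z => `|z|)); last exact: norm_continuous.
by apply: cvgB; exact: dq_continuous.
Qed.

Let archi_inv (e : R) : 0 < e -> exists m, forall j, (m <= j)%N -> j.+1%:R^-1 < e.
Proof.
move=> e0; exists (Num.truncn e^-1) => j mj.
rewrite invf_plt ?posrE//; apply: (lt_le_trans (truncnS_gt _)).
by rewrite ler_nat ltnS.
Qed.

Let dqE F f x t : (forall s, 0 <= s <= 1 -> f s = F s) -> 0 <= x <= 1 ->
  0 <= t <= 1 -> diff_quotient f x t = dq F (t - x) x.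
Proof. by move=> fF x01 t01; rewrite /diff_quotient /dq !fF// [x + (t - x)]addrC subrK. Qed.

Let dset_derivable F f x : (forall s, 0 <= s <= 1 -> f s = F s) -> 0 < x < 1 ->
  rderivable01 f x <-> dset F x.
Proof.
move=> fF /andP[x0 x1]; have x01 : 0 <= x <= 1 by rewrite !ltW.
have dqh h : 0 <= x + h <= 1 -> diff_quotient f x (x + h) = dq F h x.
  by move=> xh; rewrite (dqE fF)//; congr (dq F _ x); rewrite addrC addKr.
split=> [fx k _|Dx].
  have e0 : 0 < k.+1%:R^-1 / 2 :> R by rewrite divr_gt0// invr_gt0 ltr0n.
  have [d d0 hd] := rderivable01_eps fx e0.
  (* This radius keeps x + h inside [0, 1], where [f] agrees with its extension [F]. *)
  have r0 : 0 < Num.min d (Num.min x (1 - x)) by rewrite !lt_min d0 x0 subr_gt0.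
  have [m hm] := archi_inv r0.
  have small h : 0 < `|h| -> `|h| < m.+1%:R^-1 ->
      `|dq F h x - rderiv01 f x| <= k.+1%:R^-1 / 2.
    move=> h0 hl; have := lt_trans hl (hm m (leqnn _)).
    rewrite !lt_min => /and3P[h1 h2 h3].
    have /andP[h4 h5] : - `|h| <= h <= `|h| by rewrite -ler_norml.
    have t01 : 0 <= x + h <= 1 by apply/andP; split; lra.
    rewrite -dqh//; apply: hd => //.
      by rewrite -subr_eq0 addrC addKr -normr_gt0.
    by rewrite opprD addNKr normrN.
  exists m => // h /= /andP[h0 hl].
  have hsm : `|hs m| < m.+1%:R^-1.
    by rewrite gtr0_norm// ltf_pV2 ?posrE ?ltr0n// ltr_nat.
  have := small h h0 hl; have := small (hs m); rewrite gtr0_norm//.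
  rewrite gtr0_norm// in hsm => /(_ (hs_gt0 m) hsm) s1 s2.
  rewrite -(subrKA (rderiv01 f x)) (le_trans (ler_normD _ _))//.
  by rewrite (distrC (rderiv01 f x)) [leRHS]splitr lerD.
have pf := nbhs01_properfilter x01.
apply: (@R_complete R (diff_quotient f x t @[t --> nbhs01 x])); apply: cauchy_exP => e e0.
have [k hk] := archi_inv e0; have [m _ hm] := Dx k I.
exists (dq F (hs m) x); apply/nbhs01P.
exists m.+1%:R^-1; first by rewrite invr_gt0 ltr0n.
move=> t t01 tx xt /=; rewrite /ball /= distrC.
apply: le_lt_trans (hk k (leqnn k)).
rewrite (dqE fF)//; apply: (hm (t - x)) => /=.
by rewrite normr_gt0 subr_eq0 tx distrC.
Qed.

(** Membership of l(y) in L^2 includes Borel measurability of the n-th derivative on all of ]0, 1[,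
    also where it fails to exist; equality a.e. with a Borel function does not give this. Hence the
    set of points of differentiability is itself shown to be Borel. *)
Lemma measurable_rderiv01 F f : continuous F ->
  (forall s, 0 <= s <= 1 -> f s = F s) ->
  measurable_fun (`]0, 1[%classic : set R) (rderiv01 f).
Proof.
move=> cF fF.
(* On [dset F] the quotients with increment [hs j] converge to the derivative; off it the constant
   [point] is the default value of a divergent [lim]. *)
pose u j (x : R) : R := \1_(dset F) x * dq F (hs j) x + \1_(~` dset F) x * (point : R).
apply: (@measurable_fun_cvg _ _ _ _ u).
  move=> j; apply: measurable_funD; apply: measurable_funM.
  - by apply: measurable_indic; exact: measurable_dset.
  - by apply: measurable_funTS; apply: continuous_measurable_fun; exact: dq_continuous.
  - by apply: measurable_indic; apply: measurableC; exact: measurable_dset.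
  - exact: measurable_cst.
move=> x /=; rewrite in_itv/= => /andP[x0 x1].
have x01 : 0 <= x <= 1 by rewrite !ltW.
have xx : 0 < x < 1 by rewrite x0.
rewrite /u; have [Dx|nDx] := pselect (dset F x).
  have fx : rderivable01 f x by apply/(dset_derivable fF xx).
  have e1 : \1_(dset F) x = 1 :> R by rewrite indicE mem_set.
  have e2 : \1_(~` dset F) x = 0 :> R by rewrite indicE memNset//= => /(_ Dx).
  under eq_fun do rewrite e1 e2 mul0r addr0 mul1r.
  apply/cvgrPdist_le => e e0; have [d d0 hd] := rderivable01_eps fx e0.
  have [m hm] := archi_inv (e := Num.min d (1 - x)) ltac:(rewrite lt_min d0 subr_gt0 x1; done).
  exists m => // j /= mj.
  have := hm j.+1 (leq_trans mj (leqnSn _)); rewrite lt_min => /andP[h1 h2].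
  have t01 : 0 <= x + hs j <= 1.
    have h3 := hs_gt0 j; rewrite -/(hs j) in h1 h2.
    by apply/andP; split; lra.
  rewrite distrC; have := hd (x + hs j) t01; rewrite (dqE fF x01 t01).
  rewrite [x + _ - x]addrC addKr; apply.
    by rewrite -subr_eq0 addrC addKr gt_eqF.
  by rewrite opprD addNKr normrN gtr0_norm.
have e1 : \1_(dset F) x = 0 :> R by rewrite indicE memNset.
have e2 : \1_(~` dset F) x = 1 :> R by rewrite indicE mem_set.
under eq_fun do rewrite e1 e2 mul0r add0r mul1r.
have -> : rderiv01 f x = (point : R).
  rewrite /rderiv01.
  have nfx : ~ rderivable01 f x by move=> /(dset_derivable fF xx).
  exact: dvgP.
exact: cvg_cst.
Qed.

End MeasurableDerivative.

(** * Primitives on a subinterval and uniformly bounded complex functions *)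

Section RealCutPrimitive.
Variable R : realType.
Local Notation mu := (@lebesgue_measure R).
Implicit Types g : R -> R.

Lemma rintegrableD g1 g2 : rintegrable g1 -> rintegrable g2 ->
  rintegrable (fun t => g1 t + g2 t).
Proof. by move=> i1 i2; exact: (integrableD measurableT i1 i2). Qed.

Lemma rintegrableZ (k : R) g : rintegrable g -> rintegrable (fun t => k * g t).
Proof. by move=> i1; exact: (integrableZl measurableT k i1). Qed.

Lemma rintegrable_norm g : rintegrable g -> rintegrable (fun t => `|g t|).
Proof. by move=> i1; exact: integrable_norm. Qed.

Lemma rintegrable_le g h : measurable_fun setT g -> rintegrable h ->
  (forall t, `|g t| <= `|h t|) -> rintegrable g.
Proof.
move=> mg ih gh; apply: (le_integrable _ _ _ ih) => //.
  exact/measurable_EFinP.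
by move=> t _ /=; rewrite lee_fin.
Qed.

Lemma rintegrable_patch g (i : interval R) :
  mu.-integrable [set` i] (EFin \o g) -> rintegrable (g \_ [set` i]).
Proof.
move=> ig; rewrite /rintegrable -restrict_EFin.
by apply: (integrable_mkcond _ _).1.
Qed.

Definition rtot g : R := \int[mu]_t g t.

Lemma rtotD g1 g2 : rintegrable g1 -> rintegrable g2 ->
  rtot (fun t => g1 t + g2 t) = rtot g1 + rtot g2.
Proof. by move=> i1 i2; rewrite /rtot RintegralD. Qed.

Lemma rtotZ (k : R) g : rintegrable g -> rtot (fun t => k * g t) = k * rtot g.
Proof. by move=> i1; rewrite /rtot RintegralZl. Qed.

Lemma rtot_ge0 g : (forall t, 0 <= g t) -> 0 <= rtot g.
Proof. by move=> g0; apply: Rintegral_ge0. Qed.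

Lemma rtot_le g1 g2 : rintegrable g1 -> rintegrable g2 ->
  (forall t, g1 t <= g2 t) -> rtot g1 <= rtot g2.
Proof. by move=> i1 i2 h; apply: le_Rintegral. Qed.

Variables (a b : R) (s : bool).

Definition cut (V : nmodType) (f : R -> V) (t : R) : V :=
  if a <= t <= b then f t else 0.

(* The primitive on [a, b] vanishing at a (s = false) or at b (s = true) *)
Definition rJ g (x : R) : R :=
  cut (fun x => rprim g x - (if s then rtot g else 0)) x.

Lemma rJD g1 g2 x : rintegrable g1 -> rintegrable g2 ->
  rJ (fun t => g1 t + g2 t) x = rJ g1 x + rJ g2 x.
Proof.
move=> i1 i2; rewrite /rJ /cut; case: ifP => _; last by rewrite addr0.
by rewrite rprimD// rtotD//; case: (s); ring.
Qed.

Lemma rJZ (k : R) g x : rintegrable g -> rJ (fun t => k * g t) x = k * rJ g x.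
Proof.
move=> i1; rewrite /rJ /cut; case: ifP => _; last by rewrite mulr0.
by rewrite rprimZ// rtotZ//; case: (s); ring.
Qed.

(** On [a, b] the value is the integral of g over ]-oo, x], or minus its integral over the
    complement, according to [s]. *)
Lemma rJ_le g x : rintegrable g -> `|rJ g x| <= rtot (fun t => `|g t|).
Proof.
move=> ig; rewrite /rJ /cut; case: ifP => _; last first.
  by rewrite normr0 rtot_ge0.
set A : set (measurableTypeR R) := `]-oo, x]%classic.
have igA : rintegrable (g \_ A).
  by apply: rintegrable_patch; exact: rintegrableS ig.
rewrite /rprim Rintegral_mkcond -/A.
case: (s); last first.
  rewrite subr0; apply: le_trans; first exact: le_normr_Rintegral.
  apply: rtot_le => //; try exact: rintegrable_norm.
  by move=> t; rewrite /patch; case: ifP => // _; rewrite normr0.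
rewrite /rtot -RintegralB//.
apply: le_trans.
  apply: le_normr_Rintegral => //.
  exact: (integrableB measurableT igA ig).
apply: rtot_le; try exact: rintegrable_norm.
  by apply: rintegrable_norm; exact: (integrableB measurableT igA ig).
move=> t; rewrite /patch; case: ifP => // _; first by rewrite subrr normr0.
by rewrite sub0r normrN.
Qed.

Lemma measurable_cut g : measurable_fun setT g -> measurable_fun setT (cut g).
Proof.
move=> mg; have -> : cut g = g \_ `[a, b].
  apply/funext => t; rewrite /cut /patch mem_setE in_itv/=.
  by [].
by apply/(measurable_restrictT _ _).1 => //; exact: measurable_funTS.
Qed.

Lemma measurable_rJ g : rintegrable g -> measurable_fun setT (rJ g).
Proof.
move=> ig; apply: measurable_cut; apply: measurable_funB => //.
by apply: continuous_measurable_fun; exact: rprim_continuous.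
Qed.

Lemma rintegrable_cut g (B : R) : measurable_fun setT g ->
  (forall t, `|g t| <= B) -> (forall t, ~~ (a <= t <= b) -> g t = 0) ->
  rintegrable g.
Proof.
move=> mg gB g0.
have -> : g = g \_ `[a, b].
  apply/funext => t; rewrite /patch mem_setE in_itv/=.
  by case: ifP => // /negbT /g0.
have : mu.-integrable [set` `[a, b]] (EFin \o g).
  apply: measurable_bounded_integrable => //.
  - by rewrite /= lebesgue_measure_itv/=; case: ifP => _; rewrite -?EFinB ltry.
  - exact: measurable_funTS.
  - by exists B; split=> [|M BM t _]; [exact: num_real|exact: le_trans (gB t) (ltW BM)].
exact: rintegrable_patch.
Qed.

Lemma rtot_cut_le g (B : R) : a <= b -> measurable_fun setT g ->
  (forall t, `|g t| <= B) -> (forall t, ~~ (a <= t <= b) -> g t = 0) ->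
  `|rtot g| <= B * (b - a).
Proof.
move=> ab mg gB g0; have ig := rintegrable_cut mg gB g0.
rewrite (le_trans (le_normr_Rintegral _ _))//.
have -> : B * (b - a) = rtot ((cst B) \_ `[a, b]).
  rewrite /rtot -Rintegral_mkcond Rintegral_cst//= lebesgue_measure_itv/= lte_fin.
  by case: ltP => //; rewrite le_eqVlt => /orP[/eqP->|]; rewrite ?subrr// ltNge ab.
have B0 : 0 <= B by exact: le_trans (normr_ge0 _) (gB 0).
apply: rtot_le; first exact: rintegrable_norm.
  apply: rintegrable_patch; apply: measurable_bounded_integrable => //.
    by rewrite /= lebesgue_measure_itv/=; case: ifP => _; rewrite -?EFinB ltry.
  by exists `|B|; split=> // M kM t _; exact: ltW.
move=> t; rewrite /patch mem_setE in_itv/=; case: ifP => // /negbT /g0 ->.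
by rewrite normr0.
Qed.

End RealCutPrimitive.

Section ComplexCutPrimitive.
Variable R : realType.
Local Notation C := R[i].
Implicit Types f g : R -> C.

Definition cmeasurable f := measurable_fun setT (fun t => complex.Re (f t)) /\
  measurable_fun setT (fun t => complex.Im (f t)).

Definition cintegrable f := rintegrable (fun t => complex.Re (f t)) /\
  rintegrable (fun t => complex.Im (f t)).

Definition l1norm f : R := rtot (fun t => norm1 (f t)).

Lemma cmeasurableD f g : cmeasurable f -> cmeasurable g ->
  cmeasurable (fun t => f t + g t).
Proof.
move=> [f1 f2] [g1 g2]; split.
  by under eq_fun do rewrite cReD; exact: measurable_funD.
by under eq_fun do rewrite cImD; exact: measurable_funD.
Qed.

Lemma cmeasurableM f g : cmeasurable f -> cmeasurable g ->
  cmeasurable (fun t => f t * g t).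
Proof.
move=> [f1 f2] [g1 g2]; split.
  rewrite (_ : (fun t => _) = (fun t => complex.Re (f t) * complex.Re (g t) -
      complex.Im (f t) * complex.Im (g t))); last by apply/funext => t; exact: cReM.
  by apply: measurable_funB; exact: measurable_funM.
rewrite (_ : (fun t => _) = (fun t => complex.Re (f t) * complex.Im (g t) +
    complex.Im (f t) * complex.Re (g t))); last by apply/funext => t; exact: cImM.
by apply: measurable_funD; exact: measurable_funM.
Qed.

Lemma cmeasurable_cst (c : C) : cmeasurable (fun=> c).
Proof. by split; exact: measurable_cst. Qed.

Lemma cmeasurable_conj f : cmeasurable f -> cmeasurable (fun t => conjc (f t)).
Proof.
move=> [f1 f2]; split.
  by have -> : (fun t => complex.Re (conjc (f t))) = (fun t => complex.Re (f t))
    by apply/funext => t; case: (f t).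
have -> : (fun t => complex.Im (conjc (f t))) = (fun t => - complex.Im (f t))
  by apply/funext => t; case: (f t).
exact: measurableT_comp.
Qed.

Lemma cmeasurable_sum (I : Type) (r : seq I) (F : I -> R -> C) :
  (forall i, cmeasurable (F i)) -> cmeasurable (fun t => \sum_(i <- r) F i t).
Proof.
move=> mF; elim: r => [|i r IH].
  by under eq_fun do rewrite big_nil; exact: cmeasurable_cst.
by under eq_fun do rewrite big_cons; exact: cmeasurableD.
Qed.

Lemma cmeasurable_norm1 f : cmeasurable f ->
  measurable_fun setT (fun t => norm1 (f t)).
Proof. by move=> [f1 f2]; apply: measurable_funD; exact: measurableT_comp. Qed.

Lemma cintegrable_measurable f : cintegrable f -> cmeasurable f.
Proof.
by move=> [/measurable_int/measurable_EFinP f1 /measurable_int/measurable_EFinP f2].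
Qed.

Lemma cintegrableD f g : cintegrable f -> cintegrable g ->
  cintegrable (fun t => f t + g t).
Proof.
move=> [f1 f2] [g1 g2]; split.
  by under eq_fun do rewrite cReD; exact: rintegrableD.
by under eq_fun do rewrite cImD; exact: rintegrableD.
Qed.

Lemma cintegrable_norm1 f : cintegrable f -> rintegrable (fun t => norm1 (f t)).
Proof. by move=> [f1 f2]; apply: rintegrableD; exact: rintegrable_norm. Qed.

Lemma cintegrable_le f (h : R -> R) : cmeasurable f -> rintegrable h ->
  (forall t, norm1 (f t) <= h t) -> cintegrable f.
Proof.
move=> [f1 f2] ih fh; split; apply: rintegrable_le ih _ => // t.
  by rewrite (le_trans (Re_le_norm1 _))// (le_trans (fh t))// ler_norm.
by rewrite (le_trans (Im_le_norm1 _))// (le_trans (fh t))// ler_norm.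
Qed.

Lemma cintegrableZ (c : C) f : cintegrable f -> cintegrable (fun t => c * f t).
Proof.
move=> fi; apply: (@cintegrable_le _ (fun t => norm1 c * norm1 (f t))).
- by apply: cmeasurableM; [exact: cmeasurable_cst|exact: cintegrable_measurable].
- by apply: rintegrableZ; exact: cintegrable_norm1.
- by move=> t; exact: norm1M.
Qed.

Lemma cintegrable0 : cintegrable (fun=> 0).
Proof. by split; exact: integrable0. Qed.

Lemma cintegrable_sum (I : Type) (r : seq I) (F : I -> R -> C) :
  (forall i, cintegrable (F i)) -> cintegrable (fun t => \sum_(i <- r) F i t).
Proof.
move=> mF; elim: r => [|i r IH].
  by under eq_fun do rewrite big_nil; exact: cintegrable0.
by under eq_fun do rewrite big_cons; exact: cintegrableD.
Qed.

Lemma l1norm_ge0 f : 0 <= l1norm f.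
Proof. by apply: rtot_ge0 => t; exact: norm1_ge0. Qed.

Lemma l1normD f g : cintegrable f -> cintegrable g ->
  l1norm (fun t => f t + g t) <= l1norm f + l1norm g.
Proof.
move=> fi gi; rewrite /l1norm -rtotD; try exact: cintegrable_norm1.
apply: rtot_le; first by apply: cintegrable_norm1; exact: cintegrableD.
  by apply: rintegrableD; exact: cintegrable_norm1.
by move=> t; exact: norm1D.
Qed.

Lemma l1normM_le f g (B : R) : cintegrable f -> cmeasurable g ->
  (forall t, norm1 (g t) <= B) ->
  cintegrable (fun t => f t * g t) /\ l1norm (fun t => f t * g t) <= B * l1norm f.
Proof.
move=> fi mg gB.
have ih : rintegrable (fun t => B * norm1 (f t)).
  by apply: rintegrableZ; exact: cintegrable_norm1.
have h t : norm1 (f t * g t) <= B * norm1 (f t).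
  by rewrite (le_trans (norm1M _ _))// [leRHS]mulrC ler_wpM2l// norm1_ge0.
have fgi : cintegrable (fun t => f t * g t).
  apply: cintegrable_le ih h; apply: cmeasurableM => //.
  exact: cintegrable_measurable.
split=> //; rewrite /l1norm -rtotZ; last exact: cintegrable_norm1.
by apply: rtot_le => //; exact: cintegrable_norm1.
Qed.

Variables (a b : R) (s : bool).

Definition cJ f (x : R) : C :=
  rJ a b s (fun t => complex.Re (f t)) x +i*
  rJ a b s (fun t => complex.Im (f t)) x.

Lemma cJD f g : cintegrable f -> cintegrable g ->
  cJ (fun t => f t + g t) = (fun x => cJ f x + cJ g x).
Proof.
move=> [f1 f2] [g1 g2]; apply/funext => x; rewrite /cJ.
under [X in rJ _ _ _ X _ +i* _]eq_fun do rewrite cReD.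
under [X in _ +i* rJ _ _ _ X _]eq_fun do rewrite cImD.
by rewrite !rJD.
Qed.

Lemma cJZ (c : C) f : cintegrable f ->
  cJ (fun t => c * f t) = (fun x => c * cJ f x).
Proof.
move=> [f1 f2]; apply/funext => x; rewrite /cJ.
have -> : (fun t => complex.Re (c * f t)) = (fun t => complex.Re c * complex.Re (f t)
    + - complex.Im c * complex.Im (f t)).
  by apply/funext => t; rewrite cReM mulNr.
have -> : (fun t => complex.Im (c * f t)) = (fun t => complex.Re c * complex.Im (f t)
    + complex.Im c * complex.Re (f t)).
  by apply/funext => t; rewrite cImM.
rewrite !rJD; try exact: rintegrableZ.
rewrite !rJZ//; case: c => c1 c2 /=.
by rewrite mulNr.
Qed.

Lemma cJ0 : cJ (fun=> 0) = (fun=> 0).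
Proof.
have -> : (fun=> 0) = (fun t : R => 0 * (0 : C)) by apply/funext => t; rewrite mul0r.
by rewrite cJZ//; [apply/funext => x; rewrite mul0r mul0r|exact: cintegrable0].
Qed.

Lemma cJ_sum (I : Type) (r : seq I) (F : I -> R -> C) :
  (forall i, cintegrable (F i)) ->
  cJ (fun t => \sum_(i <- r) F i t) = (fun x => \sum_(i <- r) cJ (F i) x).
Proof.
move=> mF; elim: r => [|i r IH].
  under eq_fun do rewrite big_nil.
  by rewrite cJ0; apply/funext => x; rewrite big_nil.
under eq_fun do rewrite big_cons.
rewrite cJD//; last exact: cintegrable_sum.
by rewrite IH; apply/funext => x; rewrite big_cons.
Qed.

Lemma norm1_cJ f x : cintegrable f -> norm1 (cJ f x) <= l1norm f.
Proof.
move=> [f1 f2]; rewrite norm1_ReIm /l1norm /norm1 rtotD; try exact: rintegrable_norm.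
by apply: lerD; exact: rJ_le.
Qed.

(** The class in which the fixed point is sought. The support condition makes the L^1 norm at most B
    (b - a). *)
Definition cbounded f (B : R) := [/\ cmeasurable f, forall t, norm1 (f t) <= B &
  forall t, ~~ (a <= t <= b) -> f t = 0].

Lemma cbounded_ge0 f B : cbounded f B -> 0 <= B.
Proof. by move=> [_ fB _]; exact: le_trans (norm1_ge0 _) (fB 0). Qed.

Lemma cbounded_integrable f B : cbounded f B -> cintegrable f.
Proof.
move=> [[m1 m2] fB f0]; split.
  apply: (rintegrable_cut (a := a) (b := b) (B := B)) => //.
    by move=> t; exact: le_trans (Re_le_norm1 _) (fB t).
  by move=> t /f0 ->.
apply: (rintegrable_cut (a := a) (b := b) (B := B)) => //.
  by move=> t; exact: le_trans (Im_le_norm1 _) (fB t).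
by move=> t /f0 ->.
Qed.

Lemma l1norm_cbounded f B : a <= b -> cbounded f B -> l1norm f <= B * (b - a).
Proof.
move=> ab [mf fB f0]; apply: le_trans (ler_norm _) _; apply: rtot_cut_le => //.
- exact: cmeasurable_norm1.
- by move=> t; rewrite ger0_norm ?norm1_ge0.
- by move=> t /f0 ->; exact: norm1_0.
Qed.

Lemma cbounded_cJ f : cintegrable f -> cbounded (cJ f) (l1norm f).
Proof.
move=> fi; split; first by case: fi => f1 f2; split; exact: measurable_rJ.
- by move=> t; exact: norm1_cJ.
- by move=> t h; rewrite /cJ /rJ /cut (negPf h).
Qed.

Lemma cbounded_sum (I : Type) (r : seq I) (F : I -> R -> C) (B : I -> R) :
  (forall i, cbounded (F i) (B i)) ->
  cbounded (fun t => \sum_(i <- r) F i t) (\sum_(i <- r) B i).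
Proof.
move=> FB; split.
- by apply: cmeasurable_sum => i; case: (FB i).
- move=> t; apply: le_trans (norm1_sum _ _ _) _.
  by apply: ler_sum => i _; case: (FB i).
- by move=> t h; rewrite big1// => i _; case: (FB i) => _ _; exact.
Qed.

Lemma cboundedZ (c : C) f B : cbounded f B ->
  cbounded (fun t => c * f t) (norm1 c * B).
Proof.
move=> [mf fB f0]; split.
- by apply: cmeasurableM => //; exact: cmeasurable_cst.
- by move=> t; rewrite (le_trans (norm1M _ _))// ler_wpM2l// norm1_ge0.
- by move=> t /f0 ->; rewrite mulr0.
Qed.

Lemma cboundedD f g A B : cbounded f A -> cbounded g B ->
  cbounded (fun t => f t + g t) (A + B).
Proof.
move=> [mf fB f0] [mg gB g0]; split; first exact: cmeasurableD.
- by move=> t; rewrite (le_trans (norm1D _ _))// lerD.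
- by move=> t h; rewrite f0// g0// addr0.
Qed.

Lemma cbounded_le f A B : A <= B -> cbounded f A -> cbounded f B.
Proof. by move=> AB [mf fA f0]; split=> // t; exact: le_trans (fA t) AB. Qed.

Hypothesis ab : a <= b.

(** Passing from the sup norm to the L^1 norm gains the length of the interval at each primitive;
    this produces the powers of d below. *)
Lemma cbounded_iterJ f B k : cbounded f B ->
  cbounded (iter k cJ f) (B * (b - a) ^+ k).
Proof.
move=> fB; elim: k => [|k IH]; first by rewrite expr0 mulr1.
rewrite iterS; apply: cbounded_le (cbounded_cJ (cbounded_integrable IH)).
by rewrite exprSr mulrA; exact: l1norm_cbounded.
Qed.

(** The first primitive of an integrable function only trades the L^1 norm for the sup norm; the
    gain starts with the second. *)
Lemma cbounded_iterSJ f k : cintegrable f ->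
  cbounded (iter k.+1 cJ f) (l1norm f * (b - a) ^+ k).
Proof. by move=> fi; rewrite iterSr; apply: cbounded_iterJ; exact: cbounded_cJ. Qed.

Lemma iterJ_integrable f k : cintegrable f -> cintegrable (iter k cJ f).
Proof.
case: k => // k fi; exact: cbounded_integrable (cbounded_iterSJ _ fi).
Qed.

Lemma iterJD f g k : cintegrable f -> cintegrable g ->
  iter k cJ (fun t => f t + g t) = (fun x => iter k cJ f x + iter k cJ g x).
Proof.
move=> fi gi; elim: k => // k IH; rewrite !iterS IH cJD//; exact: iterJ_integrable.
Qed.

Lemma iterJZ (c : C) f k : cintegrable f ->
  iter k cJ (fun t => c * f t) = (fun x => c * iter k cJ f x).
Proof.
move=> fi; elim: k => // k IH; rewrite !iterS IH cJZ//; exact: iterJ_integrable.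
Qed.

Lemma iterJ_sum (I : Type) (r : seq I) (F : I -> R -> C) k :
  (forall i, cintegrable (F i)) ->
  iter k cJ (fun t => \sum_(i <- r) F i t) =
  (fun x => \sum_(i <- r) iter k cJ (F i) x).
Proof.
move=> mF; elim: k => // k IH; rewrite !iterS IH cJ_sum// => i.
exact: iterJ_integrable.
Qed.

End ComplexCutPrimitive.

Section PolynomialPrimitive.
Variable R : realType.
Variables (a b : R).
Hypothesis ab : a <= b.
Implicit Types p : {poly R}.

Definition pcut p (t : R) : R[i] := cut a b (fun t => (p.[t])%:C) t.

Lemma Rintegral_deriv_poly p x y : x <= y ->
  \int[lebesgue_measure]_(t in `[x, y]) (p^`()).[t] = p.[y] - p.[x].
Proof.
rewrite le_eqVlt => /orP[/eqP->|xy].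
  by rewrite set_itv1 Rintegral_set1 subrr.
rewrite /Rintegral (@continuous_FTC2 _ _ (horner p))//.
- by apply: continuous_subspaceT => z; exact: continuous_horner.
- split=> [z _||]; first exact: derivable_horner.
    by apply: cvg_at_right_filter; exact: continuous_horner.
  by apply: cvg_at_left_filter; exact: continuous_horner.
- by move=> z _; rewrite derivE.
Qed.

Lemma cbounded_pcut p (B : R) :
  (forall t, a <= t <= b -> `|p.[t]| <= B) -> 0 <= B ->
  cbounded a b (pcut p) B.
Proof.
move=> pB B0; split.
- have e1 : (fun t => complex.Re (pcut p t)) = cut a b (horner p).
    by apply/funext => t; rewrite /pcut /cut; case: ifP.
  have e2 : (fun t => complex.Im (pcut p t)) = (fun=> 0).
    by apply/funext => t; rewrite /pcut /cut; case: ifP.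
  split; rewrite ?e1 ?e2//; apply: measurable_cut.
  by apply: continuous_measurable_fun => z; exact: continuous_horner.
- move=> t; rewrite /pcut /cut; case: ifP => h; first by rewrite norm1_real pB.
  by rewrite norm1_0.
- by move=> t h; rewrite /pcut /cut (negPf h).
Qed.

Lemma cJ_pcut (s : bool) p : (if s then p.[b] else p.[a]) = 0 ->
  cJ a b s (pcut p^`()) = pcut p.
Proof.
move=> p0; apply/funext => x; rewrite /cJ.
have e1 : (fun t => complex.Re (pcut p^`() t)) = (horner p^`()) \_ `[a, b].
  by apply/funext => t; rewrite /pcut /cut /patch mem_setE in_itv/=; case: ifP.
have e2 : (fun t => complex.Im (pcut p^`() t)) = (fun=> 0).
  by apply/funext => t; rewrite /pcut /cut; case: ifP.
rewrite e1 e2.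
have -> : rJ a b s (fun=> 0) x = 0.
  rewrite /rJ /cut /rprim /rtot !Rintegral_cst// !mul0r.
  by case: (s); rewrite ?subr0; case: ifP.
rewrite /rJ /pcut /cut; case: ifP => // /andP[ax xb].
have -> : rprim (horner p^`() \_ `[a, b]) x = p.[x] - p.[a].
  rewrite /rprim -Rintegral_mkcondr.
  have -> : `]-oo, x]%classic `&` `[a, b]%classic = (`[a, x]%classic : set R).
    apply/seteqP; split=> t /=; rewrite !in_itv/=.
      by move=> [tx /andP[-> _]].
    by move=> /andP[-> tx]; split=> //=; exact: le_trans tx xb.
  exact: Rintegral_deriv_poly.
have -> : rtot (horner p^`() \_ `[a, b]) = p.[b] - p.[a].
  by rewrite /rtot -Rintegral_mkcond; exact: Rintegral_deriv_poly.
by case: s p0 => p0; congr (_ +i* _); rewrite p0; ring.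
Qed.

End PolynomialPrimitive.

(** * A contraction principle and Hermite interpolation *)

Section GeometricLimit.
Variable R : realType.

Lemma exp2_archimedean (K e : R) : 0 < e -> exists m, K / 2 ^+ m < e.
Proof.
move=> e0; exists (Num.truncn (K / e)).+1.
rewrite ltr_pdivrMr ?exprn_gt0// mulrC -ltr_pdivrMr//.
apply: (lt_le_trans (truncnS_gt _)).
by rewrite -natrX ler_nat ltnW// ltn_expl.
Qed.

Lemma geometric_cauchy_cvg (v : nat -> R) (K : R) :
  (forall m k, `|v (m + k)%N - v m| <= K / 2 ^+ m) ->
  exists2 l : R, v @ \oo --> l & forall m, `|l - v m| <= K / 2 ^+ m.
Proof.
move=> vK.
have : cvg (v @ \oo).
  apply: R_complete; apply: cauchy_exP => e e0.
  have [m hm] := exp2_archimedean K e0.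
  exists (v m); exists m => // j /= mj.
  rewrite /ball /= distrC; apply: le_lt_trans hm.
  by rewrite -(subnKC mj).
move=> cv; exists (lim (v @ \oo)) => // m.
apply/ler_addgt0Pl => e e0.
have /cvgrPdist_le/(_ e e0)[N _ hN] : v @ \oo --> lim (v @ \oo) by exact: cv.
have := hN (m + N)%N (leq_addl _ _) => /= h.
rewrite -(subrKA (v (m + N)%N)) (le_trans (ler_normD _ _))// lerD//.
Qed.

Lemma le0_exp2 (x K : R) : (forall m, x <= K / 2 ^+ m) -> x <= 0.
Proof.
move=> h; apply/ler_addgt0Pl => e e0; rewrite addr0.
by have [m hm] := exp2_archimedean K e0; exact: le_trans (h m) (ltW hm).
Qed.

End GeometricLimit.

Section Contraction.
Variables (R : realType) (a b : R) (T : (R -> R[i]) -> R -> R[i]) (M : R).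
Let bd u := exists B, cbounded a b u B.

(** Picard iteration from 0. Successive differences are at most M / 2^m, so real and imaginary parts
    converge with error 2 M / 2^m each, whence the factor 4. The limit is pointwise, which preserves
    Borel measurability and the support. *)
Lemma contraction_fixpoint :
  (forall u, bd u -> bd (T u)) ->
  (forall u v B, bd u -> bd v -> (forall x, norm1 (u x - v x) <= B) ->
    forall x, norm1 (T u x - T v x) <= B / 2) ->
  (forall x, norm1 (T (fun=> 0) x) <= M) ->
  exists2 u, cbounded a b u (4 * M) & T u = u.
Proof.
move=> Tbd Tc T0.
pose U m := iter m T (fun=> 0).
have M0 : 0 <= M by exact: le_trans (norm1_ge0 _) (T0 0).
have Ubd m : bd (U m).
  elim: m => [|m IH]; last exact: Tbd.
  exists 0; split=> [|t|//]; first exact: cmeasurable_cst.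
  by rewrite norm1_0.
have dU m x : norm1 (U m.+1 x - U m x) <= M / 2 ^+ m.
  elim: m x => [|m IH] x; first by rewrite expr0 divr1 /U /= subr0; exact: T0.
  rewrite exprSr invfM mulrA.
  by apply: (@Tc (U m.+1) (U m)); [exact: Ubd|exact: Ubd|exact: IH].
(* The factor 1 - 2^-k is what makes the induction on k close. *)
have cU m k x : norm1 (U (m + k)%N x - U m x) <= (2 * M) / 2 ^+ m * (1 - 2^-1 ^+ k).
  elim: k => [|k IH]; first by rewrite addn0 expr0 !subrr mulr0 norm1_0.
  rewrite addnS -(subrKA (U (m + k)%N x)) (le_trans (norm1D _ _))//.
  rewrite (le_trans (lerD (dU _ _) IH))// exprD invfM exprSr exprVn.
  by set p := (2 ^+ m)^-1; set q := (2 ^+ k)^-1; lra.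
have cU' m k x : norm1 (U (m + k)%N x - U m x) <= (2 * M) / 2 ^+ m.
  apply: le_trans (cU m k x) _; rewrite ler_piMr//.
    by rewrite divr_ge0// ?mulr_ge0// exprn_ge0.
have Re_cvg x : {l : R | (fun m => complex.Re (U m x)) @ \oo --> l /\
    forall m, `|l - complex.Re (U m x)| <= (2 * M) / 2 ^+ m}.
  apply: cid; have [|l l1 l2] := @geometric_cauchy_cvg R
    (fun m => complex.Re (U m x)) (2 * M); last by exists l.
  by move=> m k; rewrite -cReB; exact: le_trans (Re_le_norm1 _) (cU' m k x).
have Im_cvg x : {l : R | (fun m => complex.Im (U m x)) @ \oo --> l /\
    forall m, `|l - complex.Im (U m x)| <= (2 * M) / 2 ^+ m}.
  apply: cid; have [|l l1 l2] := @geometric_cauchy_cvg R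
    (fun m => complex.Im (U m x)) (2 * M); last by exists l.
  by move=> m k; rewrite -cImB; exact: le_trans (Im_le_norm1 _) (cU' m k x).
pose u x := sval (Re_cvg x) +i* sval (Im_cvg x).
have uU m x : norm1 (u x - U m x) <= 4 * M / 2 ^+ m.
  rewrite /u; case: (Re_cvg x) => l1 /= h1; case: (Im_cvg x) => l2 /= h2.
  rewrite /norm1 cReB cImB /=; have := h1.2 m; have := h2.2 m.
  by set p := (2 ^+ m)^-1; lra.
have ubd : cbounded a b u (4 * M).
  split.
  - split.
      apply: (measurable_fun_cvg (h := fun m x => complex.Re (U m x))).
        by move=> m; have [B [[]]] := Ubd m.
      by move=> x _; exact: (svalP (Re_cvg x)).1.
    apply: (measurable_fun_cvg (h := fun m x => complex.Im (U m x))).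
    + by move=> m; have [B [[]]] := Ubd m.
    + by move=> x _; exact: (svalP (Im_cvg x)).1.
  - by move=> x; have := uU 0%N x; rewrite expr0 divr1 subr0.
  - move=> x h; apply: norm1_eq0; apply/eqP; rewrite eq_le norm1_ge0 andbT.
    apply: (@le0_exp2 _ _ (4 * M)) => m; have := uU m x.
    by case: (Ubd m) => B [_ _ ->]//; rewrite subr0.
exists u => //; apply/funext => x; apply/eqP; rewrite -subr_eq0; apply/eqP.
apply: norm1_eq0; apply/eqP; rewrite eq_le norm1_ge0 andbT.
apply: (@le0_exp2 _ _ (4 * M)) => m.
rewrite -(subrKA (U m.+1 x)) (le_trans (norm1D _ _))//.
have h1 : norm1 (T u x - U m.+1 x) <= 4 * M / 2 ^+ m / 2.
  by apply: Tc => //; exists (4 * M).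
have h2 := uU m.+1 x; rewrite norm1_distC exprSr invfM mulrA in h2.
rewrite (le_trans (lerD h1 h2))//.
by rewrite -splitr.
Qed.

End Contraction.

(** * Hermite interpolation with bounds uniform in the interval *)

Section HermitePolynomials.
Variable R : realType.
Implicit Types p : {poly R}.

Lemma derivn_comp_affine p (c d : R) k :
  (p \Po (c *: 'X + d%:P))^`(k) = c ^+ k *: (p^`(k) \Po (c *: 'X + d%:P)).
Proof.
elim: k => [|k IH]; first by rewrite expr0 scale1r.
rewrite derivnS IH derivZ deriv_comp derivD derivZ derivX derivC addr0 -derivnS.
by rewrite mulrC -scalerAl mul1r scalerA exprSr.
Qed.

Lemma derivn_dvdp_eq0 (c : R) n p k : ('X - c%:P) ^+ n %| p -> (k < n)%N ->
  (p^`(k)).[c] = 0.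
Proof.
elim: k n p => [|k IH] [|n]// p /dvdpP[q ->] kn.
  by rewrite derivn0 hornerM exprS hornerM hornerXsubC subrr mul0r mulr0.
rewrite derivSn; apply: (IH n) => //; rewrite derivM dvdp_addr.
  by rewrite deriv_exp dvdp_mull// -mulr_natl dvdp_mull// dvdp_mull// dvdpp.
by rewrite dvdp_mull// exprS dvdp_mull.
Qed.

Lemma hermite_poly n j : exists p : {poly R}, forall k, (k < n)%N ->
  (p^`(k)).[0] = 0 /\ (p^`(k)).[1] = (k == j)%:R.
Proof.
pose r : {poly R} := j`!%:R^-1 *: ('X^j \Po (1 *: 'X + (-1)%:P)).
have rE k : (r^`(k)).[1] = (k == j)%:R.
  rewrite /r derivnZ derivn_comp_affine expr1n scale1r hornerZ horner_comp.
  rewrite !hornerE subrr derivnXn hornerMn hornerXn.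
  have j0 : j`!%:R != 0 :> R by rewrite pnatr_eq0 -lt0n fact_gt0.
  have [kj|kj|->] := ltngtP k j.
  - by rewrite expr0n subn_eq0 leqNgt kj mul0rn mulr0.
  - by rewrite ffact_small// mulr0n mulr0.
  - by rewrite subnn expr0 ffactnn mulVf.
have cop : coprimep ('X^n : {poly R}) (('X - 1%:P) ^+ n).
  apply: coprimep_expl; apply: coprimep_expr.
  rewrite -[X in coprimep X _]subr0 -polyC0 coprimep_XsubC2 ?subr0 ?oner_neq0//.
have /Bezout_eq1_coprimepP[[u v] /= uv] := cop.
exists (r * u * 'X^n) => k kn; split.
  apply: derivn_dvdp_eq0 kn; rewrite polyC0 subr0.
  by rewrite dvdp_mull// dvdpp.
have -> : r * u * 'X^n = r - r * v * ('X - 1%:P) ^+ n.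
  by rewrite -!mulrA -[X in _ = X - _]mulr1 -uv mulrDr; ring.
rewrite derivnB hornerD hornerN rE [X in _ - X](derivn_dvdp_eq0 _ kn) ?subr0//.
by rewrite dvdp_mull// dvdpp.
Qed.

Definition coef_norm p : R := \sum_(i < size p) `|p`_i|.

Lemma horner_coef_norm p t : 0 <= t <= 1 -> `|p.[t]| <= coef_norm p.
Proof.
move=> /andP[t0 t1]; rewrite horner_coef (le_trans (ler_norm_sum _ _ _))//.
apply: ler_sum => i _; rewrite normrM ler_piMr// ger0_norm ?exprn_ge0//.
exact: exprn_ile1.
Qed.

Lemma coef_norm_ge0 p : 0 <= coef_norm p.
Proof. by apply: sumr_ge0. Qed.

(* psi j is (e - m) ^ j times a fixed polynomial in (t - m) / (e - m). *)
Lemma scaled_hermite n : exists2 C : R, 0 <= C & forall m e : R, m != e ->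
  exists psi : nat -> {poly R}, forall j, (j < n)%N ->
    (forall k, (k < n)%N -> ((psi j)^`(k)).[m] = 0 /\
      ((psi j)^`(k)).[e] = (k == j)%:R) /\
    (forall k t, (k <= n)%N -> 0 <= (t - m) / (e - m) <= 1 ->
      `|((psi j)^`(k)).[t]| <= C * (`|e - m| ^+ j / `|e - m| ^+ k)).
Proof.
have [Psi PsiE] := choice (fun j => hermite_poly n j).
(* The constant depends on n only, so it survives the shrinking of the interval. *)
exists (\sum_(j < n) \sum_(k < n.+1) coef_norm (Psi j)^`(k)).
  by apply: sumr_ge0 => j _; apply: sumr_ge0 => k _; exact: coef_norm_ge0.
move=> m e me; pose d := e - m.
have d0 : d != 0 by rewrite subr_eq0 eq_sym.
pose q : {poly R} := d^-1 *: 'X + (- m / d)%:P.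
have qE t : q.[t] = (t - m) / d by rewrite !hornerE; field.
exists (fun j => d ^+ j *: (Psi j \Po q)) => j jn.
have pE k t : ((d ^+ j *: (Psi j \Po q))^`(k)).[t] =
    d ^+ j / d ^+ k * ((Psi j)^`(k)).[(t - m) / d].
  by rewrite derivnZ derivn_comp_affine -/q !hornerZ horner_comp qE exprVn mulrA.
split=> [k kn|k t kn t01].
  rewrite !pE subrr mul0r divff//; have [-> ->] := PsiE j k kn.
  rewrite mulr0; split=> //; case: eqP => [->|_]; last by rewrite mulr0.
  by rewrite mulr1 divff// expf_neq0.
rewrite pE !normrM normfV !normrX mulrC ler_wpM2r//.
apply: le_trans (horner_coef_norm _ t01) _.
rewrite (bigD1 (Ordinal jn))//= (bigD1 (Ordinal (kn : (k < n.+1)%N)))//=.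
rewrite -addrA lerDl addr_ge0//; first by apply: sumr_ge0 => i _; exact: coef_norm_ge0.
by apply: sumr_ge0 => i _; apply: sumr_ge0 => i' _; exact: coef_norm_ge0.
Qed.

End HermitePolynomials.

(** * Solutions concentrated near one endpoint *)

Section Ctot.
Variable R : realType.
Local Notation C := R[i].
Implicit Types f g : R -> C.

Definition ctot f : C := rtot (fun t => complex.Re (f t)) +i*
  rtot (fun t => complex.Im (f t)).

Lemma ctotD f g : cintegrable f -> cintegrable g ->
  ctot (fun t => f t + g t) = ctot f + ctot g.
Proof.
move=> [f1 f2] [g1 g2]; rewrite /ctot.
rewrite (_ : (fun t => complex.Re _) = (fun t => complex.Re (f t) + complex.Re (g t)));
  last by apply/funext => t; exact: cReD.
rewrite (_ : (fun t => complex.Im (f t + g t)) = (fun t => complex.Im (f t) + complex.Im (g t)));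
  last by apply/funext => t; exact: cImD.
by rewrite !rtotD.
Qed.

Lemma norm1_ctot f : cintegrable f -> norm1 (ctot f) <= l1norm f.
Proof.
move=> [f1 f2]; rewrite norm1_ReIm /l1norm /norm1 rtotD; try exact: rintegrable_norm.
by apply: lerD; exact: le_normr_Rintegral.
Qed.

Lemma ctotZ (c : C) f : cintegrable f -> ctot (fun t => c * f t) = c * ctot f.
Proof.
move=> [f1 f2]; rewrite /ctot.
have -> : (fun t => complex.Re (c * f t)) = (fun t => complex.Re c * complex.Re (f t)
    + - complex.Im c * complex.Im (f t)).
  by apply/funext => t; rewrite cReM mulNr.
have -> : (fun t => complex.Im (c * f t)) = (fun t => complex.Re c * complex.Im (f t)
    + complex.Im c * complex.Re (f t)).
  by apply/funext => t; rewrite cImM.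
rewrite !rtotD; try exact: rintegrableZ.
by rewrite !rtotZ//; case: c => c1 c2 /=; rewrite mulNr.
Qed.

Lemma ctot_sum (I : Type) (r : seq I) (F : I -> R -> C) :
  (forall i, cintegrable (F i)) ->
  ctot (fun t => \sum_(i <- r) F i t) = \sum_(i <- r) ctot (F i).
Proof.
move=> mF; elim: r => [|i r IH].
  under eq_fun do rewrite big_nil.
  have -> : (fun=> 0) = (fun t : R => 0 * (0 : C)) by apply/funext => t; rewrite mul0r.
  by rewrite ctotZ ?mul0r ?big_nil//; exact: cintegrable0.
under eq_fun do rewrite big_cons.
by rewrite ctotD//; [rewrite IH big_cons|exact: cintegrable_sum].
Qed.

Lemma cboundedM a b f g (A B : R) : cbounded a b f A -> cbounded a b g B ->
  cbounded a b (fun t => f t * g t) (A * B).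
Proof.
move=> [mf fA f0] [mg gB g0]; split; first exact: cmeasurableM.
- by move=> t; rewrite (le_trans (norm1M _ _))// ler_pM ?norm1_ge0.
- by move=> t /f0 ->; rewrite mul0r.
Qed.

Lemma cbounded_conj a b f (A : R) : cbounded a b f A ->
  cbounded a b (fun t => conjc (f t)) A.
Proof.
move=> [mf fA f0]; split; first exact: cmeasurable_conj.
- by move=> t; rewrite norm1_conj.
- by move=> t /f0 ->; rewrite conjc0.
Qed.

Variables (a b : R).
Hypothesis ab : a <= b.

Lemma poly_bounded (p : {poly R}) : exists B, cbounded a b (pcut a b p) B.
Proof.
have [M MB] : exists M : R, forall t, a <= t <= b -> `|p.[t]| <= M.
  have cp : {within `[a, b], continuous (fun t => `|p.[t]|)}.
    apply: continuous_subspaceT => z.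
    by apply: (@continuous_comp _ _ _ (horner p) (fun y : R => `|y|));
      [exact: continuous_horner|exact: norm_continuous].
  have [c _ h] := EVT_max ab cp; exists `|p.[c]| => t tab.
  by apply: h; rewrite in_itv.
exists `|M|; apply: cbounded_pcut => // t tab.
by rewrite (le_trans (MB _ tab))// ler_norm.
Qed.

Lemma pcut_integrable (p : {poly R}) : cintegrable (pcut a b p).
Proof. by have [B /cbounded_integrable] := poly_bounded p. Qed.

Lemma pcutM_integrable (p p' : {poly R}) :
  cintegrable (fun t => pcut a b p t * pcut a b p' t).
Proof.
have [B hB] := poly_bounded p; have [B' hB'] := poly_bounded p'.
exact: cbounded_integrable (cboundedM hB hB').
Qed.

Lemma ctot_pcutM (p p' : {poly R}) :
  ctot (fun t => pcut a b p t * pcut a b p' t) =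
  (\int[lebesgue_measure]_(t in `[a, b]) (p * p').[t])%:C.
Proof.
rewrite /ctot /rtot [X in X%:C]Rintegral_mkcond; congr (_ +i* _).
  congr (Rintegral _ _ _); apply/funext => t.
  rewrite /pcut /cut /patch mem_setE in_itv/=.
  by case: ifP => _ /=; rewrite ?mul0r ?subr0 ?hornerM.
rewrite (_ : (fun t => complex.Im _) = (fun=> 0)); first by rewrite Rintegral_cst// mul0r.
apply/funext => t; rewrite /pcut /cut.
by case: ifP => _ /=; rewrite ?mul0r ?mulr0 addr0.
Qed.

End Ctot.

(** * Lagrange's identity for the interpolating polynomials *)

Section LagrangePolynomials.
Variable R : realType.
Variables (N : nat) (a b : R) (s : bool) (psi : nat -> {poly R}).
Hypothesis ab : a <= b.
Hypothesis N_odd : odd N.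
Let m := if s then b else a.
Let e := if s then a else b.
Hypothesis psi_m : forall j k, (j < N.+1)%N -> (k < N.+1)%N ->
  ((psi j)^`(k)).[m] = 0 /\ ((psi j)^`(k)).[e] = (k == j)%:R.

(** The bilinear concomitant of the n-th derivative, n = N+1. Its derivative telescopes, and the
    last sign is (-1)^(N+1) = 1 because N is odd. *)
Let V j l : {poly R} :=
  \sum_(i < N.+1) (-1) ^+ i *: ((psi j)^`(N - i) * (psi l)^`(i)).

Let deriv_V j l : (V j l)^`() = (psi j)^`(N.+1) * psi l - psi j * (psi l)^`(N.+1).
Proof.
pose F i : {poly R} := (-1) ^+ i *: ((psi j)^`(N.+1 - i) * (psi l)^`(i)).
have -> : (V j l)^`() = \sum_(i < N.+1) (F i - F i.+1).
  rewrite raddf_sum/=; apply: eq_bigr => i _.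
  rewrite /F derivZ derivM -!derivnS subSS -subSn; last by rewrite -ltnS.
  by rewrite exprS mulN1r scaleNr opprK scalerDr.
rewrite -(big_mkord xpredT (fun i => F i - F i.+1)) -[LHS]opprK -sumrN.
  under eq_bigr do rewrite opprB.
  rewrite telescope_sumr// opprB.
rewrite /F expr0 scale1r subn0 derivn0 subnn derivn0 -signr_odd /= N_odd /=.
by rewrite expr0 scale1r.
Qed.

(** The integral is the increment of [V]. At the inner end all data vanish; at [e] only the term i =
    l survives, and only if N - l = j. The sign (-1)^s tells whether [e] is the left or the right
    end. *)
Lemma lagrange_psi j l : (j < N.+1)%N -> (l < N.+1)%N ->
  ctot (fun t => pcut a b (psi j)^`(N.+1) t * pcut a b (psi l) t) -
  ctot (fun t => pcut a b (psi l)^`(N.+1) t * pcut a b (psi j) t) =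
  (-1) ^+ s * (-1) ^+ l * (j + l == N)%N%:R.
Proof.
move=> jn ln; rewrite !ctot_pcutM// -rmorphB/=.
have ip (p : {poly R}) :
    lebesgue_measure.-integrable `[a, b] (EFin \o (fun t => p.[t])).
  apply: continuous_compact_integrable; first exact: segment_compact.
  by apply: continuous_subspaceT => z; exact: continuous_horner.
rewrite -RintegralB//=.
have -> : \int[lebesgue_measure]_(t in `[a, b]) (((psi j)^`(N.+1) * psi l).[t] -
    ((psi l)^`(N.+1) * psi j).[t]) =
    \int[lebesgue_measure]_(t in `[a, b]) ((V j l)^`()).[t].
  by apply: eq_Rintegral => t _; rewrite deriv_V hornerD hornerN [X in _ = _ - X.[_]]mulrC.
rewrite Rintegral_deriv_poly//.
have Vm : (V j l).[m] = 0.
  rewrite horner_sum big1// => i _; rewrite hornerZ hornerM.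
  by rewrite (psi_m ln (ltn_ord i)).1 !mulr0.
have Ve : (V j l).[e] = (-1) ^+ l * (j + l == N)%N%:R.
  rewrite horner_sum (bigD1 (Ordinal ln))//= big1 ?addr0; last first.
    move=> i il; rewrite hornerZ hornerM (psi_m ln (ltn_ord i)).2.
    by rewrite (_ : (i == l :> nat) = false) ?mulr0//; apply/negbTE.
  rewrite hornerZ hornerM (psi_m ln ln).2 eqxx mulr1.
  rewrite (psi_m jn (_ : (N - l < N.+1)%N)).2; last by rewrite ltnS leq_subr.
  congr (_ * (_ : bool)%:R).
  by rewrite ltnS in ln; apply/eqP/eqP => [<-|<-]; rewrite ?subnK// addnK.
case: s @m @e Vm Ve => /= Vm Ve; rewrite Vm Ve ?subr0 ?sub0r.
  by rewrite expr1 mulN1r mulNr !(rmorphN, rmorphM, rmorphXn) /= rmorph1 rmorph_nat.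
by rewrite expr0 mul1r !(rmorphN, rmorphM, rmorphXn) /= rmorph1 rmorph_nat.
Qed.

End LagrangePolynomials.

(** * The boundary layer as a fixed point *)

Section Layer.
Variable R : realType.
Local Notation C := R[i].
Variables (N : nat) (q : nat -> R -> C).
Hypothesis N_odd : odd N.
Hypothesis q_int : forall k, cintegrable (q k).

Variables (C0 Z : R) (a b : R) (s : bool) (psi : nat -> {poly R}) (z : nat -> C).
Let d := b - a.
(** [m] is the inner end, where the interpolating polynomials have zero data and from which
    primitives are taken; [e] is the end that carries the data [z]. *)
Let m := if s then b else a.
Let e := if s then a else b.
Let P := \sum_(k < N) l1norm (q k).
Let n := N.+1.
(** [M / d ^+ N] bounds the map at 0, so its fixed point is bounded by 4 M / d^N; [L * (d / d ^+ N)]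
    then bounds the lower-order terms in L^1. *)
Let M := n%:R * (Z * C0).
Let L := 4 * M * P.

Hypothesis C0_ge0 : 0 <= C0.
Hypothesis Z_ge0 : 0 <= Z.
Hypothesis d_gt0 : 0 < d.
Hypothesis d_le1 : d <= 1.
(** The Lipschitz constant of the map is at most d P (1 + n C0), which must not exceed 1/2. *)
Hypothesis d_small : 2 * d * (P * (1 + n%:R * C0)) <= 1.
Hypothesis psi_m : forall j k, (j < n)%N -> (k < n)%N ->
  ((psi j)^`(k)).[m] = 0 /\ ((psi j)^`(k)).[e] = (k == j)%:R.
Hypothesis psi_le : forall j k t, (j < n)%N -> (k <= n)%N -> a <= t <= b ->
  `|((psi j)^`(k)).[t]| <= C0 * (d ^+ j / d ^+ k).
Hypothesis z_le : forall j, (j < n)%N -> norm1 (z j) <= Z / d ^+ j.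

Let J := @cJ R a b s.
Let ab : a <= b. Proof. by rewrite -subr_ge0 ltW. Qed.
Let P_ge0 : 0 <= P. Proof. by apply: sumr_ge0 => k _; exact: l1norm_ge0. Qed.
Let M_ge0 : 0 <= M. Proof. by rewrite !mulr_ge0. Qed.
Let L_ge0 : 0 <= L. Proof. by rewrite !mulr_ge0. Qed.
Let dX_gt0 k : 0 < d ^+ k. Proof. exact: exprn_gt0. Qed.
Let dX_ge0 k : 0 <= d ^+ k. Proof. exact: ltW. Qed.
Let dXV_ge0 k : 0 <= (d ^+ k)^-1. Proof. by rewrite invr_ge0. Qed.

Let phi j k := pcut a b (psi j)^`(k).

Let phi_bounded j k : (j < n)%N -> (k <= n)%N ->
  cbounded a b (phi j k) (C0 * (d ^+ j / d ^+ k)).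
Proof.
move=> jn kn; apply: cbounded_pcut; first by move=> t; exact: psi_le.
by rewrite mulr_ge0// mulr_ge0.
Qed.

Let phi_int j k : cintegrable (phi j k). Proof. exact: pcut_integrable. Qed.

Let J_phi j k : (j < n)%N -> (k < n)%N -> J (phi j k.+1) = phi j k.
Proof.
move=> jn kn; rewrite /J /phi derivnS cJ_pcut//.
by have := (psi_m jn kn).1; rewrite /m; case: (s).
Qed.

Let iterJ_phi j k i : (j < n)%N -> (k + i <= n)%N ->
  iter i J (phi j (k + i)) = phi j k.
Proof.
move=> jn; elim: i => [|i IH] kin; first by rewrite addn0.
rewrite iterSr addnS J_phi//; last by rewrite addnS in kin.
by apply: IH; rewrite (leq_trans _ kin)// leq_add2l.
Qed.

Let phi_e j k : (j < n)%N -> (k < n)%N -> phi j k e = (k == j)%:R.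
Proof.
move=> jn kn; rewrite /phi /pcut /cut.
have -> : a <= e <= b by rewrite /e; case: (s); rewrite lexx ab.
by rewrite (psi_m jn kn).2 rmorph_nat.
Qed.

(** The unknown u stands for the derivative of order N, and [Yk u k] for the one of order k. [g u]
    collects the lower-order terms moved to the right, [rdata u j] is the datum of order j at [e] of
    the n-fold primitive of [g u], and [T] adds the interpolating polynomial that corrects these
    data to [z]. *)
Let Yk u k := iter (N - k) J u.
Let g u t := - (\sum_(k < N) q k t * Yk u k t).
Let rdata u j := iter (N - j).+1 J (g u) e.
Let T u x := J (g u) x + \sum_(j < n) (z j - rdata u j) * phi j N x.

Let bd u := exists B, cbounded a b u B.

Let Yk_bounded u B k : cbounded a b u B -> cbounded a b (Yk u k) (B * d ^+ (N - k)).
Proof. by move=> uB; exact: cbounded_iterJ. Qed.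

(** Since k < N, each [Yk u k] has undergone at least one primitive and carries a factor d^(N-k) <=
    d: here the absence of a term of order n - 1 in l(y) gives smallness. *)
Let g_l1 u B : cbounded a b u B ->
  cintegrable (g u) /\ l1norm (g u) <= B * (d * P).
Proof.
move=> uB; have B0 := cbounded_ge0 uB.
have h (k : 'I_N) := l1normM_le (q_int k) (let: And3 h _ _ := Yk_bounded k uB in h)
  (let: And3 _ h _ := Yk_bounded k uB in h).
have gi : cintegrable (fun t => \sum_(k < N) q k t * Yk u k t).
  by apply: cintegrable_sum => k; case: (h k).
have gE : g u = (fun t => -1 * \sum_(k < N) q k t * Yk u k t).
  by apply/funext => t; rewrite mulN1r.
split; first by rewrite gE; exact: cintegrableZ.
have -> : l1norm (g u) = l1norm (fun t => \sum_(k < N) q k t * Yk u k t).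
  by rewrite /l1norm /g; congr rtot; apply/funext => t; rewrite norm1N.
have sum_le (r : seq 'I_N) : l1norm (fun t => \sum_(k <- r) q k t * Yk u k t) <=
    \sum_(k <- r) B * (d * l1norm (q k)).
  elim: r => [|k r IH].
    rewrite big_nil; under eq_fun do rewrite big_nil.
    rewrite /l1norm; under eq_fun do rewrite norm1_0.
    by rewrite /rtot Rintegral_cst// mul0r.
  rewrite big_cons; under eq_fun do rewrite big_cons.
  have [h1 h2] := h k.
  apply: le_trans (l1normD h1 _) _.
    by apply: cintegrable_sum => i; case: (h i).
  rewrite lerD//; apply: le_trans h2 _; rewrite mulrA ler_wpM2r ?l1norm_ge0//.
  rewrite ler_wpM2l// -[leRHS]expr1 ler_wiXn2l// ?subn_gt0//.
  exact: ltW.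
by rewrite /P mulr_sumr mulr_sumr; exact: sum_le.
Qed.

Let g_int u : bd u -> cintegrable (g u). Proof. by case=> B /g_l1[]. Qed.

Let rdata_le u B j : cbounded a b u B ->
  norm1 (rdata u j) <= B * (d * P) * d ^+ (N - j).
Proof.
move=> uB; have [gi gl] := g_l1 uB.
have [_ h _] := cbounded_iterSJ s ab (N - j) gi.
by apply: le_trans (h e) _; rewrite ler_wpM2r.
Qed.

Let bdB u v : bd u -> bd v -> bd (fun t => u t - v t).
Proof.
move=> [A uA] [B vB]; exists (A + norm1 (-1 : C) * B).
have := cboundedD uA (cboundedZ (-1) vB).
by under eq_fun do rewrite mulN1r.
Qed.

Let bd_int u : bd u -> cintegrable u.
Proof. by case=> B; exact: cbounded_integrable. Qed.

Let gD u v : bd u -> bd v -> g (fun t => u t + v t) = (fun t => g u t + g v t).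
Proof.
move=> bu bv; apply/funext => t; rewrite /g -opprD -big_split/=; congr (- _).
apply: eq_bigr => k _; rewrite /Yk iterJD//; try exact: bd_int.
by rewrite mulrDr.
Qed.

Let rdataD u v j : bd u -> bd v ->
  rdata (fun t => u t + v t) j = rdata u j + rdata v j.
Proof. by move=> bu bv; rewrite /rdata gD// iterJD//; exact: g_int. Qed.

Let T_bd u : bd u -> bd (T u).
Proof.
move=> bu; have gi := g_int bu.
exists (l1norm (g u) + \sum_(j < n) norm1 (z j - rdata u j) * (C0 * (d ^+ j / d ^+ N))).
apply: cboundedD; first exact: cbounded_cJ.
by apply: cbounded_sum => j; apply: cboundedZ; exact: phi_bounded.
Qed.

(** [T] is affine, so only its linear part at w = u - v matters. The factor d^(N-j) of [rdata w j]
    cancels the size d^j / d^N of [phi j N], so each of the n corrections is at most B d P C0. *)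
Let T_contraction u v B : bd u -> bd v -> (forall x, norm1 (u x - v x) <= B) ->
  forall x, norm1 (T u x - T v x) <= B / 2.
Proof.
move=> bu bv uvB x.
pose w t := u t - v t.
have bw : bd w by exact: bdB.
have wB : cbounded a b w B by case: bw => B' [h1 _ h3]; split.
have uE : u = (fun t => v t + w t) by apply/funext => t; rewrite addrC subrK.
have [gwi gw] := g_l1 wB.
have -> : T u x - T v x = J (g w) x - \sum_(j < n) rdata w j * phi j N x.
  rewrite {1}uE /T gD// /J cJD//; try exact: g_int.
  have -> : \sum_(j < n) (z j - rdata (fun t => v t + w t) j) * phi j N x =
      \sum_(j < n) (z j - rdata v j) * phi j N x - \sum_(j < n) rdata w j * phi j N x.
    by rewrite -sumrB; apply: eq_bigr => j _; rewrite rdataD//; ring.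
  by ring.
apply: le_trans (norm1B _ _) _.
have h1 : norm1 (J (g w) x) <= B * (d * P).
  by apply: le_trans (norm1_cJ _ _ _ _ gwi) gw.
have h2 : norm1 (\sum_(j < n) rdata w j * phi j N x) <=
    n%:R * (B * (d * P) * C0).
  apply: le_trans (norm1_sum _ _ _) _.
  apply: le_trans (_ : \sum_(j < n) B * (d * P) * C0 <= _); last first.
    by rewrite sumr_const card_ord mulr_natl.
  apply: ler_sum => j _; apply: le_trans (norm1M _ _) _.
  have [_ h _] := phi_bounded (ltn_ord j) (leqnSn N).
  apply: le_trans (ler_pM (norm1_ge0 _) (norm1_ge0 _) (rdata_le j wB) (h x)) _.
  rewrite -[leRHS]mulr1 -(@divff _ (d ^+ N)) ?gt_eqF//.
  rewrite -[in X in _ <= _ * (X / _)](@subnK j N); last by rewrite -ltnS.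
  by rewrite exprD le_eqVlt; apply/orP; left; apply/eqP; ring.
have B0 := cbounded_ge0 wB.
apply: le_trans (lerD h1 h2) _.
have := ler_wpM2l B0 d_small.
set X := n%:R * C0.
have -> : n%:R * (B * (d * P) * C0) = B * (d * P) * X by rewrite /X; ring.
lra.
Qed.

Let T_zero x : norm1 (T (fun=> 0) x) <= M / d ^+ N.
Proof.
have b0 : cbounded a b (fun=> 0) 0.
  by split=> [|t|//]; [exact: cmeasurable_cst|rewrite norm1_0].
have r0 j : rdata (fun=> 0) j = 0.
  apply: norm1_eq0; apply/eqP; rewrite eq_le norm1_ge0 andbT.
  by apply: le_trans (rdata_le j b0) _; rewrite !mul0r.
have J0 : J (g (fun=> 0)) x = 0.
  have [gi gl] := g_l1 b0.
  apply: norm1_eq0; apply/eqP; rewrite eq_le norm1_ge0 andbT.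
  by apply: le_trans (norm1_cJ _ _ _ _ gi) _; rewrite (le_trans gl)// mul0r.
rewrite /T J0 add0r; apply: le_trans (norm1_sum _ _ _) _.
apply: le_trans (_ : \sum_(j < n) (Z * C0) / d ^+ N <= _); last first.
  by rewrite sumr_const card_ord -mulr_natl /M mulrA.
apply: ler_sum => j _; rewrite r0 subr0; apply: le_trans (norm1M _ _) _.
have [_ h _] := phi_bounded (ltn_ord j) (leqnSn N).
apply: le_trans (ler_pM (norm1_ge0 _) (norm1_ge0 _) (z_le (ltn_ord j)) (h x)) _.
by rewrite le_eqVlt; apply/orP; left; apply/eqP; field; rewrite !gt_eqF.
Qed.

(** [E] holds the data at [e] of the polynomial part of y, and [Q] is the integral of [h] against
    the conjugate of that part alone. Being a form in real polynomials, [Q] has an explicit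
    imaginary part. *)
Lemma layer_fixpoint : exists Y : nat -> R -> C, exists h : R -> C,
  exists E : nat -> C, exists Q : C,
  [/\ (forall k, (k < N)%N -> Y k = J (Y k.+1)),
      Y N = J (fun t => h t - \sum_(k < N) q k t * Y k t),
      (forall k, (k < n)%N -> cbounded a b (Y k) (4 * M / d ^+ k)) &
      cbounded a b h (n%:R * (Z + L) * C0 / d ^+ n)] /\
  [/\ (forall k, (k < n)%N -> Y k e = z k),
      (forall j, (j < n)%N -> norm1 (E j - z j) <= L * (d / d ^+ j)),
      norm1 (ctot (fun t => h t * conjc (Y 0%N t)) - Q) <=
        n%:R * (Z + L) * C0 * L * (d / d ^+ N) &
      Q - conjc Q = (-1) ^+ s * \sum_(l < n) (-1) ^+ l * (E (N - l)%N * conjc (E l))].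
Proof.
have [u uM uT] := contraction_fixpoint T_bd T_contraction T_zero.
have bu : bd u by exists (4 * (M / d ^+ N)).
have [gi gl] := g_l1 uM.
have {}gl : l1norm (g u) <= L * (d / d ^+ N).
  by rewrite (le_trans gl)// /L le_eqVlt; apply/orP; left; apply/eqP; ring.
pose E j := z j - rdata u j.
have rE j : (j < n)%N -> norm1 (rdata u j) <= L * (d / d ^+ j).
  move=> jn; apply: le_trans (rdata_le j uM) _.
  rewrite -[X in _ / d ^+ X](@subnK j N)// exprD.
  by rewrite le_eqVlt; apply/orP; left; apply/eqP; rewrite /L; field; rewrite !gt_eqF.
have EE j : (j < n)%N -> norm1 (E j) <= (Z + L) / d ^+ j.
  move=> jn; apply: le_trans (norm1B _ _) _.
  rewrite mulrDl lerD ?z_le//; apply: le_trans (rE _ jn) _.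
  by rewrite ler_wpM2l// ler_piMl.
pose h t := \sum_(j < n) E j * phi j n t.
pose G t := h t - \sum_(k < N) q k t * Yk u k t.
have hi : cintegrable h by apply: cintegrable_sum => j; exact: cintegrableZ.
have GE : G = (fun t => g u t + h t) by apply/funext => t; rewrite addrC.
have JG : J G = u.
  rewrite GE /J cJD// cJ_sum; last by move=> j; exact: cintegrableZ.
  rewrite -[RHS]uT; apply/funext => x; congr (_ + _); apply: eq_bigr => j _.
  by rewrite cJZ// -/J J_phi.
(* Splitting of y^(k) into a primitive of the lower-order terms and the k-th derivative of the
   polynomial sum_j E_j psi_j. *)
have YE k : (k < n)%N -> Yk u k = (fun x => iter (N - k).+1 J (g u) x +
    \sum_(j < n) E j * phi j k x).
  move=> kn; rewrite /Yk -{1}JG -iterSr GE iterJD// iterJ_sum//; last first.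
    by move=> j; exact: cintegrableZ.
  apply/funext => x; congr (_ + _); apply: eq_bigr => j _.
  rewrite iterJZ//; congr (_ * _).
  have kN : (k + (N - k).+1)%N = n by rewrite addnS subnKC.
  have := @iterJ_phi j k (N - k).+1 (ltn_ord j); rewrite kN => /(_ (leqnn _)) kE.
  by rewrite -/J kE.
exists (Yk u), h, E, (\sum_(j < n) \sum_(l < n) E j * conjc (E l) *
  ctot (fun t => phi j n t * phi l 0%N t)).
have hB : cbounded a b h (n%:R * (Z + L) * C0 / d ^+ n).
  apply: (@cbounded_le _ _ _ _ (\sum_(j < n) norm1 (E j) * (C0 * (d ^+ j / d ^+ n)))).
    apply: le_trans (_ : \sum_(j < n) (Z + L) * C0 / d ^+ n <= _); last first.
      by rewrite sumr_const card_ord -[leLHS]mulr_natl !mulrA.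
    apply: ler_sum => j _.
    apply: le_trans (ler_wpM2r _ (EE _ (ltn_ord j))) _; first by rewrite !mulr_ge0.
    by rewrite le_eqVlt; apply/orP; left; apply/eqP; field; rewrite !gt_eqF.
  by apply: cbounded_sum => j; apply: cboundedZ; exact: phi_bounded.
split; split.
- by move=> k kN; rewrite /Yk -iterS subnSK.
- by rewrite /Yk subnn /= -[LHS]JG.
- move=> k kn; apply: cbounded_le (Yk_bounded k uM).
  rewrite -[X in _ / d ^+ X](@subnK k N)// exprD.
  by rewrite le_eqVlt; apply/orP; left; apply/eqP; field; rewrite !gt_eqF.
- exact: hB.
- move=> k kn; rewrite YE// -/(rdata u k) (bigD1 (Ordinal kn))//= big1 ?addr0; last first.
    move=> j jk; rewrite phi_e// (_ : (k == j) = false) ?mulr0//.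
    by apply/negbTE; rewrite eq_sym.
  by rewrite phi_e// eqxx mulr1 addrC subrK.
- by move=> j jn; rewrite /E addrAC subrr add0r norm1N; exact: rE.
(* N of the N + 1 primitives gain a factor d and cancel d^-N, so this part of y is O(d). Against
   [h], of size d^-n on an interval of length d, it contributes O(d / d^N). *)
- have Jg : cbounded a b (iter N.+1 J (g u)) (L * d).
    apply: cbounded_le (cbounded_iterSJ s ab N gi).
    rewrite (le_trans (ler_wpM2r _ gl))// le_eqVlt; apply/orP; left; apply/eqP.
    by field; rewrite gt_eqF.
  have cE : ctot (fun t => h t * conjc (Yk u 0%N t)) =
      ctot (fun t => h t * conjc (iter N.+1 J (g u) t)) +
      \sum_(j < n) \sum_(l < n) E j * conjc (E l) *
        ctot (fun t => phi j n t * phi l 0%N t).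
    have i1 : cintegrable (fun t => h t * conjc (iter N.+1 J (g u) t)).
      exact: cbounded_integrable (cboundedM hB (cbounded_conj Jg)).
    have -> : (fun t => h t * conjc (Yk u 0%N t)) =
        (fun t => h t * conjc (iter N.+1 J (g u) t) + \sum_(j < n)
          \sum_(l < n) E j * conjc (E l) * (phi j n t * phi l 0%N t)).
      apply/funext => t; rewrite YE// subn0 rmorphD mulrDr; congr (_ + _).
      rewrite rmorph_sum /h big_distrlr/=; apply: eq_bigr => j _.
      apply: eq_bigr => l _; rewrite rmorphM/=.
      have -> : conjc (phi l 0%N t) = phi l 0%N t.
        by rewrite /phi /pcut /cut; case: ifP => _; rewrite ?conjc0// conjc_real.
      by ring.
    rewrite ctotD//; last first.
      apply: cintegrable_sum => j; apply: cintegrable_sum => l.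
      by apply: cintegrableZ; exact: pcutM_integrable.
    congr (_ + _); rewrite ctot_sum; last first.
      move=> j; apply: cintegrable_sum => l.
      by apply: cintegrableZ; exact: pcutM_integrable.
    apply: eq_bigr => j _; rewrite ctot_sum; last first.
      by move=> l; apply: cintegrableZ; exact: pcutM_integrable.
    by apply: eq_bigr => l _; rewrite ctotZ//; exact: pcutM_integrable.
  rewrite cE addrK; have hJ := cboundedM hB (cbounded_conj Jg).
  apply: le_trans (norm1_ctot (cbounded_integrable hJ)) _.
  apply: le_trans (l1norm_cbounded ab hJ) _.
  rewrite -/d exprS le_eqVlt; apply/orP; left; apply/eqP.
  by field; rewrite !gt_eqF.
(* These integrals are real, so conjugating Q amounts to transposing them, and only [c j l - c l j]
   remains. *)
- pose c j l := ctot (fun t => phi j n t * phi l 0%N t).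
  have cc j l : conjc (c j l) = c j l by rewrite /c ctot_pcutM// conjc_real.
  have cL j l : (j < n)%N -> (l < n)%N ->
      c j l - c l j = (-1) ^+ s * (-1) ^+ l * (j + l == N)%N%:R.
    by move=> jn ln; rewrite -(lagrange_psi ab N_odd psi_m).
  rewrite -[X in X - _ = _]/(\sum_(j < n) \sum_(l < n) E j * conjc (E l) * c j l).
  have -> : conjc (\sum_(j < n) \sum_(l < n) E j * conjc (E l) * c j l) =
      \sum_(j < n) \sum_(l < n) E j * conjc (E l) * c l j.
    rewrite rmorph_sum exchange_big/=; apply: eq_bigr => j _.
    rewrite rmorph_sum/=; apply: eq_bigr => l _.
    have cM (x y : C) : conjc (x * y) = conjc x * conjc y by rewrite rmorphM.
    by rewrite !cM conjcK cc; ring.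
  rewrite -sumrB (eq_bigr (fun j : 'I_n => \sum_(l < n)
    E j * conjc (E l) * (c j l - c l j))); last first.
    by move=> j _; rewrite -sumrB; apply: eq_bigr => l _; rewrite mulrBr.
  rewrite exchange_big/= mulr_sumr; apply: eq_bigr => l _.
  have Nl : (N - l < n)%N by rewrite ltnS leq_subr.
  rewrite (bigD1 (Ordinal Nl))//= big1 ?addr0.
  + rewrite cL// subnK ?eqxx; last by rewrite -ltnS.
    by rewrite mulr1; ring.
  + move=> j jl; rewrite cL//.
    case: eqP => [jlN|_]; last by rewrite !mulr0.
    by case/eqP: jl; apply/val_inj; rewrite /= -jlN addnK.
Qed.

End Layer.

(** * Membership in the domain of L *)

Section RegularityOfPrimitives.
Variable R : realType.
Local Notation C := R[i].
Local Notation mu := (@lebesgue_measure R).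

(** The cut loses nothing on [0, 1]: [a, b] reaches the endpoint opposite to the inner end, and
    beyond the inner end the shifted primitive already vanishes. *)
Lemma rJ_rprim (a b : R) (s : bool) (g : R -> R) (x : R) : a <= b ->
  (forall t, ~~ (a <= t <= b) -> g t = 0) -> 0 <= x <= 1 ->
  (if s then a = 0 else b = 1) ->
  rJ a b s g x = - (if s then rtot g else 0) + rprim g x.
Proof.
move=> ab g0 /andP[x0 x1] hs; rewrite /rJ /cut; case: ifP => [_|/negbT].
  by rewrite addrC.
rewrite negb_and -!ltNge => /orP[xa|bx].
  case: s hs => [a0|b1]; first by move: x0; rewrite leNgt -a0 xa.
  rewrite oppr0 add0r /rprim (_ : \int[mu]_(t in _) _ = \int[mu]_(t in `]-oo, x]) 0).
    by rewrite /Rintegral integral0.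
  apply: eq_Rintegral => t; rewrite inE/= in_itv/= => tx.
  by apply: g0; rewrite negb_and -!ltNge (le_lt_trans tx xa).
case: s hs => [a0|b1]; last by move: x1; rewrite leNgt -b1 bx.
rewrite /rprim Rintegral_mkcond /rtot.
rewrite (_ : g \_ _ = g) ?addNr//; apply/funext => t.
rewrite /patch mem_setE in_itv/=; case: ifP => // /negbT; rewrite -ltNge => xt.
by rewrite g0// negb_and -!ltNge (lt_trans bx xt) orbT.
Qed.

Definition cprim (f : R -> C) (x : R) : C :=
  rprim (fun t => complex.Re (f t)) x +i* rprim (fun t => complex.Im (f t)) x.

Lemma cprimD (f g : R -> C) x : cintegrable f -> cintegrable g ->
  cprim (fun t => f t + g t) x = cprim f x + cprim g x.
Proof.
move=> [f1 f2] [g1 g2]; rewrite /cprim.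
rewrite (_ : (fun t => complex.Re _) = (fun t => complex.Re (f t) + complex.Re (g t)));
  last by apply/funext => t; exact: cReD.
rewrite (_ : (fun t => complex.Im (f t + g t)) = (fun t => complex.Im (f t) + complex.Im (g t)));
  last by apply/funext => t; exact: cImD.
by rewrite !rprimD.
Qed.

Lemma cJ_cprim (a b : R) (s : bool) (f : R -> C) : a <= b ->
  (forall t, ~~ (a <= t <= b) -> f t = 0) -> (if s then a = 0 else b = 1) ->
  exists c : C, forall x, 0 <= x <= 1 -> cJ a b s f x = c + cprim f x.
Proof.
move=> ab f0 hs.
exists ((- (if s then rtot (fun t => complex.Re (f t)) else 0)) +i*
        (- (if s then rtot (fun t => complex.Im (f t)) else 0))) => x x01.
by rewrite /cJ !rJ_rprim// => t /f0 ->.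
Qed.

Lemma abs_continuous_cprim (F f : R -> C) (c : C) : cintegrable f ->
  (forall x, 0 <= x <= 1 -> F x = c + cprim f x) -> abs_continuous01 F.
Proof.
move=> [f1 f2] FE e e0.
have e20 : 0 < e / 2 by rewrite divr_gt0.
have [d1 d10 h1] := rprim_abs_continuous f1 e20.
have [d2 d20 h2] := rprim_abs_continuous f2 e20.
exists (Num.min d1 d2); first by rewrite lt_min d10.
move=> m a b ab abI; rewrite lt_min => /andP[s1 s2].
have ab' i : a i <= b i by case: (ab i).
rewrite [ltRHS]splitr; apply: le_lt_trans (ltrD (h1 m a b ab' abI s1) (h2 m a b ab' abI s2)).
rewrite -big_split/=; apply: ler_sum => i _.
apply: le_trans (normc_le_norm1 _) _.
have [a0 ai b1] := ab i.
have a01 : 0 <= a i <= 1 by rewrite a0 (le_trans ai b1).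
have b01 : 0 <= b i <= 1 by rewrite b1 (le_trans a0 ai).
rewrite !FE//.
rewrite (_ : _ - _ = cprim f (b i) - cprim f (a i)); last by ring.
by rewrite /norm1 cReB cImB.
Qed.

Lemma cprim_local_continuous (F f : R -> C) (c : C) : cintegrable f ->
  (forall x, 0 <= x <= 1 -> F x = c + cprim f x) ->
  forall x, 0 <= x <= 1 -> forall e : R, 0 < e -> exists2 d : R, 0 < d &
    forall t, 0 <= t <= 1 -> `|x - t| < d -> norm1 (F t - F x) <= e.
Proof.
move=> [f1 f2] FE x x01 e e0.
have e20 : 0 < e / 2 by rewrite divr_gt0.
have /cvgrPdist_le/(_ _ e20)/nbhs_ballP[d1 /= d10 h1] := @rprim_continuous R _ f1 x.
have /cvgrPdist_le/(_ _ e20)/nbhs_ballP[d2 /= d20 h2] := @rprim_continuous R _ f2 x.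
exists (Num.min d1 d2); first by rewrite lt_min d10.
move=> t t01; rewrite lt_min => /andP[xt1 xt2].
rewrite !FE// (_ : _ - _ = cprim f t - cprim f x); last by ring.
rewrite /norm1 cReB cImB/= [leRHS]splitr distrC [X in _ + X]distrC.
by apply: lerD; [exact: h1|exact: h2].
Qed.

Lemma deriv01_cprim (F f : R -> C) (c : C) (x : R) : cintegrable f ->
  (forall x, 0 <= x <= 1 -> F x = c + cprim f x) -> 0 <= x <= 1 ->
  (forall e : R, 0 < e -> exists2 d : R, 0 < d &
    forall t, 0 <= t <= 1 -> `|x - t| < d -> norm1 (f t - f x) <= e) ->
  derivable01 F x /\ deriv01 F x = f x.
Proof.
move=> [f1 f2] FE x01 fc.
have [d1 e1] : rderivable01 (fun t => complex.Re (F t)) x /\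
    rderiv01 (fun t => complex.Re (F t)) x = complex.Re (f x).
  apply: (rderiv01_prim f1 (c := complex.Re c)) => //.
    by move=> t t01; rewrite FE// cReD.
  move=> e e0; have [d d0 hd] := fc e e0; exists d => // t t01 xt.
  by rewrite -cReB; exact: le_trans (Re_le_norm1 _) (hd t t01 xt).
have [d2 e2] : rderivable01 (fun t => complex.Im (F t)) x /\
    rderiv01 (fun t => complex.Im (F t)) x = complex.Im (f x).
  apply: (rderiv01_prim f2 (c := complex.Im c)) => //.
    by move=> t t01; rewrite FE// cImD.
  move=> e e0; have [d d0 hd] := fc e e0; exists d => // t t01 xt.
  by rewrite -cImB; exact: le_trans (Im_le_norm1 _) (hd t t01 xt).
by split; [split|rewrite /deriv01 e1 e2 -complex_eta].
Qed.

Lemma deriv01_congr (F f : R -> C) (x : R) : 0 <= x <= 1 ->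
  (forall t, 0 <= t <= 1 -> F t = f t) ->
  (derivable01 F x <-> derivable01 f x) /\ deriv01 F x = deriv01 f x.
Proof.
move=> x01 Ff.
have [d1 e1] := @rderiv01_congr R (fun t => complex.Re (F t))
  (fun t => complex.Re (f t)) x x01 (fun t t01 => congr1 _ (Ff t t01)).
have [d2 e2] := @rderiv01_congr R (fun t => complex.Im (F t))
  (fun t => complex.Im (f t)) x x01 (fun t t01 => congr1 _ (Ff t t01)).
by rewrite /derivable01 /deriv01 d1 d2 e1 e2.
Qed.

Lemma ae_deriv01_cprim (F f : R -> C) (c : C) : cintegrable f ->
  (forall x, 0 <= x <= 1 -> F x = c + cprim f x) ->
  {ae mu, forall x, `]0, 1[%classic x -> deriv01 F x = f x}.
Proof.
move=> [f1 f2] FE.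
have hr t : 0 <= t <= 1 ->
    complex.Re (F t) = complex.Re c + rprim (fun t => complex.Re (f t)) t.
  by move=> t01; rewrite FE// cReD.
have hi t : 0 <= t <= 1 ->
    complex.Im (F t) = complex.Im c + rprim (fun t => complex.Im (f t)) t.
  by move=> t01; rewrite FE// cImD.
have h1 := ae_rderiv01_prim f1 hr; have h2 := ae_rderiv01_prim f2 hi.
have fl := ae_filter_ringOfSetsType mu.
move: h1 h2; apply: filterS2 => x h1 h2 x01.
by rewrite /deriv01 h1// h2// -complex_eta.
Qed.

Lemma measurable_deriv01_cprim (F f : R -> C) (c : C) : cintegrable f ->
  (forall x, 0 <= x <= 1 -> F x = c + cprim f x) ->
  measurable_fun (`]0, 1[%classic : set R) (fun x => complex.Re (deriv01 F x)) /\
  measurable_fun (`]0, 1[%classic : set R) (fun x => complex.Im (deriv01 F x)).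
Proof.
move=> [f1 f2] FE; split.
  apply: (measurable_rderiv01 (F := fun x => complex.Re c +
    rprim (fun t => complex.Re (f t)) x)).
    by move=> x; apply: cvgD; [exact: cvg_cst|exact: rprim_continuous].
  by move=> t t01; rewrite FE// cReD.
apply: (measurable_rderiv01 (F := fun x => complex.Im c +
  rprim (fun t => complex.Im (f t)) x)).
  by move=> x; apply: cvgD; [exact: cvg_cst|exact: rprim_continuous].
by move=> t t01; rewrite FE// cImD.
Qed.

Variables (N : nat) (Y : nat -> R -> C) (G : R -> C) (c : nat -> C).
Hypothesis Y_int : forall k, (k <= N)%N -> cintegrable (Y k).
Hypothesis G_int : cintegrable G.
Hypothesis YE : forall k, (k < N)%N -> forall x, 0 <= x <= 1 ->
  Y k x = c k + cprim (Y k.+1) x.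
Hypothesis YNE : forall x, 0 <= x <= 1 -> Y N x = c N + cprim G x.

Let Y_prim k : (k <= N)%N -> exists2 f, cintegrable f &
  forall x, 0 <= x <= 1 -> Y k x = c k + cprim f x.
Proof.
rewrite leq_eqVlt => /predU1P[->|kN]; first by exists G.
by exists (Y k.+1); [exact: Y_int|exact: YE].
Qed.

(** [Y k.+1] is itself a primitive, hence continuous, so the fundamental theorem applies at every
    point of [0, 1], endpoints included. Only the last step, with density [G], is restricted to
    almost every point. *)
Lemma chain_derivn01 k : (k <= N)%N -> forall x, 0 <= x <= 1 ->
  derivn01 k (Y 0%N) x = Y k x.
Proof.
elim: k => [//|k IH] kN x x01; rewrite /derivn01 iterS -/(derivn01 k _).
have [_ ->] := deriv01_congr x01 (IH (ltnW kN)).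
apply: (deriv01_cprim (c := c k) (Y_int kN) _ x01 _).2; first exact: YE.
have [f fi fE] := Y_prim kN.
exact: cprim_local_continuous fi fE x x01.
Qed.

Lemma chain_derivable01 k : (k < N)%N -> forall x, 0 <= x <= 1 ->
  derivable01 (derivn01 k (Y 0%N)) x.
Proof.
move=> kN x x01.
apply: (deriv01_congr x01 (chain_derivn01 (ltnW kN))).1.2.
apply: (deriv01_cprim (c := c k) (Y_int kN) _ x01 _).1; first exact: YE.
have [f fi fE] := Y_prim kN.
exact: cprim_local_continuous fi fE x x01.
Qed.

Lemma chain_abs_continuous k : (k <= N)%N ->
  abs_continuous01 (derivn01 k (Y 0%N)).
Proof.
move=> kN; have [f fi fE] := Y_prim kN.
by apply: abs_continuous_cprim fi _ => x x01; rewrite chain_derivn01// fE.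
Qed.

Lemma chain_ae : {ae mu, forall x, `]0, 1[%classic x ->
  derivn01 N.+1 (Y 0%N) x = G x}.
Proof.
have := ae_deriv01_cprim (c := c N) (F := derivn01 N (Y 0%N)) G_int _; apply.
by move=> x x01; rewrite chain_derivn01// YNE.
Qed.

Lemma chain_measurable :
  measurable_fun (`]0, 1[%classic : set R)
    (fun x => complex.Re (derivn01 N.+1 (Y 0%N) x)) /\
  measurable_fun (`]0, 1[%classic : set R)
    (fun x => complex.Im (derivn01 N.+1 (Y 0%N) x)).
Proof.
apply: (measurable_deriv01_cprim (c := c N) (F := derivn01 N (Y 0%N)) G_int).
by move=> x x01; rewrite chain_derivn01// YNE.
Qed.

End RegularityOfPrimitives.

(** * Perturbation of the boundary data *)

Section BoundaryPerturbation.
Variable R : realType.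
Local Notation C := R[i].

(* The conditions are triangular: the one of order j is solved by correcting the
   data of order j, the lower-order data contributing a relative error O(d). *)
Lemma bc_solve (n : nat) (U : normalized_bc R n) (zeta0 zeta1 : nat -> C) :
  (forall j : 'I_n, zeta0 j *: bc_b0 U j + zeta1 j *: bc_b1 U j = 0) ->
  exists2 K : R, 0 <= K & forall d : R, 0 < d <= 1 -> exists w0 w1 : nat -> C,
    (forall j, bc_form U j (fun k => w0 k) (fun k => w1 k) = 0) /\
    (forall j, norm1 (w0 j - (d ^+ j)^-1%:C * zeta0 j) <= K * (d / d ^+ j) /\
      norm1 (w1 j - (d ^+ j)^-1%:C * zeta1 j) <= K * (d / d ^+ j)).
Proof.
move=> zE.
(* Induction on the number m of orders already solved. It starts from the exactly scaled data; [K]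
   grows at each order but stays independent of [d]. *)
suff H m : exists2 K : R, 0 <= K & forall d : R, 0 < d <= 1 -> exists w0 w1 : nat -> C,
    (forall j : 'I_n, (j < m)%N -> bc_form U j (fun k => w0 k) (fun k => w1 k) = 0) /\
    (forall j, norm1 (w0 j - (d ^+ j)^-1%:C * zeta0 j) <= K * (d / d ^+ j) /\
      norm1 (w1 j - (d ^+ j)^-1%:C * zeta1 j) <= K * (d / d ^+ j)).
  have [K K0 HK] := H n; exists K => // d d01.
  have [w0 [w1 [h1 h2]]] := HK d d01; exists w0, w1; split=> // j.
  exact: h1.
elim: m => [|m [K K0 IH]].
  exists 0 => // d _; exists (fun j => (d ^+ j)^-1%:C * zeta0 j).
  exists (fun j => (d ^+ j)^-1%:C * zeta1 j); split=> // j.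
  by rewrite !subrr norm1_0 mul0r.
have [nm|mn] := leqP n m.
  exists K => // d d01; have [w0 [w1 [h1 h2]]] := IH d d01.
  exists w0, w1; split=> // j jm; apply: h1.
  exact: leq_trans (ltn_ord j) nm.
pose j0 := Ordinal mn.
(* Full row rank gives a right inverse, through which the lower-order part of the condition is
   cancelled by changing the data of order m only. The two coordinates of the correction belong to
   the endpoints 0 and 1. *)
have /row_freeP[B BE] : row_free (row_mx (bc_b0 U j0) (bc_b1 U j0)).
  by apply/eqP; exact: bc_rank.
pose al (i : 'I_(1 + 1)) k := (B *m bc_a0 U j0 k) i 0.
pose be (i : 'I_(1 + 1)) k := (B *m bc_a1 U j0 k) i 0.
pose A := \sum_(i < 1 + 1) \sum_(k < n) (norm1 (al i k) + norm1 (be i k)).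
pose D := \sum_(k < n) (norm1 (zeta0 k) + norm1 (zeta1 k)) + K.
have A0 : 0 <= A.
  by apply: sumr_ge0 => i _; apply: sumr_ge0 => k _; rewrite addr_ge0 ?norm1_ge0.
have D0 : 0 <= D.
  by rewrite addr_ge0//; apply: sumr_ge0 => k _; rewrite addr_ge0 ?norm1_ge0.
exists (K + A * D); first by rewrite addr_ge0 ?mulr_ge0.
move=> d /[dup] d01 /andP[d0 d1].
have [w0 [w1 [h1 h2]]] := IH d d01.
have dX k : 0 < d ^+ k by exact: exprn_gt0.
pose x (i : 'I_(1 + 1)) : C :=
  - \sum_(k < n | (k < j0)%N) (w0 k * al i k + w1 k * be i k).
have xB i : norm1 (x i) <= A * D * (d / d ^+ m).
  rewrite /x norm1N; apply: le_trans (norm1_sum _ _ _) _.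
  apply: le_trans (_ : \sum_(k < n | (k < j0)%N) (norm1 (al i k) + norm1 (be i k)) *
      (D * (d / d ^+ m)) <= _); last first.
    rewrite -mulr_suml -[leRHS]mulrA ler_wpM2r//; first by rewrite mulr_ge0// divr_ge0 ?ltW.
    rewrite /A (bigD1 i)//= -[leLHS]addr0 lerD//; last first.
      by apply: sumr_ge0 => i' _; apply: sumr_ge0 => k _; rewrite addr_ge0 ?norm1_ge0.
    rewrite [leRHS](bigID (fun k : 'I_n => (k < m)%N))/= lerDl.
    by apply: sumr_ge0 => k _; rewrite addr_ge0 ?norm1_ge0.
  apply: ler_sum => k km.
  (* As k < m and d <= 1, data of order k are smaller than those of order m by at least a factor
     d. *)
  have dk : (d ^+ k)^-1 <= d / d ^+ m.
    rewrite -[X in _ / d ^+ X](subnK (ltnW km)) -[(m - k)%N]prednK ?subn_gt0//.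
    rewrite exprD exprS -[leLHS]mul1r; set X := d ^+ _ .-1; set Y := d ^+ k.
    have X0 : 0 < X by exact: exprn_gt0.
    have Y0 : 0 < Y by exact: exprn_gt0.
    have -> : d / (d * X * Y) = X^-1 * Y^-1 by field; rewrite !gt_eqF.
    apply: ler_wpM2r; first by rewrite invr_ge0 ltW.
    by rewrite invf_ge1//; apply: exprn_ile1 => //; exact: ltW.
  have wB (w zeta : nat -> C) :
      norm1 (w k - (d ^+ k)^-1%:C * zeta k) <= K * (d / d ^+ k) ->
      norm1 (zeta k) + K <= D -> norm1 (w k) <= D * (d / d ^+ m).
    move=> h hD; rewrite -(subrK ((d ^+ k)^-1%:C * zeta k) (w k)).
    apply: le_trans (norm1D _ _) _; rewrite norm1_realM gtr0_norm ?invr_gt0//.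
    apply: le_trans (_ : (norm1 (zeta k) + K) / d ^+ k <= _); last first.
      by rewrite ler_pM// ?addr_ge0 ?norm1_ge0// invr_ge0 ltW.
    rewrite mulrDl addrC [X in X + _]mulrC lerD2l (le_trans h)//.
    by rewrite ler_wpM2l// ler_piMl// invr_ge0 ltW.
  have zD : norm1 (zeta0 k) + norm1 (zeta1 k) <= \sum_(k < n) (norm1 (zeta0 k) + norm1 (zeta1 k)).
    rewrite (bigD1 k)//= lerDl.
    by apply: sumr_ge0 => i' _; rewrite addr_ge0 ?norm1_ge0.
  have n0 := norm1_ge0 (zeta0 k); have n1 := norm1_ge0 (zeta1 k).
  have w0B : norm1 (w0 k) <= D * (d / d ^+ m).
    by apply: (wB w0 zeta0); [case: (h2 k)|rewrite /D lerD2r; lra].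
  have w1B : norm1 (w1 k) <= D * (d / d ^+ m).
    by apply: (wB w1 zeta1); [case: (h2 k)|rewrite /D lerD2r; lra].
  apply: le_trans (norm1D _ _) _; rewrite mulrDl.
  apply: lerD; apply: le_trans (norm1M _ _) _; rewrite mulrC ler_wpM2l// norm1_ge0//.
pose v0 k := if k == m then (d ^+ m)^-1%:C * zeta0 m + x (lshift 1 0) else w0 k.
pose v1 k := if k == m then (d ^+ m)^-1%:C * zeta1 m + x (rshift 1 0) else w1 k.
have KAD : K <= K + A * D by rewrite lerDl mulr_ge0.
have ADK : A * D <= K + A * D by rewrite lerDr.
have dd k : 0 <= d / d ^+ k by rewrite divr_ge0 ?ltW.
exists v0, v1; split; last first.
  move=> j; rewrite /v0 /v1; case: eqP => [->|_].
    by split; rewrite addrAC subrr add0r; apply: le_trans (xB _) _; rewrite ler_wpM2r.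
  by have [h3 h4] := h2 j; split; [apply: le_trans h3 _|apply: le_trans h4 _];
    rewrite ler_wpM2r.
move=> j; rewrite ltnS leq_eqVlt => /orP[jm|jm]; last first.
  rewrite -(h1 j jm) /bc_form /v0 /v1 (ltn_eqF jm); congr (_ + _).
  apply: eq_bigr => k kj; rewrite (_ : (k == m :> nat) = false)//.
  by rewrite ltn_eqF// (ltn_trans kj jm).
have -> : j = j0 by apply/val_inj/eqP.
rewrite /bc_form /v0 /v1 /= eqxx !scalerDl addrACA -!scalerA -scalerDr zE.
rewrite scaler0 add0r.
under eq_bigr => k km do rewrite (ltn_eqF km).
set rho := \sum_(k < n | _) _.
have -> : x (lshift 1 0) *: bc_b0 U j0 + x (rshift 1 0) *: bc_b1 U j0 =
    row_mx (bc_b0 U j0) (bc_b1 U j0) *m (\col_i x i).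
  rewrite -[\col_i x i]vsubmxK mul_row_col.
  congr (_ + _); apply/colP => i; rewrite !mxE big_ord1 !mxE mulrC; congr (_ * x _);
  by apply/val_inj.
have -> : \col_i x i = - (B *m rho).
  apply/colP => i; rewrite [LHS]mxE [RHS]mxE /x; congr (- _).
  rewrite /rho mulmx_sumr summxE; apply: eq_bigr => k _.
  by rewrite mulmxDr -!scalemxAr [RHS]mxE [X in _ = X + _]mxE [X in _ = _ + X]mxE.
by rewrite mulmxN mulmxA BE mul1mx addNr.
Qed.

(** In each product the orders add up to n - 1, so d^-(n-1) factors out and every error term keeps
    an extra factor d. *)
Lemma bform_perturbation (n : nat) (zeta : nat -> C) (K : R) : 0 <= K ->
  exists2 K2 : R, 0 <= K2 & forall (d : R) (v : nat -> C), 0 < d <= 1 ->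
    (forall j, (j < n)%N -> norm1 (v j - (d ^+ j)^-1%:C * zeta j) <= K * (d / d ^+ j)) ->
    norm1 (bform n v - (d ^+ n.-1)^-1%:C * bform n zeta) <= K2 * (d / d ^+ n.-1).
Proof.
move=> K0; pose S := \sum_(j < n) norm1 (zeta j).
have S0 : 0 <= S by apply: sumr_ge0 => j _; exact: norm1_ge0.
have zS j : (j < n)%N -> norm1 (zeta j) <= S.
  move=> jn; rewrite /S (bigD1 (Ordinal jn))//= lerDl.
  by apply: sumr_ge0 => i _; exact: norm1_ge0.
exists (n%:R * (2 * S * K + K * K)).
  by rewrite mulr_ge0// addr_ge0// ?mulr_ge0.
move=> d v /andP[d0 d1] vz.
have dX k : 0 < d ^+ k by exact: exprn_gt0.
rewrite /bform mulr_sumr -sumrB; apply: le_trans (norm1_sum _ _ _) _.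
apply: le_trans (_ : \sum_(m < n) (2 * S * K + K * K) * (d / d ^+ n.-1) <= _); last first.
  by rewrite sumr_const card_ord -[leLHS]mulr_natl mulrA.
apply: ler_sum => m _.
have mn : (m <= n.-1)%N by rewrite -ltnS prednK// (leq_ltn_trans _ (ltn_ord m)).
set a := (n.-1 - m)%N.
have an : (a < n)%N by rewrite (leq_ltn_trans (leq_subr _ _))// -ltnS prednK// (leq_ltn_trans _ (ltn_ord m)).
have dE : d ^+ n.-1 = d ^+ a * d ^+ m by rewrite -exprD subnK.
set va := v a - (d ^+ a)^-1%:C * zeta a.
set vm := v m - (d ^+ m)^-1%:C * zeta m.
have ha : norm1 va <= K * (d / d ^+ a) by exact: vz.
have hm : norm1 vm <= K * (d / d ^+ m) by exact: vz.
have -> : v a * conjc (v m) - (d ^+ n.-1)^-1%:C * (zeta a * conjc (zeta m)) =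
   va * conjc vm + va * ((d ^+ m)^-1%:C * conjc (zeta m)) +
   (d ^+ a)^-1%:C * zeta a * conjc vm.
  have -> : conjc vm = conjc (v m) - (d ^+ m)^-1%:C * conjc (zeta m).
    rewrite /vm (rmorphB (@conjc R)) (rmorphM (@conjc R)).
    by congr (_ - _ * _); exact: conjc_real.
  by rewrite dE invfM (rmorphM (@real_complex R)) /va; ring.
have na := zS a an; have nm := zS m (ltn_ord m).
have h1 : norm1 (va * conjc vm) <= K * K * (d / d ^+ n.-1).
  apply: le_trans (norm1M _ _) _; rewrite norm1_conj.
  apply: le_trans (ler_pM (norm1_ge0 _) (norm1_ge0 _) ha hm) _.
  have -> : K * (d / d ^+ a) * (K * (d / d ^+ m)) = K * K * (d * (d / d ^+ n.-1)).
    by rewrite dE; field; rewrite !gt_eqF.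
  by rewrite ler_wpM2l ?mulr_ge0// ler_piMl// divr_ge0 ?ltW.
have h2 : norm1 (va * ((d ^+ m)^-1%:C * conjc (zeta m))) <= S * K * (d / d ^+ n.-1).
  apply: le_trans (norm1M _ _) _; rewrite norm1_realM norm1_conj gtr0_norm ?invr_gt0//.
  apply: le_trans (ler_pM (norm1_ge0 _) _ ha (ler_wpM2l _ nm)) _.
  - by rewrite mulr_ge0 ?norm1_ge0// invr_ge0 ltW.
  - by rewrite invr_ge0 ltW.
  - by rewrite dE le_eqVlt; apply/orP; left; apply/eqP; field; rewrite !gt_eqF.
have h3 : norm1 ((d ^+ a)^-1%:C * zeta a * conjc vm) <= S * K * (d / d ^+ n.-1).
  rewrite -mulrA norm1_realM gtr0_norm ?invr_gt0//.
  apply: le_trans (ler_wpM2l _ (norm1M _ _)) _; first by rewrite invr_ge0 ltW.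
  rewrite norm1_conj.
  apply: le_trans (ler_wpM2l _ (ler_pM (norm1_ge0 _) (norm1_ge0 _) na hm)) _.
    by rewrite invr_ge0 ltW.
  by rewrite dE le_eqVlt; apply/orP; left; apply/eqP; field; rewrite !gt_eqF.
apply: le_trans (norm1D _ _) _; apply: le_trans (lerD (norm1D _ _) h3) _.
by move: h1 h2; move: (d / _) => X h1 h2; lra.
Qed.

(** (-i)^(N+1) is real because N + 1 is even, so the imaginary part is read off from Q - conj Q. The
    signs (-1)^l are absorbed by conj((-i)^l) = (-1)^l (-i)^l, which turns the sum into [bform]. *)
Lemma Im_lagrange (N : nat) (s : bool) (E : nat -> C) (Q : C) :
  Q - conjc Q = (-1) ^+ s * \sum_(l < N.+1) (-1) ^+ l * (E (N - l)%N * conjc (E l)) ->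
  odd N ->
  complex.Im ((0 -i* 1) ^+ N.+1 * Q) =
  - (-1) ^+ s / 2 * complex.Re (bform N.+1 (fun j => (0 -i* 1) ^+ j * E j)).
Proof.
move=> QE No.
set mi : C := 0 -i* 1.
have mi2 : mi ^+ 2 = -1 by rewrite expr2 /mi; simpc.
have mireal k : ~~ odd k -> exists e : R, mi ^+ k = e%:C.
  move=> ek; exists ((-1) ^+ k./2).
  rewrite -[in LHS](odd_double_half k) (negPf ek) add0n -mul2n exprM mi2.
  by rewrite rmorphXn rmorphN rmorph1.
have [e eE] := mireal N.+1 ltac:(by rewrite /= No).
have bE : bform N.+1 (fun j => mi ^+ j * E j) =
    mi ^+ N * \sum_(l < N.+1) (-1) ^+ l * (E (N - l)%N * conjc (E l)).
  rewrite /bform mulr_sumr; apply: eq_bigr => l _ /=.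
  have cmi : conjc mi = - mi by apply/eqP; rewrite eq_complex /= ?oppr0 ?opprK !eqxx.
  have -> : conjc (mi ^+ l * E l) = (- mi) ^+ l * conjc (E l).
    rewrite (rmorphM (@conjc R)) (rmorphXn (@conjc R)).
    by congr (_ ^+ _ * _); exact: cmi.
  rewrite -[X in _ = mi ^+ X * _](subnK (_ : (l <= N)%N)); last by rewrite -ltnS.
  rewrite exprD (exprNn mi); move: (mi ^+ (N - l)) (mi ^+ l) ((-1) ^+ l) => A B D.
  by move: (E (N - l)%N) (conjc (E l)) => x y; ring.
have key : mi ^+ N.+1 * Q - conjc (mi ^+ N.+1 * Q) =
    (-1) ^+ s * (mi * bform N.+1 (fun j => mi ^+ j * E j)).
  have -> : conjc (mi ^+ N.+1 * Q) = mi ^+ N.+1 * conjc Q.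
    by rewrite (rmorphM (@conjc R)) eE; congr (_ * _); exact: conjc_real.
  by rewrite bE -mulrBr QE exprS; ring.
move: key; set X := mi ^+ N.+1 * Q; set Y := bform _ _.
have -> : (-1) ^+ s = ((-1) ^+ s : R)%:C by rewrite rmorphXn rmorphN rmorph1.
case: X Y => [x1 x2] [y1 y2] /eqP; rewrite /mi eq_complex /= => /andP[_ /eqP].
by move=> h; move: h; set g := (-1) ^+ s; lra.
Qed.

End BoundaryPerturbation.

(** * Integrals of functions known almost everywhere on ]0, 1[ *)

Section AlmostEverywhere01.
Variable R : realType.
Local Notation mu := (@lebesgue_measure R).
Local Notation I01 := (`]0%R, 1%R[%classic : set R).
Local Notation C := R[i].

Lemma integrable01_ae (f g : R -> R) : measurable_fun I01 f -> rintegrable g ->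
  {ae mu, forall x, I01 x -> f x = g x} ->
  mu.-integrable I01 (EFin \o f) /\
  \int[mu]_(x in I01) f x = \int[mu]_(x in I01) g x.
Proof.
move=> mf ig fg.
have fl := ae_filter_ringOfSetsType mu.
have igI : mu.-integrable I01 (EFin \o g) by exact: rintegrableS ig.
have mg : measurable_fun I01 (EFin \o g) by exact: (measurable_int mu igI).
have mf' : measurable_fun I01 (EFin \o f) by exact/measurable_EFinP.
have mI : measurable (I01 : set (measurableTypeR R)) by exact: measurable_itv.
split; last first.
  congr fine; apply: (@ae_eq_integral _ _ R mu I01 (EFin \o g) (EFin \o f) mI mf' mg).
  by move: fg; apply: filterS => x fg xI /=; rewrite fg.
apply/integrableP; split => //.
move/integrableP : igI => [_]; congr (_ < _)%E.
apply: ge0_ae_eq_integral => //.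
- exact: measurableT_comp.
- exact: measurableT_comp.
- by move: fg; apply: filterS => x fg xI /=; rewrite fg.
Qed.

Lemma Rintegral01_rtot (g : R -> R) : rintegrable g ->
  (forall t, ~~ (0 <= t <= 1) -> g t = 0) ->
  \int[mu]_(x in I01) g x = rtot g.
Proof.
move=> ig g0.
rewrite Rintegral_itv_bndo_bndc; last exact: rintegrableS ig.
rewrite Rintegral_itv_obnd_cbnd; last exact: rintegrableS ig.
rewrite Rintegral_mkcond /rtot; congr (Rintegral _ _ _); apply/funext => t.
by rewrite /patch mem_setE in_itv/=; case: ifP => // /negbT /g0.
Qed.

Lemma cintegral_ae (F h : R -> C) (B : R) :
  measurable_fun I01 (fun x => complex.Re (F x)) ->
  measurable_fun I01 (fun x => complex.Im (F x)) ->
  cbounded 0 1 h B ->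
  {ae mu, forall x, I01 x -> F x = h x} ->
  cintegral F = ctot h.
Proof.
move=> m1 m2 hB Fh; have [h1 h2] := cbounded_integrable hB.
have [_ _ h0] := hB; have fl := ae_filter_ringOfSetsType mu.
rewrite /cintegral /ctot; congr (_ +i* _).
  rewrite (integrable01_ae m1 h1 _).2; last by move: Fh; apply: filterS => x Fh /Fh ->.
  by apply: Rintegral01_rtot => // t /h0 ->.
rewrite (integrable01_ae m2 h2 _).2; last by move: Fh; apply: filterS => x Fh /Fh ->.
by apply: Rintegral01_rtot => // t /h0 ->.
Qed.

Lemma inL2_ae (F h : R -> C) (B : R) :
  measurable_fun I01 (fun x => complex.Re (F x)) ->
  measurable_fun I01 (fun x => complex.Im (F x)) ->
  cbounded 0 1 h B ->
  {ae mu, forall x, I01 x -> F x = h x} ->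
  inL2 F.
Proof.
move=> m1 m2 hB Fh; split => //.
have sqE (z : C) : Normc.normc z ^+ 2 = complex.Re z ^+ 2 + complex.Im z ^+ 2.
  by case: z => a b; rewrite /= sqr_sqrtr// addr_ge0 ?sqr_ge0.
have [[n1 n2] hb h0] := hB.
have fl := ae_filter_ringOfSetsType mu.
apply: (integrable01_ae (f := fun x => Normc.normc (F x) ^+ 2) (g := fun x => complex.Re (h x) ^+ 2 + complex.Im (h x) ^+ 2) _ _ _).1.
- rewrite (_ : (fun x => _) = (fun x => complex.Re (F x) ^+ 2 + complex.Im (F x) ^+ 2));
    last by apply/funext => x; exact: sqE.
  by apply: measurable_funD; exact: measurable_funX.
- apply: (rintegrable_cut (a := 0) (b := 1) (B := B ^+ 2)).
  + by apply: measurable_funD; exact: measurable_funX.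
  + move=> t; rewrite ger0_norm ?addr_ge0 ?sqr_ge0//.
    have := hb t; rewrite -(ler_pXn2r (n := 2))// ?nnegrE ?norm1_ge0//; last first.
      exact: le_trans (norm1_ge0 _) (hb 0).
    apply: le_trans; rewrite /norm1 sqrrD !real_normK ?num_real// lerD2r lerDl.
    by rewrite mulrn_wge0// mulr_ge0.
  + by move=> t /h0 ->; rewrite /= expr0n addr0.
- by move: Fh; apply: filterS => x Fh /Fh ->; rewrite sqE.
Qed.

End AlmostEverywhere01.

(** * Passage to the limit *)

Section LayerExists.
Variable R : realType.
Local Notation C := R[i].

(** [K] and [d0] are chosen before the interval and the data: this uniformity is what allows d to
    tend to 0. *)
Lemma layer_exists (N : nat) (q : nat -> R -> C) (Z : R) :
  odd N -> (forall k, cintegrable (q k)) -> 0 <= Z ->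
  exists2 K : R, 0 <= K & exists2 d0 : R, 0 < d0 <= 3^-1 &
  forall (d a b : R) (s : bool) (z : nat -> C), b - a = d -> 0 < d <= d0 ->
  (forall j, (j < N.+1)%N -> norm1 (z j) <= Z / d ^+ j) ->
  exists Y : nat -> R -> C, exists h : R -> C, exists E : nat -> C, exists Q : C,
  [/\ (forall k, (k < N)%N -> Y k = cJ a b s (Y k.+1)),
      Y N = cJ a b s (fun t => h t - \sum_(k < N) q k t * Y k t),
      (forall k, (k < N.+1)%N -> exists B, cbounded a b (Y k) B) &
      exists B, cbounded a b h B] /\
  [/\ (forall k, (k < N.+1)%N -> Y k (if s then a else b) = z k),
      (forall j, (j < N.+1)%N -> norm1 (E j - z j) <= K * (d / d ^+ j)),
      norm1 (ctot (fun t => h t * conjc (Y 0%N t)) - Q) <= K * (d / d ^+ N) &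
      Q - conjc Q =
      (-1) ^+ s * \sum_(l < N.+1) (-1) ^+ l * (E (N - l)%N * conjc (E l))].
Proof.
move=> No qi Z0.
have [C0 C00 hC] := scaled_hermite R N.+1.
set P := \sum_(k < N) l1norm (q k).
have P0 : 0 <= P by apply: sumr_ge0 => k _; exact: l1norm_ge0.
set M := N.+1%:R * (Z * C0); set L := 4 * M * P.
have M0 : 0 <= M by rewrite !mulr_ge0.
have L0 : 0 <= L by rewrite !mulr_ge0.
set K4 := N.+1%:R * (Z + L) * C0 * L.
have K40 : 0 <= K4 by rewrite !mulr_ge0// addr_ge0.
exists (L + K4); first by rewrite addr_ge0.
set X := P * (1 + N.+1%:R * C0).
have X0 : 0 <= X by rewrite mulr_ge0// addr_ge0// mulr_ge0.
have X10 : 0 < 2 * X + 1 by rewrite ltr_pwDr// mulr_ge0.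
(* The bound 1/3 keeps the layers at 0 and 1 disjoint; the other one makes the map a contraction. *)
exists (Num.min 3^-1 (2 * X + 1)^-1).
  by rewrite lt_min ge_min lexx !invr_gt0 X10 ltr0n.
move=> _ a b s z <-; set d := b - a => /andP[d0]; rewrite le_min => /andP[d3 dX] zd.
have d1 : d <= 1 by rewrite (le_trans d3)// invf_le1// ler1n.
have dsmall : 2 * d * X <= 1.
  have : d * (2 * X + 1) <= 1 by rewrite -ler_pdivlMr// div1r.
  by lra.
pose m := if s then b else a; pose e := if s then a else b.
have emd : e - m = (if s then - d else d).
  by rewrite /e /m /d; case: (s); rewrite ?opprB.
have em : `|e - m| = d.
  by rewrite emd; case: (s); rewrite ?normrN gtr0_norm.
have me : m != e.
  by rewrite eq_sym -subr_eq0 -normr_gt0 em.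
have [psi hpsi] := hC m e me.
have psi_m j k : (j < N.+1)%N -> (k < N.+1)%N ->
    ((psi j)^`(k)).[m] = 0 /\ ((psi j)^`(k)).[e] = (k == j)%:R.
  by move=> jn kn; have [h _] := hpsi j jn; exact: h.
have psi_le j k t : (j < N.+1)%N -> (k <= N.+1)%N -> a <= t <= b ->
    `|((psi j)^`(k)).[t]| <= C0 * (d ^+ j / d ^+ k).
  move=> jn kn; have [_ h] := hpsi j jn; move=> tab; rewrite -em; apply: h => //.
  rewrite emd; move: tab d0; rewrite /m /d; case: (s) => /andP[ta tb] d0.
    by rewrite invrN mulrN -mulNr opprB ler_pdivlMr// ler_pdivrMr//; lra.
  by rewrite ler_pdivlMr// ler_pdivrMr//; lra.
have [Y [h [E [Q [[h1 h2 h3 h4] [h5 h6 h7 h8]]]]]] :=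
  layer_fixpoint No qi C00 Z0 d0 d1 dsmall psi_m psi_le zd.
exists Y, h, E, Q; split; split=> //.
- by move=> k kn; exists (4 * M / d ^+ k); exact: h3.
- by eexists; exact: h4.
- move=> j jn; have := h6 j jn; move=> /le_trans; apply.
  by rewrite ler_wpM2r ?lerDl// divr_ge0 ?exprn_ge0 ?ltW.
- move: h7; move=> /le_trans; apply.
  by rewrite ler_wpM2r ?lerDr// divr_ge0 ?exprn_ge0 ?ltW.
Qed.

Lemma cbounded_sub (a b a' b' : R) (f : R -> C) (B : R) :
  a' <= a -> b <= b' -> cbounded a b f B -> cbounded a' b' f B.
Proof.
move=> aa bb [mf fB f0]; split=> // t h; apply: f0; apply: contra h.
by move=> /andP[h1 h2]; rewrite (le_trans aa h1) (le_trans h2 bb).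
Qed.

Lemma norm1_NiX k (z : C) : norm1 ((0 -i* 1) ^+ k * z) = norm1 z.
Proof.
elim: k z => [|k IH] z; first by rewrite expr0 mul1r.
rewrite exprSr -mulrA IH; case: z => a b.
by rewrite /norm1 /= !mul0r !mulN1r sub0r add0r opprK normrN addrC.
Qed.

Lemma NiX_iX k : (0 -i* 1) ^+ k * (0 +i* 1) ^+ k = 1 :> C.
Proof.
rewrite -exprMn (_ : _ * _ = 1) ?expr1n//.
by apply/eqP; rewrite eq_complex /=; apply/andP; split; apply/eqP; ring.
Qed.

End LayerExists.

(** * The test function made of two layers *)

Section TwoLayers.
Variable R : realType.
Local Notation C := R[i].
Local Notation mi := (0 -i* 1 : C).
Local Notation mu := (@lebesgue_measure R).
Local Notation I01 := (`]0%R, 1%R[%classic : set R).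

Variables (N : nat) (p : 'I_N.+1.-1 -> R -> C) (U : normalized_bc R N.+1).
Hypothesis p_L1 : forall k, inL1 (p k).

Let p01 (k : 'I_N) (t : R) : C := if 0 < t < 1 then p k t else 0.

Let p01_int k : cintegrable (p01 k).
Proof.
have [h1 h2] := p_L1 k.
have pE (f : C -> R) (t : R) : f 0 = 0 ->
    f (p01 k t) = ((fun t => f (p k t)) \_ [set` `]0, 1[]) t.
  by move=> f0; rewrite /p01 /patch mem_setE in_itv/=; case: ifP.
split.
  rewrite (_ : (fun t => _) = (fun t => complex.Re (p k t)) \_ [set` `]0, 1[]).
    exact: rintegrable_patch.
  by apply/funext => t; exact: (pE (@complex.Re R)).
rewrite (_ : (fun t => _) = (fun t => complex.Im (p k t)) \_ [set` `]0, 1[]).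
  exact: rintegrable_patch.
by apply/funext => t; exact: (pE (@complex.Im R)).
Qed.

(* The coefficients of [D^n y = (0 -i* 1) ^+ n (h - sum q k y^(k)) ], chosen so
   that l(y) = (0 -i* 1) ^+ n h. *)
Definition qcoef (k : nat) (t : R) : C :=
  if insub k is Some i then (mi ^+ N.+1)^-1 * mi ^+ k * p01 i t else 0.

Lemma qcoef_int k : cintegrable (qcoef k).
Proof.
rewrite /qcoef; case: insubP => [i _ _|_]; last exact: cintegrable0.
exact: cintegrableZ.
Qed.

Let mi_neq0 : mi != 0.
Proof. by rewrite eq_complex /= negb_and oppr_eq0 oner_eq0 orbT. Qed.

Variables (d : R) (w0 w1 : nat -> C).
Hypothesis d01 : 0 < d <= 3^-1.
Hypothesis bc_w : forall j, bc_form U j (fun k => w0 k) (fun k => w1 k) = 0.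
Variables (Y0 Y1 : nat -> R -> C) (h0 h1 : R -> C).
Hypothesis Y0E : forall k, (k < N)%N -> Y0 k = cJ 0 d true (Y0 k.+1).
Hypothesis Y1E : forall k, (k < N)%N -> Y1 k = cJ (1 - d) 1 false (Y1 k.+1).
Hypothesis Y0N : Y0 N = cJ 0 d true (fun t => h0 t - \sum_(k < N) qcoef k t * Y0 k t).
Hypothesis Y1N : Y1 N =
  cJ (1 - d) 1 false (fun t => h1 t - \sum_(k < N) qcoef k t * Y1 k t).
Hypothesis Y0b : forall k, (k < N.+1)%N -> exists B, cbounded 0 d (Y0 k) B.
Hypothesis Y1b : forall k, (k < N.+1)%N -> exists B, cbounded (1 - d) 1 (Y1 k) B.
Hypothesis h0b : exists B, cbounded 0 d h0 B.
Hypothesis h1b : exists B, cbounded (1 - d) 1 h1 B.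
Hypothesis Y0w : forall k, (k < N.+1)%N -> Y0 k 0 = (0 +i* 1) ^+ k * w0 k.
Hypothesis Y1w : forall k, (k < N.+1)%N -> Y1 k 1 = (0 +i* 1) ^+ k * w1 k.

Let d_gt0 : 0 < d. Proof. by case/andP: d01. Qed.
Let d_lt : d < 1 - d. Proof. by case/andP: d01; lra. Qed.
Let d_le1 : d <= 1. Proof. by move: d_gt0 d_lt; lra. Qed.
Let d1_ge0 : 0 <= 1 - d. Proof. by rewrite subr_ge0. Qed.

Let Y k t := Y0 k t + Y1 k t.
Let h t := h0 t + h1 t.
Let G0 t := h0 t - \sum_(k < N) qcoef k t * Y0 k t.
Let G1 t := h1 t - \sum_(k < N) qcoef k t * Y1 k t.
Let G t := G0 t + G1 t.

Let G_int (a b : R) (g : R -> C) (Z : nat -> R -> C) : (exists B, cbounded a b g B) ->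
  (forall k, (k < N.+1)%N -> exists B, cbounded a b (Z k) B) ->
  cintegrable (fun t => g t - \sum_(k < N) qcoef k t * Z k t) /\
  forall t, ~~ (a <= t <= b) -> g t - \sum_(k < N) qcoef k t * Z k t = 0.
Proof.
move=> [A gA] Zb; split; last first.
  move=> t tab; case: gA => _ _ ->//; rewrite big1 ?subr0// => k _.
  have [B [_ _ ->]] := Zb k (ltnW (ltn_ord k : (k < N)%N)); rewrite ?mulr0//.
have -> : (fun t => g t - \sum_(k < N) qcoef k t * Z k t) =
    (fun t => g t + -1 * \sum_(k < N) qcoef k t * Z k t).
  by apply/funext => t; rewrite mulN1r.
apply: cintegrableD; first exact: cbounded_integrable gA.
apply: cintegrableZ; apply: cintegrable_sum => k.
have [B [mZ ZB _]] := Zb k (ltnW (ltn_ord k : (k < N)%N)).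
by case: (l1normM_le (qcoef_int k) mZ ZB).
Qed.

Let GE t : G t = h t - \sum_(k < N) qcoef k t * Y k t.
Proof.
rewrite /G /G0 /G1 /h addrACA -opprD -big_split/=; congr (_ - _).
by apply: eq_bigr => k _; rewrite mulrDr.
Qed.

Let Y_bounded k : (k < N.+1)%N -> exists B, cbounded 0 1 (Y k) B.
Proof.
move=> kN; have [A hA] := Y0b kN; have [B hB] := Y1b kN; exists (A + B).
apply: cboundedD; first by apply: cbounded_sub hA => //; exact: d_le1.
by apply: cbounded_sub hB => //; exact: d1_ge0.
Qed.

Let h_bounded : exists B, cbounded 0 1 h B.
Proof.
have [A hA] := h0b; have [B hB] := h1b; exists (A + B).
apply: cboundedD; first by apply: cbounded_sub hA => //; exact: d_le1.
by apply: cbounded_sub hB => //; exact: d1_ge0.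
Qed.

Let Y_prim k : exists c : C, forall x, 0 <= x <= 1 ->
  ((k < N)%N -> Y k x = c + cprim (Y k.+1) x) /\
  (k = N -> Y k x = c + cprim G x).
Proof.
have ab0 : 0 <= d by exact: ltW.
have ab1 : 1 - d <= 1 by rewrite gerBl ltW.
have [kN|kN|->] := ltngtP k N; last 1 first.
- have [i0 z0] := G_int h0b Y0b; have [i1 z1] := G_int h1b Y1b.
  have [c0 e0] := @cJ_cprim R 0 d true _ ab0 z0 erefl.
  have [c1 e1] := @cJ_cprim R (1 - d) 1 false _ ab1 z1 erefl.
  exists (c0 + c1) => x x01; split=> [//|_].
  by rewrite /Y Y0N Y1N e0// e1// addrACA -(cprimD x i0 i1).
- have [A hA] := Y0b (kN : (k.+1 < N.+1)%N); have [B hB] := Y1b (kN : (k.+1 < N.+1)%N).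
  have [_ _ z0] := hA; have [_ _ z1] := hB.
  have i0 := cbounded_integrable hA; have i1 := cbounded_integrable hB.
  have [c0 e0] := @cJ_cprim R 0 d true _ ab0 z0 erefl.
  have [c1 e1] := @cJ_cprim R (1 - d) 1 false _ ab1 z1 erefl.
  exists (c0 + c1) => x x01; split=> [_|kE]; last by rewrite kE ltnn in kN.
  by rewrite /Y Y0E// Y1E// e0// e1// addrACA -(cprimD x i0 i1).
- exists 0 => x _; split=> [//|kE]; by rewrite kE ltnn in kN.
Qed.

Let y := Y 0%N.

(** The two layers have disjoint supports, so the inner product has no cross terms, and at each
    endpoint only one layer contributes to the boundary data. *)
Lemma two_layers_in_domain : in_domain p U y /\
  inner (diff_expr p y) y = mi ^+ N.+1 *
    (ctot (fun t => h0 t * conjc (Y0 0%N t)) + ctot (fun t => h1 t * conjc (Y1 0%N t))).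
Proof.
have [c cE] := choice Y_prim.
have Yi k : (k <= N)%N -> cintegrable (Y k).
  by move=> kN; have [B /cbounded_integrable] := Y_bounded (kN : (k < N.+1)%N).
have [i0 z0] := G_int h0b Y0b; have [i1 z1] := G_int h1b Y1b.
have Gi : cintegrable G by exact: cintegrableD.
have YE k : (k < N)%N -> forall x, 0 <= x <= 1 -> Y k x = c k + cprim (Y k.+1) x.
  by move=> kN x x01; exact: (cE k x x01).1.
have YNE x : 0 <= x <= 1 -> Y N x = c N + cprim G x.
  by move=> x01; exact: (cE N x x01).2.
have dE := chain_derivn01 Yi Gi YE YNE.
have [m1 m2] := chain_measurable Yi Gi YE YNE.
have aeD := chain_ae Yi Gi YE YNE.
have fl := ae_filter_ringOfSetsType mu.
have [B yB] := Y_bounded (ltn0Sn N); have [my _ _] := yB.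
have [B' hB'] := h_bounded.
have lB : cbounded 0 1 (fun t => mi ^+ N.+1 * h t) (norm1 (mi ^+ N.+1) * B').
  exact: cboundedZ.
(* Extension by 0 outside ]0, 1[ gives a function measurable on the whole line, to which the closure
   properties of [cmeasurable] apply. *)
pose D' x : C := if 0 < x < 1 then derivn01 N.+1 y x else 0.
have D'm : cmeasurable D'.
  split.
    rewrite (_ : (fun x => _) =
      (fun x => complex.Re (derivn01 N.+1 y x)) \_ I01).
      by apply/(measurable_restrictT _ _).1.
    by apply/funext => x; rewrite /D' /patch mem_setE in_itv/=; case: ifP.
  rewrite (_ : (fun x => _) =
    (fun x => complex.Im (derivn01 N.+1 y x)) \_ I01).
    by apply/(measurable_restrictT _ _).1.
  by apply/funext => x; rewrite /D' /patch mem_setE in_itv/=; case: ifP.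
pose F x : C := mi ^+ N.+1 * D' x + \sum_(k < N) p01 k x * (mi ^+ k * Y k x).
have Fm : cmeasurable F.
  apply: cmeasurableD; first by apply: cmeasurableM => //; exact: cmeasurable_cst.
  apply: cmeasurable_sum => k; apply: cmeasurableM.
    exact: cintegrable_measurable.
  apply: cmeasurableM; first exact: cmeasurable_cst.
  by apply: cintegrable_measurable; apply: Yi; exact: ltnW.
have FE x : I01 x -> diff_expr p y x = F x.
  rewrite /= in_itv/= => x01; rewrite /diff_expr /F /Dn /D' x01; congr (_ + _).
  have x01' : 0 <= x <= 1 by case/andP: x01 => ? ?; rewrite !ltW.
  apply: eq_bigr => k _; rewrite /p01 x01 dE//.
  by apply: ltnW; exact: ltn_ord k.
(* The lower-order terms of l(y) cancel those built into [G]. What remains is bounded, which puts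
   l(y) in L^2 although its separate terms need not be there. *)
have aeF : {ae mu, forall x, I01 x -> diff_expr p y x = mi ^+ N.+1 * h x}.
  move: aeD; apply: filterS => x hx xI; rewrite FE//.
  have x01 : 0 < x < 1 by move: (xI); rewrite /= in_itv.
  rewrite /F /D' x01 (_ : derivn01 N.+1 y x = G x); last exact: hx.
  rewrite GE mulrBr.
  rewrite [X in _ - X + _](_ : _ = \sum_(k < N) p01 k x * (mi ^+ k * Y k x)) ?subrK//.
  rewrite mulr_sumr; apply: eq_bigr => k _; rewrite /qcoef.
  rewrite (insubT (fun k => (k < N)%N) (ltn_ord k)) /=.
  rewrite (_ : Sub _ _ = k); last by apply/val_inj.
  by rewrite !mulrA divff ?mul1r ?expf_neq0//; ring.
have eqm (f : C -> R) (A B0 : R -> C) : (forall x, I01 x -> A x = B0 x) ->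
    measurable_fun setT (fun x => f (B0 x)) -> measurable_fun I01 (fun x => f (A x)).
  move=> AB mB; apply: (eq_measurable_fun (fun x => f (B0 x))).
    by move=> x; rewrite inE => /AB ->.
  exact: measurable_funTS.
split; first split.
- apply: (inL2_ae (h := y) (B := B)) => //.
  + by apply: measurable_funTS; case: my.
  + by apply: measurable_funTS; case: my.
  + by apply: (@filterE _ _ fl) => x.
- by move=> k kN x x01; exact: (chain_derivable01 Yi Gi YE YNE).
- by move=> k kN; exact: (chain_abs_continuous Yi Gi YE YNE).
- apply: (inL2_ae _ _ lB aeF).
  + by apply: (eqm (@complex.Re R) _ _ FE); case: Fm.
  + by apply: (eqm (@complex.Im R) _ _ FE); case: Fm.
- move=> j; rewrite /bc_eval -[RHS](bc_w j).
  have a01 : 0 <= (0 : R) <= 1 by rewrite lexx ler01.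
  have b01 : 0 <= (1 : R) <= 1 by rewrite lexx ler01.
  have e0 (k : 'I_N.+1) : Dn k y 0 = w0 k.
    rewrite /Dn dE//; last by rewrite -ltnS.
    rewrite /Y Y0w//; have [A [_ _ ->]] := Y1b (ltn_ord k).
      by rewrite addr0 mulrA NiX_iX mul1r.
    by rewrite negb_and -!ltNge; apply/orP; left; exact: lt_trans d_gt0 d_lt.
  have e1 (k : 'I_N.+1) : Dn k y 1 = w1 k.
    rewrite /Dn dE//; last by rewrite -ltnS.
    rewrite /Y Y1w//; have [A [_ _ ->]] := Y0b (ltn_ord k).
      by rewrite add0r mulrA NiX_iX mul1r.
    by rewrite negb_and -!ltNge; apply/orP; right; move: d_lt d_gt0; lra.
  by congr (bc_form U j _ _); apply/funext.
have hyB := cboundedM lB (cbounded_conj yB).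
rewrite /inner (cintegral_ae (h := fun t => mi ^+ N.+1 * h t * conjc (y t))
    (B := norm1 (mi ^+ N.+1) * B' * B)) //; last first.
- by move: aeF; apply: filterS => x hx /hx ->.
- have Fym : cmeasurable (fun x => F x * conjc (y x)).
    by apply: cmeasurableM => //; exact: cmeasurable_conj.
  apply: (eqm (@complex.Im R) _ (fun x => F x * conjc (y x))); last by case: Fym.
  by move=> x xI; rewrite FE.
- have Fym : cmeasurable (fun x => F x * conjc (y x)).
    by apply: cmeasurableM => //; exact: cmeasurable_conj.
  apply: (eqm (@complex.Re R) _ (fun x => F x * conjc (y x))); last by case: Fym.
  by move=> x xI; rewrite FE.
have [A0 hA0] := h0b; have [A1 hA1] := h1b.
have [B0 hB0] := Y0b (ltn0Sn N); have [B1 hB1] := Y1b (ltn0Sn N).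
rewrite -ctotD; last 2 first.
- exact: cbounded_integrable (cboundedM hA0 (cbounded_conj hB0)).
- exact: cbounded_integrable (cboundedM hA1 (cbounded_conj hB1)).
rewrite -ctotZ; last first.
  apply: cintegrableD.
    exact: cbounded_integrable (cboundedM hA0 (cbounded_conj hB0)).
  exact: cbounded_integrable (cboundedM hA1 (cbounded_conj hB1)).
congr ctot; apply/funext => t; rewrite -mulrA; congr (_ * _).
rewrite /h /y /Y (rmorphD (@conjc R)).
case: hA0 hA1 hB0 hB1 => [_ _ zh0] [_ _ zh1] [_ _ zy0] [_ _ zy1].
(* On either side of d at most one layer is nonzero. *)
have [td|dt] := leP t d.
  have tn : ~~ (1 - d <= t <= 1).
    by rewrite negb_and -!ltNge; apply/orP; left; exact: le_lt_trans td d_lt.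
  by rewrite zh1// zy1// mul0r !addr0 (rmorph0 (@conjc R)) addr0.
have tn : ~~ (0 <= t <= d) by rewrite negb_and -!ltNge dt orbT.
by rewrite zh0// zy0// mul0r !add0r (rmorph0 (@conjc R)) add0r.
Qed.

End TwoLayers.

Section Dissipativity.
Variable R : realType.
Local Notation C := R[i].
Local Notation mi := (0 -i* 1 : C).

(* Under scaling at both endpoints only the leading parts of the boundary
   conditions and of the form (L y, y) survive. *)
Lemma bform_dissipative (N : nat) (p : 'I_N.+1.-1 -> R -> C)
    (U : normalized_bc R N.+1) (zeta0 zeta1 : nat -> C) :
  odd N -> (forall k, inL1 (p k)) -> dissipative p U ->
  (forall j : 'I_N.+1, zeta0 j *: bc_b0 U j + zeta1 j *: bc_b1 U j = 0) ->
  complex.Re (bform N.+1 zeta1) <= complex.Re (bform N.+1 zeta0).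
Proof.
move=> No pL1 dis hz.
have [K1 K10 hw] := bc_solve hz.
pose Z := \sum_(j < N.+1) (norm1 (zeta0 j) + norm1 (zeta1 j)) + K1.
have Z0 : 0 <= Z.
  by rewrite addr_ge0//; apply: sumr_ge0 => j _; rewrite addr_ge0 ?norm1_ge0.
have [K K0 [d0 /andP[d00 d03] hlay]] := layer_exists No (qcoef_int pL1) Z0.
have KK : 0 <= K + K1 by exact: addr_ge0.
have [Ka Ka0 ha] := bform_perturbation N.+1 zeta0 KK.
have [Kb Kb0 hb] := bform_perturbation N.+1 zeta1 KK.
(* [Ka] and [Kb] come from the two boundary forms. Each layer integral has error [K], and clearing
   the factor 1/2 in front of the forms doubles their sum. *)
pose K3 := Ka + Kb + 4 * K.
have K30 : 0 <= K3 by rewrite !addr_ge0// mulr_ge0.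
suff main d : 0 < d <= d0 ->
    complex.Re (bform N.+1 zeta1) <= complex.Re (bform N.+1 zeta0) + K3 * d.
  apply/ler_addgt0Pl => e e0.
  have K31 : 0 < K3 + 1 by rewrite ltr_pwDr.
  pose d := Num.min d0 (e / (K3 + 1)).
  have dpos : 0 < d by rewrite lt_min d00 divr_gt0.
  have dd0 : 0 < d <= d0 by rewrite dpos ge_min lexx.
  apply: le_trans (main d dd0) _; rewrite addrC lerD2r.
  have : d <= e / (K3 + 1) by rewrite ge_min lexx orbT.
  rewrite ler_pdivlMr//; apply: le_trans.
  by rewrite mulrDr mulr1 mulrC lerDl ltW.
move=> /andP[dp dd0].
have d3 : d <= 3^-1 by exact: le_trans d03.
have d1 : d <= 1 by rewrite (le_trans d3)// invf_le1// ler1n.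
have dp1 : 0 < d <= 1 by rewrite dp.
have dX k : 0 < d ^+ k by exact: exprn_gt0.
have [w0 [w1 [bcw wz]]] := hw d dp1.
(* Layers prescribe ordinary derivatives, which are i^j times the data D^j y. *)
have zw (zeta w : nat -> C) j : (j < N.+1)%N ->
    norm1 (w j - (d ^+ j)^-1%:C * zeta j) <= K1 * (d / d ^+ j) ->
    norm1 (zeta j) + K1 <= Z -> norm1 ((0 +i* 1) ^+ j * w j) <= Z / d ^+ j.
  move=> jN h hZ; rewrite norm1_iX -(subrK ((d ^+ j)^-1%:C * zeta j) (w j)).
  apply: le_trans (norm1D _ _) _; rewrite norm1_realM gtr0_norm ?invr_gt0//.
  apply: le_trans (_ : (norm1 (zeta j) + K1) / d ^+ j <= _); last first.
    by rewrite ler_wpM2r// invr_ge0 ltW.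
  rewrite mulrDl addrC [X in X + _]mulrC lerD2l (le_trans h)//.
  by rewrite ler_wpM2l// ler_piMl// invr_ge0 ltW.
have zS j : (j < N.+1)%N -> norm1 (zeta0 j) + norm1 (zeta1 j) <= Z - K1.
  move=> jN; rewrite /Z addrK (bigD1 (Ordinal jN))//= lerDl.
  by apply: sumr_ge0 => i _; rewrite addr_ge0 ?norm1_ge0.
have z0B j : (j < N.+1)%N -> norm1 ((0 +i* 1) ^+ j * w0 j) <= Z / d ^+ j.
  move=> jN; apply: (zw zeta0) => //; first by case: (wz j).
  by have := zS j jN; have := norm1_ge0 (zeta1 j); lra.
have z1B j : (j < N.+1)%N -> norm1 ((0 +i* 1) ^+ j * w1 j) <= Z / d ^+ j.
  move=> jN; apply: (zw zeta1) => //; first by case: (wz j).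
  by have := zS j jN; have := norm1_ge0 (zeta0 j); lra.
have dpd : 0 < d <= d0 by rewrite dp.
have [Y0 [h0 [E0 [Q0 [[a1 a2 a3 a4] [a5 a6 a7 a8]]]]]] :=
  hlay d 0 d true _ (subr0 d) dpd z0B.
have e1d : 1 - (1 - d) = d by ring.
have [Y1 [h1 [E1 [Q1 [[b1 b2 b3 b4] [b5 b6 b7 b8]]]]]] :=
  hlay d (1 - d) 1 false _ e1d dpd z1B.
have dp3 : 0 < d <= 3^-1 by rewrite dp.
have [ydom yinner] := two_layers_in_domain pL1 dp3 bcw a1 b1 a2 b2 a3 b3 a4 b4 a5 b5.
have := dis _ ydom; rewrite yinner mulrDr cImD.
set X0 := ctot _; set X1 := ctot _.
have imX (X Q : C) : norm1 (X - Q) <= K * (d / d ^+ N) ->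
    complex.Im (mi ^+ N.+1 * X) <= complex.Im (mi ^+ N.+1 * Q) + K * (d / d ^+ N).
  move=> h; rewrite -lerBlDl -cImB -mulrBr.
  apply: le_trans (ler_norm _) _; apply: le_trans (Im_le_norm1 _) _.
  by rewrite norm1_NiX.
have vz (w E zeta : nat -> C) j : (j < N.+1)%N ->
    norm1 (E j - (0 +i* 1) ^+ j * w j) <= K * (d / d ^+ j) ->
    norm1 (w j - (d ^+ j)^-1%:C * zeta j) <= K1 * (d / d ^+ j) ->
    norm1 (mi ^+ j * E j - (d ^+ j)^-1%:C * zeta j) <= (K + K1) * (d / d ^+ j).
  move=> jN hE hw'.
  have -> : mi ^+ j * E j - (d ^+ j)^-1%:C * zeta j =
      mi ^+ j * (E j - (0 +i* 1) ^+ j * w j) + (w j - (d ^+ j)^-1%:C * zeta j).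
    by rewrite mulrBr mulrA NiX_iX mul1r addrA subrK.
  by rewrite mulrDl; apply: le_trans (norm1D _ _) _; rewrite norm1_NiX lerD.
have va := ha d (fun j => mi ^+ j * E0 j) dp1
  (fun j jN => vz w0 E0 zeta0 j jN (a6 j jN) (wz j).1).
have vb := hb d (fun j => mi ^+ j * E1 j) dp1
  (fun j jN => vz w1 E1 zeta1 j jN (b6 j jN) (wz j).2).
have i0 := Im_lagrange a8 No; have i1 := Im_lagrange b8 No.
have x0 := imX _ _ a7; have x1 := imX _ _ b7.
rewrite i0 /= in x0; rewrite i1 /= in x1.
set B0 := bform _ _ in va x0; set B1 := bform _ _ in vb x1.
have rB (B zeta : C) (k : R) : norm1 (B - (d ^+ N)^-1%:C * zeta) <= k ->
    `|complex.Re B - (d ^+ N)^-1 * complex.Re zeta| <= k.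
  move=> h; apply: le_trans h; apply: le_trans (Re_le_norm1 _).
  by rewrite cReB; case: zeta => z1 z2; rewrite /= mul0r subr0.
have ra := rB _ _ _ va; have rb := rB _ _ _ vb.
move: ra rb; rewrite !ler_norml => /andP[_ ra] /andP[rb _] h.
have dN := dX N.
have hh : 0 <= (complex.Re B0 - complex.Re B1) / 2 + 2 * (K * (d / d ^+ N)).
  apply: le_trans h _; apply: le_trans (lerD x0 x1) _.
  by rewrite expr1 expr0; lra.
(* Multiplication by d^(n-1) removes the common scale and leaves an error linear in d. *)
have : 0 <= d ^+ N * ((complex.Re B0 - complex.Re B1) / 2 + 2 * (K * (d / d ^+ N))).
  by apply: mulr_ge0 => //; exact: ltW.
have ra' : d ^+ N * complex.Re B0 <= complex.Re (bform N.+1 zeta0) + Ka * d.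
  rewrite -ler_pdivlMl// mulrDr -lerBlDl (le_trans ra)// le_eqVlt; apply/orP; left.
  by apply/eqP; field; rewrite gt_eqF.
have rb' : complex.Re (bform N.+1 zeta1) - Kb * d <= d ^+ N * complex.Re B1.
  rewrite -ler_pdivrMl// mulrBr lerBlDl -lerBlDr.
  have : - (Kb * (d / d ^+ N)) = - ((d ^+ N)^-1 * (Kb * d)) by field; rewrite gt_eqF.
  by move: rb; set u := _ * complex.Re _; set v := (d ^+ N)^-1 * (_ * _); set t := Kb * _; lra.
have -> : d ^+ N * ((complex.Re B0 - complex.Re B1) / 2 + 2 * (K * (d / d ^+ N))) =
   (d ^+ N * complex.Re B0 - d ^+ N * complex.Re B1) / 2 + 2 * (K * d).
  by field; rewrite gt_eqF.
by move: ra' rb'; rewrite /K3; set u := d ^+ N * _; set v := d ^+ N * _; lra.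
Qed.

End Dissipativity.

(** * Roots of unity and the regularity determinant *)

Section ShiftedRootsOfUnity.
Variable R : realType.
Local Notation C := R[i].

Definition cis (x : R) : C := cos x +i* sin x.

Lemma cisD x y : cis (x + y) = cis x * cis y.
Proof.
by apply/eqP; rewrite eq_complex /= cosD sinD; apply/andP; split; apply/eqP; ring.
Qed.

Lemma cisX x n : cis x ^+ n = cis (x *+ n).
Proof.
elim: n => [|n IH]; last by rewrite exprS mulrS cisD IH.
by rewrite expr0 mulr0n /cis cos0 sin0.
Qed.

Lemma cisDpi x : cis (x + pi) = - cis x.
Proof. by rewrite /cis cosDpi sinDpi. Qed.

Lemma cis_pihalf : cis (pi / 2) = 'i.
Proof. by rewrite /cis cos_pihalf sin_pihalf. Qed.

Variable q : nat.
Hypothesis q_gt0 : (0 < q)%N.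

(* The roots w of w ^+ (2 q) = - 'i; those with index k < q lie in the upper
   half-plane and the remaining ones are their opposites. *)
Definition root_angle (k : nat) : R := pi / 2 * (4 * k + 3)%:R / (2 * q)%:R.

Let qR_gt0 : 0 < q%:R :> R. Proof. by rewrite ltr0n. Qed.

Lemma root_angle_itv k : (k < q)%N -> 0 < root_angle k < pi.
Proof.
move=> kq; have pi0 := pi_gt0 R.
have kq' : k%:R + 1 <= q%:R :> R by rewrite natr1 ler_nat.
have k0 : 0 <= k%:R :> R by rewrite ler0n.
rewrite /root_angle natrD !natrM; apply/andP; split.
  by rewrite !mulr_gt0 ?invr_gt0 ?mulr_gt0//; lra.
rewrite ltr_pdivrMr ?mulr_gt0//.
have : pi * (4 * k%:R + 3) < pi * (4 * q%:R) :> R by rewrite ltr_pM2l//; lra.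
by lra.
Qed.

Lemma root_angleX k : cis (root_angle k) ^+ (2 * q) = - 'i.
Proof.
have n0 : (2 * q)%:R != 0 :> R by rewrite pnatr_eq0 muln_eq0 -lt0n q_gt0.
have e : root_angle k *+ (2 * q) = pi / 2 *+ (4 * k + 3).
  by rewrite /root_angle -[LHS]mulr_natr divfK// mulr_natr.
rewrite cisX e -cisX cis_pihalf exprD exprM.
have -> : ('i : C) ^+ 4 = 1 by rewrite (exprM _ 2 2) sqr_i sqrrN expr1n.
by rewrite expr1n mul1r exprS sqr_i mulrN1.
Qed.

Lemma root_angleD k : cis (root_angle (q + k)) = - cis (root_angle k).
Proof.
rewrite -cisDpi; congr cis; rewrite /root_angle mulnDr.
have q0 : q%:R != 0 :> R by rewrite pnatr_eq0 -lt0n.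
have -> : (4 * q + 4 * k + 3)%:R = 4 * q%:R + 4 * k%:R + 3 :> R by rewrite natrD natrD !natrM.
have -> : (4 * k + 3)%:R = 4 * k%:R + 3 :> R by rewrite natrD natrM.
by rewrite natrM; field; rewrite pnatr_eq0 -lt0n.
Qed.

(** The roots of w^(2q) = -i are the roots of unity turned by a fixed rotation. On the condition of
    order j the rotation acts as a common factor, so a kernel vector of the regularity matrix keeps
    its meaning. *)
Lemma cis_root_angle k : root_unity R (2 * q) k * cis (root_angle 0) =
  cis (root_angle k).
Proof.
rewrite -[root_unity _ _ _]/(cis _) -cisD; congr cis.
rewrite /root_angle muln0 add0n.
have -> : (4 * k + 3)%:R = 4 * k%:R + 3 :> R by rewrite natrD natrM.
by rewrite natrM; field; rewrite pnatr_eq0 -lt0n.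
Qed.

Lemma cis_root_angle_inj k l : (k < q)%N -> (l < q)%N ->
  cis (root_angle k) = cis (root_angle l) -> k = l.
Proof.
move=> kq lq [cc _].
have /andP[k0 k1] := root_angle_itv kq; have /andP[l0 l1] := root_angle_itv lq.
have : root_angle k = root_angle l.
  by apply: cos_inj => //; rewrite in_itv/= !ltW.
rewrite /root_angle => /(congr1 (fun x => x * (2 * q)%:R / (pi / 2))).
have pi0 : pi != 0 :> R by rewrite gt_eqF// pi_gt0.
have n0 : (2 * q)%:R != 0 :> R by rewrite pnatr_eq0 muln_eq0 -lt0n.
have e (x : R) : pi / 2 * x / (2 * q)%:R * (2 * q)%:R / (pi / 2) = x.
  have p2 : pi / 2 != 0 :> R by rewrite mulf_neq0// invr_eq0 pnatr_eq0.
  by rewrite divfK// mulrAC divff// mul1r.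
rewrite !e => /eqP; rewrite eqr_nat => /eqP; lia.
Qed.

End ShiftedRootsOfUnity.

(** * Kernel vectors of the regularity matrix *)

Section ThetaKernel.
Variable R : realType.
Local Notation C := R[i].

Lemma Bcol_entry n (r : 'I_n -> nat) (hr : (\sum_(j < n) r j)%N = n)
    (b : forall j, 'cV[C]_(r j)) k (j : 'I_n) (i : 'I_(r j)) :
  Bcol hr b k (cast_ord hr (tagnat.Rank j i)) 0 =
  root_unity R n k ^+ j * b j i 0.
Proof.
rewrite /Bcol castmxE/= cast_ordK.
have := mxcolK (fun j => root_unity R n k ^+ j *: b j) j.
move=> /matrixP/(_ i 0); rewrite [LHS]mxE [RHS]mxE => <-.
by congr (fun_of_matrix _ _ _); apply/val_inj.
Qed.

Lemma Theta_kernel n (r : 'I_n -> nat) (hr : (\sum_(j < n) r j)%N = n)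
    (b0 b1 : forall j, 'cV[C]_(r j)) : Theta hr b0 b1 = 0 ->
  exists2 c : nat -> C, exists2 k, (k < n)%N & c k != 0 &
  forall j : 'I_n, \sum_(0 <= k < n./2) (c k * root_unity R n k ^+ j) *: b0 j +
    \sum_(n./2 <= k < n) (c k * root_unity R n k ^+ j) *: b1 j = 0.
Proof.
rewrite /Theta -det_tr => /eqP/det0P[v v0 vT].
have [k0 vk0] : exists k, v 0 k != 0.
  by have /rV0Pn[k] := v0; exists k.
(* The vector is extended by 0 to all indices, so that its second half can be re-indexed by a
   shift. *)
pose c k := if insub k is Some i then v 0 i else 0.
have cE (k : 'I_n) : c k = v 0 k.
  rewrite /c (insubT (fun k => (k < n)%N) (ltn_ord k)); congr (v 0 _).
  exact/val_inj.
exists c; first by exists k0; rewrite ?cE.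
move=> j; apply/colP => i; rewrite mxE summxE summxE mxE.
have := congr1 (fun M : 'rV_n => M 0 (cast_ord hr (tagnat.Rank j i))) vT.
rewrite !mxE => vTs; rewrite -[RHS]vTs {vTs}.
have n2 : (n./2 <= n)%N by rewrite leq_half_double -addnn -addnS leq_addr.
pose F k := if (k < n./2)%N then c k * root_unity R n k ^+ j * b0 j i 0
  else c k * root_unity R n k ^+ j * b1 j i 0.
transitivity (\sum_(0 <= k < n) F k).
  rewrite [RHS](@big_cat_nat _ _ _ n./2)//=; congr (_ + _); apply: eq_big_nat => k /andP[k1 k2].
    by rewrite /F k2 mxE.
  by rewrite /F ltnNge k1 mxE.
rewrite big_mkord; apply: eq_bigr => k _; rewrite !mxE /F cE.
by case: ifP => _; rewrite Bcol_entry mulrA.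
Qed.

End ThetaKernel.

Theorem theorem1p1 (R : realType) (n : nat) (n_ge2 : (2 <= n)%N)
    (n_even : ~~ odd n) (p : 'I_n.-1 -> R -> R[i]%C)
    (p_L1 : forall k, inL1 (p k)) (U : normalized_bc R n) :
  dissipative p U -> birkhoff_regular U.
Proof.
case: n n_ge2 n_even p p_L1 U => [//|N] n_ge2 n_even p p_L1 U dis.
have No : odd N by move: n_even; rewrite /= negbK.
apply/eqP => /Theta_kernel[c [k0 k0n ck0] cE].
pose q := N.+1./2.
have nq : N.+1 = (2 * q)%N by rewrite mul2n even_halfK.
have q_gt0 : (0 < q)%N by move: n_ge2; rewrite nq; case: (q).
pose w k := cis (root_angle R q k).
(* exp(i w x) = exp(-s x): the upper half-plane is turned into the right half-plane of the Cauchy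
   form. *)
pose s k := - 'i * w k.
have w_im k : (k < q)%N -> 0 < complex.Im (w k).
  by move=> kq; apply: sin_gt0_pi; exact: root_angle_itv.
have s_re k : (k < q)%N -> 0 < complex.Re (s k).
  move=> /w_im; rewrite /s; case: (w k) => x y /= y0.
  by rewrite oppr0 mul0r sub0r mulN1r opprK.
have s_inj k l : (k < q)%N -> (l < q)%N -> s k = s l -> k = l.
  move=> kq lq /mulfI e; apply: (cis_root_angle_inj q_gt0 kq lq); apply: e.
  by rewrite oppr_eq0 neq0Ci.
have sE k l : s k + conjc (s l) = - 'i * (w k - conjc (w l)).
  by rewrite /s; case: (w k) (w l) => x y [x' y']; simpc;
    apply/eqP; rewrite eq_complex /=; apply/andP; split; apply/eqP; ring.
have wd k l : (k < q)%N -> (l < q)%N -> w k - conjc (w l) != 0.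
  move=> kq lq; have := Re_gt0_addJ_neq0 (s_re k kq) (s_re l lq).
  by rewrite sE mulf_eq0 negb_or => /andP[].
(* Index q + k belongs to the root [- w k], whose exponential decays on ]-oo, 0] and is attached to
   the endpoint 1. *)
pose c1 k := c (q + k)%N.
pose zeta0 j : R[i] := \sum_(k < q) c k * w k ^+ j.
pose zeta1 j : R[i] := \sum_(k < q) c1 k * (- w k) ^+ j.
have i2 : 'i * 'i = -1 :> R[i] by rewrite -expr2 sqr_i.
have g0 : bform N.+1 zeta0 = - 2 * gram s c q.
  rewrite /zeta0 bform_exp//; last by move=> k kq; rewrite nq root_angleX.
  rewrite -mulrA; congr (_ * _); rewrite mulr_sumr; apply: eq_bigr => k _.
  rewrite mulr_sumr; apply: eq_bigr => l _; rewrite sE invfM invrN invCi opprK.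
  by rewrite -!mulrA mulrCA; congr (_ * _); rewrite mulrCA.
have g1 : bform N.+1 zeta1 = 2 * gram s c1 q.
  have wdN k l : (k < q)%N -> (l < q)%N -> - w k - conjc (- w l) != 0.
    move=> kq lq; rewrite (_ : _ - _ = - (w k - conjc (w l))) ?oppr_eq0 ?wd//.
    by rewrite (rmorphN (@conjc R)) opprB opprK addrC.
  rewrite /zeta1 (bform_exp (w := fun k => - w k))//; last first.
    move=> k kq; rewrite exprNn nq root_angleX// exprM.
    by rewrite sqrrN expr1n expr1n mul1r.
  rewrite mulNr -mulrN -mulrA; congr (_ * _).
  rewrite mulr_sumr; apply: eq_bigr => k _; rewrite mulr_sumr; apply: eq_bigr => l _.
  rewrite (_ : - w k - conjc (- w l) = - (w k - conjc (w l))); last first.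
    by rewrite (rmorphN (@conjc R)) opprB opprK addrC.
  rewrite sE invfM !invrN invCi opprK; ring.
have hz (j : 'I_N.+1) : zeta0 j *: bc_b0 U j + zeta1 j *: bc_b1 U j = 0.
  (* Multiplying the condition of order j by the j-th power of the rotation replaces the roots of
     unity by the [w k] and their opposites. *)
  have := cE j; move/(congr1 (fun M => cis (root_angle R q 0) ^+ j *: M)).
  rewrite scaler0 => <-; rewrite scalerDr; congr (_ + _).
    rewrite /zeta0 scaler_suml scaler_sumr big_mkord; apply: eq_bigr => k _.
    by rewrite scalerA /w -(cis_root_angle R q_gt0 k) -nq exprMn; congr (_ *: _); ring.
  have Nq : (N.+1 - N.+1./2 = q)%N by rewrite -/q [X in (X - _)%N]nq mul2n -addnn addnK.
  rewrite /zeta1 scaler_suml scaler_sumr -{1}[N.+1./2]add0n big_addn Nq big_mkord.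
  apply: eq_bigr => k _.
  rewrite scalerA /c1 /w -(root_angleD R q_gt0 k) -(cis_root_angle R q_gt0) -nq.
  by rewrite addnC exprMn; congr (_ *: _); ring.
have := bform_dissipative No p_L1 dis hz.
rewrite g0 g1.
have [p0 e0] := gram_ge0_eq0 c s_re s_inj.
have [p1 e1] := gram_ge0_eq0 c1 s_re s_inj.
move: p0 p1 e0 e1; case: (gram s c q) => x0 y0; case: (gram s c1 q) => x1 y1.
rewrite !lecE /= => /andP[/eqP y00 x00] /andP[/eqP y10 x10] e0 e1.
(* [h] amounts to 2 x1 <= -2 x0 with x0 and x1 nonnegative, so both Gram forms vanish. *)
rewrite y00 y10 !mulr0 !subr0 => h.
have x0E : x0 = 0 by lra.
have x1E : x1 = 0 by lra.
have z0 := e0 ltac:(by rewrite x0E y00).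
have z1 := e1 ltac:(by rewrite x1E y10).
case/eqP: ck0; have [kq|qk] := ltnP k0 q; first exact: z0.
have := z1 (k0 - q)%N; rewrite /c1 subnKC//; apply.
by rewrite ltn_subLR// addnn -mul2n -nq.
Qed.
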